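(* Let $0<\varepsilon\le 1$ be a constant, $s=s(n)$ an integer with $|s|\le(1-\varepsilon)n$, $z\in\mathbb C$ fixed, and $F_n$ a deterministic $n\times n$ matrix all of whose rows equal a given vector in $\{-1,1\}^n$. Let $\mathbf f_1,\dots,\mathbf f_n$ be the rows of $F_n+z\sqrt n I_n$. Let $\mathbf x_1,\dots,\mathbf x_n$ be independent random vectors, each uniform on the set $\mathcal S$ of vectors in $\{-1,1\}^n$ with coordinate sum $s-1$ or $s+1$, and let $\mathbf x_1',\dots,\mathbf x_n'$ be independent random vectors whose coordinates are i.i.d. copies of $x$ with $\mathbb P(x=-1)=\frac12-\frac{s}{2n}$, $\mathbb P(x=1)=\frac12+\frac{s}{2n}$. Let $V_{i-1}$ be the span of $\mathbf x_1+\mathbf f_1,\dots,\mathbf x_{i-1}+\mathbf f_{i-1}$ and $V_{i-1}'$ the span of $\mathbf x_1'+\mathbf f_1,\dots,\mathbf x_{i-1}'+\mathbf f_{i-1}$. Let $m=n-\log^8 n$ and $$S_2=\prod_{m<i\le n}\mathrm{dist}(\mathbf x_i+\mathbf f_i,V_{i-1}),\qquad S_2'=\prod_{m<i\le n}\mathrm{dist}(\mathbf x_i'+\mathbf f_i,V_{i-1}').$$ Then with probability $1-O(n^{-100})$ we have $\frac1n(|\log S_2|+|\log S_2'|)=O(\log^9 n/n)$. *)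

(* Defs.v *)
From HB Require Import structures.
From mathcomp Require Import all_boot all_order all_algebra.
From mathcomp Require Import boolp classical_sets reals exp.
From mathcomp Require Import complex.
Set Implicit Arguments. Unset Strict Implicit. Unset Printing Implicit Defensive.
Import Order.TTheory GRing.Theory Num.Theory.
Local Open Scope ring_scope.

Section Defs.
Variable R : realType.

Definition sgn (b : bool) : R := if b then 1 else -1.
Definition signvec n := {ffun 'I_n -> bool}.
Definition family n := {ffun 'I_n -> signvec n}.

Definition vsum n (v : signvec n) : int :=
  \sum_(j < n) (if v j then 1 else -1)%R.

Definition setS n (s : int) : {set signvec n} :=
  [set v : signvec n | (vsum v == s - 1) || (vsum v == s + 1)].

Definition wS n (s : int) (v : signvec n) : R :=
  if v \in setS n s then (#|setS n s|%:R)^-1 else 0.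

Definition wB n (s : int) (v : signvec n) : R :=
  \prod_(j < n) (if v j then 2^-1 + s%:~R / (2 * n%:R)
                 else 2^-1 - s%:~R / (2 * n%:R)).

Definition wfam n (w : signvec n -> R) (X : family n) : R :=
  \prod_(i < n) w (X i).

Definition prob n (s : int) (E : family n -> family n -> bool) : R :=
  \sum_(X : family n) \sum_(X' : family n)
     (if E X X' then wfam (wS s) X * wfam (wB s) X' else 0).

Definition cvec n := 'I_n -> R[i].

Definition cnorm n (v : cvec n) : R :=
  Num.sqrt (\sum_(j < n) (complex.Re (v j) ^+ 2 + complex.Im (v j) ^+ 2)).

Definition dist_span n (v : cvec n) (w : 'I_n -> cvec n) (k : nat) : R :=
  inf [set d : R | exists c : 'I_n -> R[i],
        d = cnorm (fun l => v l - \sum_(j < n | (j < k)%N) c j * w j l)]%classic.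

(* the rows x_i + f_i, where f_i is row i of F_n + z sqrt(n) I_n and every row of
   F_n equals the sign vector r *)
Definition row_vec n (z : R[i]) (r : signvec n) (X : family n) (i : 'I_n) : cvec n :=
  fun l => (sgn (X i l))%:C%C + (sgn (r l))%:C%C
           + (if i == l then z * (Num.sqrt n%:R)%:C%C else 0).

(* S_2 = prod_{m < i <= n} dist(x_i + f_i, V_{i-1}), m = n - log^8 n;
   with 0-based index k = i - 1, V_{i-1} spans the rows of index < k *)
Definition S2 n (z : R[i]) (r : signvec n) (X : family n) : R :=
  \prod_(k < n | (n%:R : R) - ln (n%:R : R) ^+ 8 < (k.+1)%:R)
     dist_span (row_vec z r X k) (row_vec z r X) k.

End Defs.

Arguments prob {R n}.
Arguments S2 {R n}.
Arguments signvec : clear implicits.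

(* Main.v *)
(** For [k] close to [n] the distance of row [k] to the span of the previous
    rows is at least [|<row k, v>| / 2n] for any normal vector [v] of that span
    with sup norm 1, so a lower bound [n^-c] fails with probability [O(n^-102)]
    unless [v] is "bad": its small-ball probability at some polynomial scale is
    at least [n^-102].  Bad vectors are ruled out by a union bound over a net.

    The net comes from an elementary inverse Littlewood-Offord argument.  For a
    set [I] of coordinates let [h_I u] be the probability that
    [Y_I = sum_(i in I) b_i v_i] lies in [u + B], with [B] a box.  Adding a
    coordinate [i] to [I] multiplies [||h_I||_2^2] by a factor [1 - c lam^2]
    unless the translation by [v_i] moves [h_I] by at most [lam ||h_I||_2].
    Hence a greedily chosen [I] of size [O(log n / lam^2)], much less than [n],
    makes every other [v_i] such an almost period of [h_I].  Almost periods add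
    up: from [m] separated ones, sums of [j <= 1/lam] terms yield about [m/lam]
    separated translations under which [h_I] keeps half of its correlation with
    itself, and there are only [O(1/rho)] of those, [rho] being the small-ball
    probability.  So each coordinate outside [I] has only [1 + O(lam/rho)]
    possible values up to the scale of [B], against a probability [O(rho)] for
    each row to be orthogonal to [v], and the union bound wins.

    Rounding [v] costs a polynomial factor in the scale; by pigeonhole over
    boundedly many scales some such change of scale multiplies the small-ball
    probability by at most [n^(1/30)].

    The uniform measure on the two slices is at most [O(sqrt n)] times the
    Bernoulli measure restricted to them.  To absorb this loss the sum of the
    bits is recorded as an extra coordinate of [Y]; sums of different numbers
    of almost periods are then separated, and [lam] improves to [lam^2]. *)

From HB Require Import structures.
From mathcomp Require Import all_boot all_order all_algebra.
From mathcomp Require Import boolp classical_sets reals exp.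
From mathcomp Require Import complex.
From mathcomp Require Import zify ring lra.
Require Import Defs.
Set Implicit Arguments. Unset Strict Implicit. Unset Printing Implicit Defensive.
Import Order.TTheory GRing.Theory Num.Theory.
Local Open Scope ring_scope.

(** * Product measures and Bernoulli sums *)

Section ProductMeasure.
Variables (R : realFieldType) (I T : finType) (w : T -> R).

Definition upd (X : {ffun I -> T}) (k : I) (y : T) : {ffun I -> T} :=
  [ffun i => if i == k then y else X i].

Definition pexp (F : {ffun I -> T} -> R) : R :=
  \sum_(X : {ffun I -> T}) (\prod_i w (X i)) * F X.

(** Swapping the old value of coordinate [k] with the fresh one is an involution that preserves the
    product weight. *)
Lemma pexp_resample (k : I) (F : {ffun I -> T} -> R) :
  \sum_y w y = 1 ->
  pexp F = pexp (fun X => \sum_y w y * F (upd X k y)).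
Proof.
move=> w1; rewrite /pexp.
pose S (p : {ffun I -> T} * T) := (upd p.1 k p.2, p.1 k).
have SK : cancel S S.
  case=> X y; rewrite /S /=; congr (_, _); last by rewrite ffunE eqxx.
  by apply/ffunP=> i; rewrite !ffunE; case: eqP => [->|].
transitivity (\sum_(p : {ffun I -> T} * T) ((\prod_i w (p.1 i)) * F p.1) * w p.2).
  rewrite -(pair_bigA _ (fun (X : {ffun I -> T}) y => ((\prod_i w (X i)) * F X) * w y)) /=.
  by apply: eq_bigr => X _; rewrite -mulr_sumr w1 mulr1.
rewrite (reindex_inj (can_inj SK)) /=.
rewrite -(pair_bigA _ (fun (X : {ffun I -> T}) y => ((\prod_i w (upd X k y i)) * F (upd X k y)) * w (X k))) /=.
apply: eq_bigr => X _; rewrite mulr_sumr; apply: eq_bigr => y _.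
rewrite (bigD1 k) //= ffunE eqxx [\prod_i w (X i)](bigD1 k) //=.
rewrite (_ : \prod_(i | i != k) w (upd X k y i) = \prod_(i | i != k) w (X i)); first by ring.
by apply: eq_bigr => i /negbTE ik; rewrite ffunE ik.
Qed.

Lemma pexp_prod (f : I -> T -> R) :
  pexp (fun X => \prod_i f i (X i)) = \prod_i \sum_y w y * f i y.
Proof.
rewrite bigA_distr_bigA; apply: eq_bigr => X _.
by rewrite -big_split.
Qed.

Lemma pexp1 : \sum_y w y = 1 -> pexp (fun=> 1) = 1.
Proof.
move=> w1; transitivity (pexp (fun X => \prod_(i : I) 1)).
  by apply: eq_bigr => X _; rewrite big1_eq.
by rewrite (pexp_prod (fun _ _ => 1)) big1 // => i _; under eq_bigr do rewrite mulr1.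
Qed.

Lemma pexpD F G : pexp (fun X => F X + G X) = pexp F + pexp G.
Proof. by rewrite -big_split /=; apply: eq_bigr => X _; rewrite mulrDr. Qed.

Lemma pexpZ (c : R) F : pexp (fun X => c * F X) = c * pexp F.
Proof. by rewrite mulr_sumr; apply: eq_bigr => X _; rewrite mulrCA. Qed.

Lemma pexp_sum (J : Type) (r : seq J) (P : pred J) (F : J -> {ffun I -> T} -> R) :
  pexp (fun X => \sum_(j <- r | P j) F j X) = \sum_(j <- r | P j) pexp (F j).
Proof. by rewrite exchange_big; apply: eq_bigr => X _; rewrite mulr_sumr. Qed.

Lemma eq_pexp F G : F =1 G -> pexp F = pexp G.
Proof. by move=> FG; apply: eq_bigr => X _; rewrite FG. Qed.

Hypothesis w0 : forall y, 0 <= w y.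

Lemma ler_pexp F G : (forall X, F X <= G X) -> pexp F <= pexp G.
Proof.
by move=> FG; apply: ler_sum => X _; apply: ler_wpM2l => //; apply: prodr_ge0.
Qed.

End ProductMeasure.

Section BernoulliSums.
Variables (R : realFieldType) (V : zmodType) (p : R).

Definition bw (b : bool) : R := if b then p else 1 - p.

Lemma bw_sum : \sum_(b : bool) bw b = 1.
Proof. by rewrite big_bool /= addrC subrK. Qed.

(* The expectation of [F] at the sum of the elements of [s], each kept
   independently with probability [p]; see [ev_pexp]. *)
Fixpoint ev (s : seq V) (F : V -> R) : R :=
  if s is a :: s' then (1 - p) * ev s' F + p * ev s' (fun y => F (a + y)) else F 0.

Lemma eq_ev s F G : F =1 G -> ev s F = ev s G.
Proof.
elim: s F G => [|a s IH] F G FG /=; first exact: FG.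
by congr (_ * _ + _ * _); apply: IH => // y; exact: FG.
Qed.

(** The list recursion suits inductions; this form in random bits shows that the order of the list
    is irrelevant. *)
Lemma ev_pexp (I : finType) (f : I -> V) (s : seq I) (F : V -> R) : uniq s ->
  pexp bw (fun b : {ffun I -> bool} => F (\sum_(i <- s) (if b i then f i else 0)))
  = ev (map f s) F.
Proof.
elim: s F => [|i s IH] F /=.
  move=> _; transitivity (pexp bw (fun b : {ffun I -> bool} => F 0 * 1)).
    by apply: eq_pexp => b; rewrite big_nil mulr1.
  by rewrite pexpZ pexp1 ?mulr1 // bw_sum.
case/andP=> nis us; rewrite (pexp_resample i) ?bw_sum //.
rewrite -!IH // -!pexpZ -pexpD; apply: eq_pexp => b.
rewrite big_bool /= addrC !big_cons !ffunE eqxx add0r.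
have E y : \sum_(j <- s) (if upd b i y j then f j else 0)
         = \sum_(j <- s) (if b j then f j else 0).
  apply: eq_big_seq => j js; rewrite ffunE; case: eqP => // ji.
  by rewrite -ji js in nis.
by rewrite !E.
Qed.

Lemma evZ s c F : ev s (fun y => c * F y) = c * ev s F.
Proof.
elim: s F => [|a s IH] F //=.
by rewrite IH (IH (fun y => F (a + y))); ring.
Qed.

Lemma ev_const s c : ev s (fun=> c) = c.
Proof. by elim: s => //= a s ->; ring. Qed.

Lemma ev_sum (J : Type) (r : seq J) (P : pred J) s (F : J -> V -> R) :
  ev s (fun y => \sum_(j <- r | P j) F j y) = \sum_(j <- r | P j) ev s (F j).
Proof.
elim: s F => [|a s IH] F //=.
by rewrite IH (IH (fun j y => F j (a + y))) !mulr_sumr -big_split.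
Qed.

Lemma ev_cat s1 s2 F :
  ev (s1 ++ s2) F = ev s1 (fun y => ev s2 (fun y' => F (y + y'))).
Proof.
elim: s1 F => [|a s IH] F /=; first by apply: eq_ev => y; rewrite add0r.
rewrite !IH; congr (_ + _ * _); apply: eq_ev => y; apply: eq_ev => y'.
by rewrite addrA.
Qed.

Hypothesis p01 : 0 <= p <= 1.

Lemma ler_ev s F G : (forall y, F y <= G y) -> ev s F <= ev s G.
Proof.
move: p01 => /andP [p0 p1].
elim: s F G => [|a s IH] F G FG /=; first exact: FG.
by apply: lerD; apply: ler_wpM2l; rewrite ?subr_ge0 //; apply: IH => // y; exact: FG.
Qed.

End BernoulliSums.

(** * Concentration functions, energy and almost periods *)

Section Energy.
Variables (R : realFieldType) (V : finZmodType) (p : R) (B : {set V}).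
Hypothesis p01 : 0 <= p <= 1.
Implicit Types s : seq V.

(** [conc s] is the function h of the overview, [nrg s] its squared L2 norm and [incr s a] its
    squared L2 distance to the translate by [a]. An almost period is an [a] with [incr s a] small
    against [nrg s]. *)
Definition conc s (u : V) : R := ev p s (fun y => (y - u \in B)%:R).
Definition nrg s : R := \sum_u conc s u ^+ 2.
Definition incr s (a : V) : R := \sum_u (conc s (u - a) - conc s u) ^+ 2.

Lemma conc_cons a s u :
  conc (a :: s) u = (1 - p) * conc s u + p * conc s (u - a).
Proof.
rewrite /conc /=; congr (_ + _ * _); apply: eq_ev => y.
by rewrite opprB addrCA addrA.
Qed.

Lemma conc_ge0 s u : 0 <= conc s u.
Proof. by rewrite -(ev_const p s 0); apply: ler_ev. Qed.

Lemma conc_le1 s u : conc s u <= 1.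
Proof. by rewrite -(ev_const p s 1); apply: ler_ev => // y; rewrite lern1 leq_b1. Qed.

Lemma sum_translate (f : V -> R) a : \sum_u f (u - a) = \sum_u f u.
Proof. by rewrite [RHS](reindex_inj (addIr (- a))). Qed.

Lemma conc_sum s : \sum_u conc s u = #|B|%:R.
Proof.
elim: s => [|a s IH].
  rewrite /conc /= -sum1_card natr_sum (reindex_inj oppr_inj) big_mkcond /=.
  rewrite [RHS]big_mkcond; apply: eq_bigr => u _.
  by rewrite opprK add0r; case: (u \in B).
under eq_bigr do rewrite conc_cons.
by rewrite big_split /= -!mulr_sumr (sum_translate (conc s)) IH; ring.
Qed.

(** The defect in the convexity of the square: [((1-p)x + py)^2 = (1-p)x^2 + py^2 - p(1-p)(x-y)^2],
    summed over all translates. *)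
Lemma nrg_cons a s : nrg (a :: s) = nrg s - p * (1 - p) * incr s a.
Proof.
have E : \sum_u conc s (u - a) ^+ 2 = nrg s by rewrite (sum_translate (fun u => conc s u ^+ 2)).
rewrite /nrg -/(nrg s).
transitivity (\sum_u ((1 - p) * conc s u ^+ 2 + p * conc s (u - a) ^+ 2
   - p * (1 - p) * (conc s (u - a) - conc s u) ^+ 2)).
  by apply: eq_bigr => u _; rewrite conc_cons; ring.
by rewrite big_split big_split sumrN -!mulr_sumr E /= -/(nrg s) -/(incr s a); ring.
Qed.

Lemma nrg_ge0 s : 0 <= nrg s.
Proof. by apply: sumr_ge0 => u _; exact: sqr_ge0. Qed.

Lemma nrg_nil : nrg [::] = #|B|%:R.
Proof.
rewrite -(conc_sum [::]); apply: eq_bigr => u _; rewrite /conc /=.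
by case: (_ \in B); rewrite ?expr1n // expr0n.
Qed.

Lemma incr_shift s a b :
  \sum_u (conc s (u - a - b) - conc s (u - b)) ^+ 2 = incr s a.
Proof.
transitivity (\sum_u (fun u => (conc s (u - a) - conc s u) ^+ 2) (u - b)).
  by apply: eq_bigr => u _; rewrite addrAC.
exact: sum_translate.
Qed.

(** The triangle inequality for the L2 norm, kept in squared form because the base field need not
    have square roots. *)
Lemma incr_sum s (c : R) (l : seq V) : (forall a, a \in l -> incr s a <= c) ->
  incr s (\sum_(a <- l) a) <= (size l)%:R ^+ 2 * c.
Proof.
elim: l => [_|a l IH al].
  rewrite big_nil /incr big1 ?expr0n ?mul0r // => u _.
  by rewrite subr0 subrr expr0n.
have ac : incr s a <= c by apply: al; rewrite mem_head.
have lc : forall x, x \in l -> incr s x <= c by move=> x xl; apply: al; rewrite inE xl orbT.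
case: l IH lc {al} => [|b l] IH lc.
  by rewrite big_cons big_nil addr0 /= expr1n mul1r.
rewrite big_cons; set v := \sum_(_ <- _) _ in IH *; rewrite [size _]/=.
move: {IH} (IH lc); rewrite [size _]/=; set k := (size l).+1 => vk.
have k0 : 0 < k%:R :> R by rewrite ltr0n.
(* [(x+y)^2 <= (1+1/k) x^2 + (1+k) y^2]: with these weights the bounds [k^2 c] and [c] add up
   exactly to [(k+1)^2 c]. *)
suff : incr s (a + v) <= (k.+1%:R / k%:R) * incr s v + k.+1%:R * incr s a.
  move/le_trans; apply.
  have -> : k.+1%:R ^+ 2 * c = (k.+1%:R / k%:R) * (k%:R ^+ 2 * c) + k.+1%:R * c.
    by rewrite -natr1; field; rewrite gt_eqF.
  by apply: lerD; apply: ler_wpM2l => //; rewrite ?divr_ge0 ?ler0n.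
rewrite -[in X in _ <= X](incr_shift s a v) /incr !mulr_sumr -big_split /=.
apply: ler_sum => u _; rewrite opprD addrA.
set x := conc s (u - a - v); set y := conc s (u - v); set z' := conc s u.
rewrite -natr1 -subr_ge0.
have -> : (k%:R + 1) / k%:R * (y - z') ^+ 2 + (k%:R + 1) * (x - y) ^+ 2 - (x - z') ^+ 2
  = ((y - z') - k%:R * (x - y)) ^+ 2 / k%:R by field; rewrite gt_eqF.
by rewrite divr_ge0 ?sqr_ge0 // ltW.
Qed.

(* Each translation [g k] keeps half of the autocorrelation of [conc s], while
   disjointness of the translates of [B] bounds the sum of all correlations. *)
Lemma packing s (K : finType) (g : K -> V) :
  (forall k k' x, g k - x \in B -> g k' - x \in B -> k = k') ->
  (forall k, incr s (g k) <= nrg s) ->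
  #|K|%:R * nrg s <= 2 * #|B|%:R.
Proof.
move=> sep small.
(* Induction on [t]: for the empty list at most one translate of [B] contains the point, and
   averaging preserves the bound. *)
have S1 t u : \sum_k conc t (u - g k) <= 1.
  elim: t u => [|a t IH] u; last first.
    under eq_bigr do rewrite conc_cons.
    rewrite big_split /= -!mulr_sumr.
    under [X in _ + p * X]eq_bigr do rewrite addrAC.
    move: p01 => /andP [p0 p1].
    apply: le_trans (_ : (1 - p) * 1 + p * 1 <= _); last by lra.
    by apply: lerD; apply: ler_wpM2l; rewrite ?subr_ge0.
  rewrite /conc /= -natr_sum (_ : 1 = 1%:R) // ler_nat.
  case: (pickP (fun k => 0 - (u - g k) \in B)) => [k kB|no]; last first.
    by rewrite big1 // => k _; rewrite no.
  rewrite (bigD1 k) //= kB big1 // => k' /negP kk'.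
  case: (boolP (_ \in B)) => // k'B; case: kk'.
  by rewrite (sep k' k u) // -opprB -sub0r.
(* [cr k] is the correlation of h with its translate. Expanding the square gives
   [incr = 2 nrg - 2 cr], so [incr <= nrg] means [2 cr >= nrg]. *)
pose cr k := \sum_u conc s u * conc s (u - g k).
have half k : nrg s <= 2 * cr k.
  have E : \sum_u conc s (u - g k) ^+ 2 = nrg s by rewrite (sum_translate (fun u => conc s u ^+ 2)).
  have -> : 2 * cr k = 2 * nrg s - incr s (g k).
    rewrite /cr -[2 * nrg s]/(2 * nrg s) (_ : 2 * nrg s = nrg s + \sum_u conc s (u - g k) ^+ 2); last by rewrite E; ring.
    rewrite /nrg /incr -big_split -sumrB mulr_sumr /=.
    by apply: eq_bigr => u _; ring.
  by have := small k; lra.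
have : \sum_k cr k <= #|B|%:R.
  rewrite exchange_big -(conc_sum s); apply: ler_sum => u _ /=.
  rewrite -mulr_sumr -[leRHS]mulr1; apply: ler_wpM2l => //.
  exact: conc_ge0.
move=> crB; apply: le_trans (_ : \sum_k 2 * cr k <= _); last first.
  by rewrite -mulr_sumr ler_pM2l.
rewrite -sum1_card natr_sum mulr_suml; apply: ler_sum => k _.
by rewrite mul1r.
Qed.

(* [Q] indexes translates of [B] covering [B - B]. *)
Lemma conc_cat_le s1 s2 (Q : finType) (c : Q -> V) t :
  (forall x y, x \in B -> y \in B -> exists q, x - y - c q \in B) ->
  #|B|%:R * conc (s1 ++ s2) t <= #|Q|%:R * Num.max (nrg s1) (nrg s2).
Proof.
move=> cover; pose f1 (u y : V) : R := (y - u \in B)%:R.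
have prod_le (f g : V -> V) : \sum_u conc s1 (f u) * conc s2 (g u) <= 
   (\sum_u conc s1 (f u) ^+ 2 + \sum_u conc s2 (g u) ^+ 2) / 2.
  rewrite -big_split mulr_suml; apply: ler_sum => u _ /=.
  set x := conc _ _; set y := conc _ _.
  by have := sqr_ge0 (x - y); rewrite sqrrB; lra.
(* If [y + y' - t] is in [B], then for each of the [#|B|] points [u] with [y - u] in [B] the point
   [y' - (t - u)] is in [B - B], hence in a translate of [B] by some [c q]. *)
apply: le_trans (_ : \sum_q \sum_u conc s1 u * conc s2 (t - u + c q) <= _).
  have E q u : conc s1 u * conc s2 (t - u + c q)
    = ev p s1 (fun y => ev p s2 (fun y' => f1 u y * f1 (t - u + c q) y')).
    rewrite /conc [LHS]mulrC -evZ; apply: eq_ev => y.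
    by rewrite evZ mulrC.
  under eq_bigr => q _ do under eq_bigr => u _ do rewrite E.
  under eq_bigr => q _ do rewrite -ev_sum.
  rewrite -ev_sum /conc ev_cat -evZ; apply: ler_ev => // y.
  under eq_bigr => q _ do rewrite -ev_sum.
  rewrite -ev_sum -evZ; apply: ler_ev => // y'.
  rewrite exchange_big /=.
  case: (boolP (_ \in B)) => [yB|_]; last first.
    by rewrite mulr0; do 2 (apply: sumr_ge0 => ? _); rewrite mulr_ge0 ?ler0n.
  rewrite mulr1 (_ : #|B|%:R = \sum_u (f1 u y)); last first.
    rewrite -sum1_card natr_sum (reindex_inj (subrI y)) big_mkcond /=.
    by apply: eq_bigr => u _; rewrite /f1; case: (_ \in B).
  apply: ler_sum => u _; rewrite -mulr_sumr -[leLHS]mulr1 /f1.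
  case: (boolP (y - u \in B)) => [uB|_]; last by rewrite !mul0r.
  rewrite !mul1r; have [q qB] := cover _ _ yB uB.
  rewrite (bigD1 q) //= (_ : y' - (t - u + c q) = y + y' - t - (y - u) - c q).
    by rewrite qB lerDl sumr_ge0.
  rewrite opprD addrA; congr (_ - _); rewrite !opprB -addrA [RHS]addrCA.
  rewrite [y + y']addrC -[y' + y + _]addrA [y + (u - y)]addrC subrK [LHS]addrA [RHS]addrC //.
apply: le_trans (_ : \sum_(q : Q) Num.max (nrg s1) (nrg s2) <= _); last first.
  by rewrite sumr_const [#|Q|%:R * _]mulr_natl.
apply: ler_sum => q _; apply: le_trans (prod_le id (fun u => t - u + c q)) _.
have -> : \sum_u conc s2 (t - u + c q) ^+ 2 = nrg s2.
  rewrite (reindex_inj (inv_inj (subKr (t + c q)))) /=.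
  by apply: eq_bigr => u _; rewrite opprB addrCA opprD [t + _]addrA subrr sub0r subrK.
rewrite -/(nrg s1); set a := nrg s1; set b := nrg s2.
have := le_max a a b; have := le_max b a b; rewrite !lexx orbT /=; lra.
Qed.

Lemma conc_cat_sup s s' (r : R) :
  (forall t, conc s t <= r) -> forall t, conc (s' ++ s) t <= r.
Proof.
move=> sr t; rewrite /conc ev_cat -(ev_const p s' r); apply: ler_ev => // y.
apply: le_trans (sr (t - y)); rewrite le_eqVlt; apply/orP; left; apply/eqP.
by apply: eq_ev => y'; rewrite opprB addrA [y' + y]addrC.
Qed.

(** Start from the empty list, whose energy is [#|B|], and keep adding an element that is not an
    almost period; by [nrg_cons] each addition multiplies the energy by at most [1 - p(1-p)c]. *)
Lemma greedy (I : eqType) (f : I -> V) (c : R) (K : nat) (A : seq I) :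
  0 <= c -> p * (1 - p) * c <= 1 ->
  exists s : seq I, exists rest : seq I, [/\ perm_eq (s ++ rest) A, (size s <= K)%N &
   (forall i, i \in rest -> incr (map f s) (f i) <= c * nrg (map f s)) \/
   nrg (map f s) <= (1 - p * (1 - p) * c) ^+ K * #|B|%:R].
Proof.
move=> c0 c1; elim: K => [|K [s [rest [sA sK [H|H]]]]].
- by exists [::], A; split=> //; right; rewrite /= nrg_nil expr0 mul1r.
- by exists s, rest; split=> //; [rewrite leqW|left].
case: (altP (@allP _ (fun i => incr (map f s) (f i) <= c * nrg (map f s)) rest)) => [P|/allPn [i ir ni]].
  by exists s, rest; split=> //; [rewrite leqW|left].
exists (i :: s), (rem i rest); split=> //.
  by rewrite -(permPr sA) -cat1s -catA perm_catCA perm_cat2l perm_sym perm_to_rem.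
right; rewrite [map f _]/= nrg_cons exprS -[X in _ <= X]mulrA.
move: p01 => /andP [p0 p1].
have pp0 : 0 <= p * (1 - p) by rewrite mulr_ge0 // subr_ge0.
apply: le_trans (_ : (1 - p * (1 - p) * c) * nrg (map f s) <= _); last first.
  by apply: ler_wpM2l => //; rewrite subr_ge0.
rewrite mulrBl mul1r lerD2l lerN2 -[X in X <= _]mulrA; apply: ler_wpM2l => //.
by rewrite ltW // ltNge.
Qed.

(* Two disjoint greedy sets are needed because [nrg] is quadratic in the
   concentration: the sum of two independent parts concentrates at most like
   the larger of their energies. *)
Lemma almost_period_structure (n : nat) (f : 'I_n -> V) (c : R) (K : nat) (Q : finType) (cq : Q -> V) :
  0 <= c -> p * (1 - p) * c <= 1 ->
  (forall x y, x \in B -> y \in B -> exists q, x - y - cq q \in B) ->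
  let all := map f (enum 'I_n) in
  (exists s s' : seq 'I_n, [/\ (size s <= K)%N, (size s' <= K)%N,
    forall i, i \notin s ++ s' -> incr (map f s) (f i) <= c * nrg (map f s) &
    forall t, #|B|%:R * conc all t <= #|Q|%:R * nrg (map f s)])
  \/ (forall t, #|B|%:R * conc all t <=
         #|Q|%:R * ((1 - p * (1 - p) * c) ^+ K * #|B|%:R)).
Proof.
move=> c0 c1 cover all.
have [s [rest [sp sK H]]] := greedy f K (enum 'I_n) c0 c1.
have [s' [rest' [sp' sK' H']]] := greedy f K rest c0 c1.
have pe : perm_eq (rest' ++ s ++ s') (enum 'I_n).
  by rewrite perm_catC -catA -(permPr sp) perm_cat2l.
have bd t : #|B|%:R * conc all t <= #|Q|%:R * Num.max (nrg (map f s)) (nrg (map f s')).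
  have -> : conc all t = conc (map f rest' ++ (map f s ++ map f s')) t.
    have up : uniq (rest' ++ s ++ s') by rewrite (perm_uniq pe) enum_uniq.
    rewrite /all -!map_cat /conc -(ev_pexp p f _ (enum_uniq _)) -(ev_pexp p f _ up).
    by apply: eq_pexp => b; rewrite (perm_big _ pe).
  have B0 : 0 <= #|B|%:R :> R by rewrite ler0n.
  have [->|Bn0] := eqVneq #|B| 0%N.
    by rewrite mul0r mulr_ge0 ?ler0n // le_max nrg_ge0.
  have Bp : 0 < #|B|%:R :> R by rewrite ltr0n lt0n.
  rewrite mulrC -ler_pdivlMr //; apply: conc_cat_sup => u.
  by rewrite ler_pdivlMr // mulrC; exact: (conc_cat_le _ _ _ cover).
have inr i : i \notin s ++ s' -> i \in rest'.
  have : i \in rest' ++ s ++ s' by rewrite (perm_mem pe) mem_enum.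
  by rewrite mem_cat; case: (i \in rest') => //= ->.
have inr2 i : i \notin s ++ s' -> i \in rest.
  by move/inr => ir; rewrite -(perm_mem sp') mem_cat ir orbT.
(* The part with the larger energy controls the concentration of the whole sum, so its almost
   periods are the ones retained. *)
case: (leP (nrg (map f s')) (nrg (map f s))) => cmp.
  case: H => H.
    left; exists s, s'; split=> // [i /inr2 /H //|t].
    by apply: le_trans (bd t) _; rewrite max_l.
  right=> t; apply: le_trans (bd t) _; rewrite max_l //.
  by rewrite ler_wpM2l ?ler0n.
case: H' => H'.
  left; exists s', s; split=> // [i ni|t].
    by apply: H'; apply: inr; move: ni; rewrite !mem_cat orbC.
  by apply: le_trans (bd t) _; rewrite max_r // ltW.
right=> t; apply: le_trans (bd t) _; rewrite max_r ?(ltW cmp) //.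
by rewrite ler_wpM2l ?ler0n.
Qed.

End Energy.

(** * Counting separated almost periods in a lattice *)

HB.instance Definition _ (A B : finZmodType) := Finite.on (A * B)%type.

Section SeparatingFunctional.
Variables (m M W : nat) (x : 'I_m -> int * int).
Hypothesis mM : (m * m <= M)%N.
Hypothesis far : forall i j, i != j ->
  (((2 * M + 1) * W)%:Z <= `|(x i).1 - (x j).1|) || (((2 * M + 1) * W)%:Z <= `|(x i).2 - (x j).2|).

(* Two different [a] cannot both fail on the same pair of points, so one of the
   [M + 1] candidates survives all pairs. *)
Lemma separating_functional :
  exists2 a : nat, (a <= M)%N &
    forall i j, i != j ->
      W%:Z <= `|((x i).1 + a%:Z * (x i).2) - ((x j).1 + a%:Z * (x j).2)|.
Proof.
pose good (a : 'I_M.+1) := [forall i, forall j, (i != j) ==>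
   (W%:Z <= `|((x i).1 + a%:Z * (x i).2) - ((x j).1 + a%:Z * (x j).2)|)].
have [a aP|none] := pickP good.
  exists a; first by rewrite -ltnS ltn_ord.
  by move=> i j ij; move/forallP: aP => /(_ i) /forallP /(_ j) /implyP; apply.
have wit (a : 'I_M.+1) : exists p : 'I_m * 'I_m, (p.1 != p.2) &&
   (`|((x p.1).1 + a%:Z * (x p.1).2) - ((x p.2).1 + a%:Z * (x p.2).2)| < W%:Z).
  have := none a; rewrite /good => /negbT /forallPn [i /forallPn [j]].
  by rewrite negb_imply -ltNge => H; exists (i, j).
pose f a := xchoose (wit a).
have fP a := xchooseP (wit a).
(* Each failing candidate is sent to a pair on which it fails; injectivity puts [M + 1] candidates
   into [m * m <= M] pairs, which is absurd. *)
have finj : injective f.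
  move=> a b fab; have := fP a; have := fP b; rewrite -/(f a) -/(f b) -fab.
  move: (f a) => [i j] /= /andP [ij b1] /andP [_ a1].
  have := far ij; apply: contraTeq => ab; apply/negP.
  have {}ab : (a : nat) != b by [].
  have aM := ltn_ord a; have bM := ltn_ord b.
  move: b1 a1 ab aM bM {fab}; move: (nat_of_ord a) (nat_of_ord b) => {}a {}b.
  move: (x i) (x j) => [x1 x2] [y1 y2] /=.
  have -> : x1 + b%:Z * x2 - (y1 + b%:Z * y2) = (x1 - y1) + b%:Z * (x2 - y2) by ring.
  have -> : x1 + a%:Z * x2 - (y1 + a%:Z * y2) = (x1 - y1) + a%:Z * (x2 - y2) by ring.
  move: (x1 - y1) (x2 - y2) => u v b1 a1 ab aM bM.
  (* Subtracting the two failures bounds [(a - b) v], hence [v]; then [u] is also below [(2M+1) W]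
     in absolute value, against [far]. *)
  have v2W : `|v| < 2 * W%:Z.
    have : `|(a%:Z - b%:Z) * v| < 2 * W%:Z.
      rewrite (_ : _ * v = (u + a%:Z * v) - (u + b%:Z * v)); last by ring.
      by apply: le_lt_trans (ler_normB _ _) _; lia.
    rewrite normrM; have : 1 <= `|a%:Z - b%:Z| by lia.
    nia.
  have : `|u| < W%:Z + M%:Z * (2 * W%:Z).
    rewrite (_ : u = (u + a%:Z * v) - a%:Z * v); last by ring.
    apply: le_lt_trans (ler_normB _ _) _; rewrite normrM.
    have : `|a%:Z| * `|v| <= M%:Z * (2 * W%:Z) by apply: ler_pM => //; lia.
    lia.
  move=> uW; apply/negP; rewrite negb_or -!ltNge; apply/andP; split; nia.
have := leq_card f finj; rewrite card_prod !card_ord; lia.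
Qed.

End SeparatingFunctional.

(** The sums climb from [j h k] to [j h (k+1)] in [j] steps of size at least [W], so they increase
    along the lexicographic order of [(k, l)]. *)
Lemma chain_separated (W : nat) (j k l k' l' : nat) (h : nat -> int) :
  (forall a b, (a < b)%N -> (b <= (maxn k k').+1)%N -> h a + W%:Z <= h b) ->
  (l < j)%N -> (l' < j)%N -> (k, l) != (k', l') ->
  W%:Z <= `|((j - l)%N%:Z * h k + l%:Z * h k.+1) - ((j - l')%N%:Z * h k' + l'%:Z * h k'.+1)|.
Proof.
wlog : k l k' l' / (k < k')%N || (k == k') && (l < l')%N.
  move=> wl H lj l'j; case: (ltngtP k k') => kk'.
  - by apply: wl => //; rewrite kk'.
  - by move=> _; rewrite distrC; apply: wl; rewrite ?kk' // 1?maxnC // xpair_eqE; lia.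
  - move=> ne; have /orP [ll'|ll'] : (l < l')%N || (l' < l)%N.
      by move: ne; rewrite kk' xpair_eqE eqxx /= neq_ltn.
      by apply: wl => //; rewrite kk' eqxx ll' orbT.
    rewrite distrC; apply: wl; rewrite 1?maxnC //; first by rewrite kk' eqxx ll' orbT.
    by rewrite eq_sym.
move=> ord H lj l'j _.
have h1 : h k + W%:Z <= h k.+1 by apply: H => //; rewrite ltnS leq_maxl.
have h2 : h k' + W%:Z <= h k'.+1 by apply: H => //; rewrite ltnS leq_maxr.
rewrite -!subzn 1?ltnW //; case/orP: ord => [kk'|/andP [/eqP kk' ll']].
  have h3 : h k.+1 <= h k'.
    case: (ltngtP k.+1 k') => [lt|gt|-> //]; last by lia.
    by have := H _ _ lt; lia.
  rewrite distrC ler_normr; apply/orP; left.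
  have := h k; have := h k'; move: h1 h2 h3.
  move: (h k) (h k.+1) (h k') (h k'.+1) => a b c d h1 h2 h3 _ _.
  have : (j%:Z - l%:Z) * a <= (j%:Z - l%:Z) * (b - W%:Z) by apply: ler_wpM2l; lia.
  have : l'%:Z * c <= l'%:Z * d by apply: ler_wpM2l; lia.
  have : j%:Z * b <= j%:Z * c by apply: ler_wpM2l; lia.
  have : 1 * W%:Z <= (j%:Z - l%:Z) * W%:Z by apply: ler_wpM2r; lia.
  nia.
subst k'; rewrite distrC ler_normr; apply/orP; left.
move: h1; move: (h k) (h k.+1) => a b h1.
have : 1 * W%:Z <= (l'%:Z - l%:Z) * (b - a) by apply: ler_pM; lia.
nia.
Qed.

(* [Z^2] is modelled by ['Z_N ^ 2] with [N] too large for wrap-around to matter;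
   with [kp = 1] the third coordinate counts the summands. *)
Section Lattice.
Variables (N : nat).
Hypothesis N1 : (1 < N)%N.
Notation G := ('Z_N * 'Z_N * 'Z_N)%type.

Definition lat (kp : nat) (x : int * int) : G := (x.1%:~R, x.2%:~R, kp%:R).

(** A square in the first two coordinates and a single point in the third: for [kp = 1] a hit also
    fixes the number of summands modulo [N]. *)
Definition window (W : nat) : {set G} :=
  [set ((i%:R, j%:R, 0) : G) | i : 'I_W, j : 'I_W].

Lemma Zp_natr_inj (a b : nat) : (a < N)%N -> (b < N)%N ->
  a%:R = b%:R :> 'Z_N -> a = b.
Proof.
move=> aN bN /(congr1 (@nat_of_ord _)); rewrite !val_Zp_nat //.
by rewrite !modn_small.
Qed.

Lemma Zp_intr_inj (a b : int) : `|a - b| < N%:Z -> a%:~R = b%:~R :> 'Z_N -> a = b.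
Proof.
wlog ba : a b / b <= a.
  move=> wl; case: (leP b a) => ab; first exact: wl.
  by rewrite distrC => H E; symmetry; apply: wl => //; rewrite ltW.
move=> H /eqP; rewrite -subr_eq0 -rmorphB /=.
have -> : a - b = `|a - b|%N%:Z by rewrite gez0_abs // subr_ge0.
rewrite -pmulrn => /eqP E; apply/eqP; rewrite -subr_eq0 -absz_eq0; apply/eqP.
by apply: Zp_natr_inj => //; lia.
Qed.

(** Each coordinate difference lies in [(-W, W)], which is covered by [[0, W)] and its translate by
    [-W]; two coordinates give four translates. *)
Lemma window_cover (W : nat) (x y : G) : x \in window W -> y \in window W ->
  exists q : bool * bool,
    x - y - ((if q.1 then - W%:R else 0, if q.2 then - W%:R else 0, 0) : G) \in window W.
Proof.
case/imset2P=> i j _ _ -> /imset2P [i' j' _ _ ->].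
have sub (a b : 'I_W) : exists q : bool, exists c : 'I_W,
    a%:R - b%:R - (if q then - W%:R else 0) = c%:R :> 'Z_N.
  have aW := ltn_ord a; have bW := ltn_ord b.
  case: (leqP b a) => ba.
    have cW : (a - b < W)%N by lia.
    by exists false, (Ordinal cW); rewrite subr0 /= natrB.
  have cW : (a + W - b < W)%N by lia.
  by exists true, (Ordinal cW); rewrite opprK /= natrB ?natrD; [ring|lia].
have [q1 [c1 E1]] := sub i i'; have [q2 [c2 E2]] := sub j j'.
exists (q1, q2); apply/imset2P; exists c1 c2 => //.
by rewrite -E1 -E2; congr (_, _, _); rewrite /= subrr subr0.
Qed.

(** The bound by [N] excludes wrap-around, so the congruence is an equality of integers. *)
Lemma Zp_sub_window (W : nat) (a b : int) (c d : nat) :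
  (c < W)%N -> (d < W)%N -> (W + `|a - b| <= N)%N ->
  c%:R - d%:R = a%:~R - b%:~R :> 'Z_N -> `|a - b| < W%:Z.
Proof.
move=> cW dW H e.
have e' : (a - b)%:~R = (c%:Z - d%:Z)%:~R :> 'Z_N by rewrite !rmorphB /= e.
have lt : `|a - b - (c%:Z - d%:Z)| < N%:Z by move: cW dW H {e e'}; lia.
by have := Zp_intr_inj lt e' => {e e' lt} ->; move: cW dW {H}; lia.
Qed.

(** Two points in one translate of the window differ by a difference of window points; this serves
    to check the separation hypothesis of [packing]. *)
Lemma window_sep (W k l : nat) (x y : int * int) (z : G) :
  (W + `|x.1 - y.1| <= N)%N -> (W + `|x.2 - y.2| <= N)%N ->
  lat k x - z \in window W -> lat l y - z \in window W ->
  [/\ `|x.1 - y.1| < W%:Z, `|x.2 - y.2| < W%:Z & k%:R = l%:R :> 'Z_N].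
Proof.
move=> N1' N2' /imset2P [i j _ _ E] /imset2P [i' j' _ _ E'].
have : (lat k x - z) - (lat l y - z) = lat k x - lat l y.
  by rewrite opprB addrA subrK.
rewrite E E' => H.
have e3 : 0 - 0 = k%:R - l%:R :> 'Z_N := congr1 (fun g : G => g.2) H.
have e1' : i%:R - i'%:R = x.1%:~R - y.1%:~R :> 'Z_N := congr1 (fun g : G => g.1.1) H.
have e2' : j%:R - j'%:R = x.2%:~R - y.2%:~R :> 'Z_N := congr1 (fun g : G => g.1.2) H.
split.
- exact: Zp_sub_window (ltn_ord i) (ltn_ord i') N1' e1'.
- exact: Zp_sub_window (ltn_ord j) (ltn_ord j') N2' e2'.
by move/eqP: e3; rewrite subr0 eq_sym subr_eq0 => /eqP.
Qed.

Lemma card_window_gt0 W : (0 < W)%N -> (0 < #|window W|)%N.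
Proof.
move=> W0; rewrite card_gt0; apply/set0Pn; exists ((0%:R, 0%:R, 0) : G).
by apply/imset2P; exists (Ordinal W0) (Ordinal W0).
Qed.

Lemma lat_chain (kp a b : nat) (x y : int * int) :
  \sum_(z <- nseq a (lat kp x) ++ nseq b (lat kp y)) z =
  lat (kp * (a + b)) (a%:Z * x.1 + b%:Z * y.1, a%:Z * x.2 + b%:Z * y.2).
Proof.
rewrite big_cat /= !big_nseq !iter_addr_0 /lat /=.
have E (u v w : 'Z_N) k : (u, v, w) *+ k = (u *+ k, v *+ k, w *+ k) :> G.
  by elim: k => [|k IH]; rewrite ?mulr0n // !mulrS IH.
rewrite !E mulnDr natrD !natrM !mulr_natr.
have F (u v : int) : u%:~R *+ a + v%:~R *+ b = (a%:Z * u + b%:Z * v)%:~R :> 'Z_N.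
  by rewrite rmorphD !rmorphM /= -!pmulrn !mulr_natl.
by rewrite -!F.
Qed.

End Lattice.

(** * Separated almost periods in a bounded grid *)

Definition cell (T : nat) := ('I_(2 * T + 1) * 'I_(2 * T + 1))%type.
Definition pos (T : nat) (x : cell T) : int * int := (x.1%:Z - T%:Z, x.2%:Z - T%:Z).
Definition near (D : nat) (x y : int * int) : bool :=
  (`|x.1 - y.1| < D%:Z) && (`|x.2 - y.2| < D%:Z).

Section Centers.
Variables (R : realFieldType) (p : R) (N W T M J J1 kp : nat).
Hypothesis p01 : 0 <= p <= 1.
Hypothesis W0 : (0 < W)%N.
Hypothesis NT : (8 * (J + 1) * T + W + kp * (2 * J) < N)%N.
Hypothesis J0 : (0 < J)%N.
Hypothesis J1J : (0 < J1 <= J)%N.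
(** Sums of different numbers of almost periods are used only when the third coordinate can tell
    these numbers apart; otherwise there is a single level. *)
Hypothesis kpJ : (J1 = 1%N) \/ (kp = 1%N).
Notation G := ('Z_N * 'Z_N * 'Z_N)%type.
Notation B := (window N W).
Variables (s : seq G) (c : R).
Hypothesis cJ : c * (2 * J%:R) ^+ 2 <= 1.
Hypothesis c0 : 0 <= c.

(** A small set with separation [F] admits a functional [x.1 + a x.2], [a <= M], with gaps
    [(M+1) W], which is the bound for the variation of that functional on a window. *)
Let F := ((2 * M + 1) * ((M + 1) * W))%N.
Let N1 : (1 < N)%N. Proof. by lia. Qed.

Lemma pos_bound (x : cell T) : `|(pos x).1| <= T%:Z /\ `|(pos x).2| <= T%:Z.
Proof. by case: x => i j; have := ltn_ord i; have := ltn_ord j; rewrite /pos /=; lia. Qed.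

(** Packing with the points themselves instead of their sums; this crude bound secures the condition
    [#|C|^2 <= M] of [centers_bound]. *)
Lemma centers_trivial_bound (C : {set cell T}) :
  (forall x, x \in C -> incr p B s (lat N kp (pos x)) <= c * nrg p B s) ->
  (forall x y, x \in C -> y \in C -> x != y -> ~~ near F (pos x) (pos y)) ->
  #|C|%:R * nrg p B s <= 2 * #|B|%:R.
Proof.
move=> Cs Cf.
have := @packing R _ p B p01 s 'I_#|C| (fun k => lat N kp (pos (enum_val k))).
rewrite card_ord; apply => [k k' z|k]; last first.
  apply: le_trans (Cs _ (enum_valP k)) _; rewrite -[leRHS]mul1r.
  apply: ler_wpM2r; first exact: nrg_ge0.
  apply: le_trans cJ; rewrite -[leLHS]mulr1; apply: ler_wpM2l => //.
  have : 1 <= J%:R :> R by rewrite ler1n.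
  by nra.
have [b1 b2] := pos_bound (enum_val k); have [b3 b4] := pos_bound (enum_val k').
move=> h1 h2; have [n1 n2] : (W + `|(pos (enum_val k)).1 - (pos (enum_val k')).1| <= N)%N /\
    (W + `|(pos (enum_val k)).2 - (pos (enum_val k')).2| <= N)%N.
  by move: b1 b2 b3 b4 NT; clear; move: (pos _) (pos _) => u v; lia.
have [d1 d2 _] := window_sep N1 n1 n2 h1 h2.
apply: enum_val_inj; apply/eqP/negPn/negP => ne.
have := Cf _ _ (enum_valP k) (enum_valP k') ne; rewrite /near.
have WF : W%:Z <= F%:Z by rewrite lez_nat /F; clear; nia.
by rewrite (lt_le_trans d1 WF) (lt_le_trans d2 WF).
Qed.

(* The separated sums are [(J + j0 - i) y_k + i y_(k+1)], with [y] sorted along a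
   separating functional. *)
Lemma centers_bound (C : {set cell T}) :
  (#|C| * #|C| <= M)%N ->
  (forall x, x \in C -> incr p B s (lat N kp (pos x)) <= c * nrg p B s) ->
  (forall x y, x \in C -> y \in C -> x != y -> ~~ near F (pos x) (pos y)) ->
  (J1 * J * #|C|.-1)%:R * nrg p B s <= 2 * #|B|%:R.
Proof.
move=> CM Cs Cf; set m := #|C|.
pose x (i : 'I_m) := pos (enum_val i).
have far i j : i != j ->
    (((2 * M + 1) * ((M + 1) * W))%:Z <= `|(x i).1 - (x j).1|)
    || (((2 * M + 1) * ((M + 1) * W))%:Z <= `|(x i).2 - (x j).2|).
  move=> ij; rewrite !leNgt -negb_and; apply: Cf; rewrite ?enum_valP //.
  by rewrite (inj_eq enum_val_inj).
have [a aM sep] := separating_functional CM far.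
pose l (z : int * int) := z.1 + a%:Z * z.2.
pose L := sort (fun u v => l u <= l v) [seq x i | i <- enum 'I_m].
have sL : size L = m by rewrite size_sort size_map size_enum_ord.
pose y k := nth (0, 0) L k.
have uL : uniq L.
  rewrite sort_uniq map_inj_uniq ?enum_uniq // => i j xij; apply/eqP/negPn/negP => ij.
  by have := sep _ _ ij; rewrite xij subrr normr0; move: W0; clear; nia.
have yx k : (k < m)%N -> exists i, y k = x i.
  move=> km; have : y k \in L by rewrite mem_nth ?sL.
  by rewrite mem_sort => /mapP [i _ ->]; exists i.
have gap k k' : (k < k')%N -> (k' < m)%N -> l (y k) + ((M + 1) * W)%:Z <= l (y k').
  move=> kk' k'm.
  have srt : sorted (fun u v => l u + ((M + 1) * W)%:Z <= l v) L.
    apply/(sortedP (0, 0)) => k0; rewrite sL => k0m.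
    have le : l (y k0) <= l (y k0.+1).
      have sr : sorted (fun u v => l u <= l v) L by apply: sort_sorted => u v; exact: le_total.
      by move/(sortedP (0, 0)): sr; apply; rewrite sL.
    have [i yi] := yx k0 (ltnW k0m); have [i' yi'] := yx k0.+1 k0m.
    have ii' : i != i'.
      apply/eqP => ii'.
      have : y k0 == y k0.+1 by rewrite yi yi' ii'.
      by rewrite nth_uniq ?sL ?(ltnW k0m) // eqn_leq ltnn andbF //; exact: ltnW.
    have := sep _ _ ii'; rewrite -yi -yi' -/(l _) -/(l _) -/(y _) -/(y _).
    by rewrite distrC ger0_norm ?subr_ge0 // lerBrDl.
  apply: (sorted_ltn_nth _ _ srt); rewrite ?inE ?sL //; last by lia.
  by move=> u v w; lia.
pose X (q : 'I_J1 * 'I_m.-1 * 'I_J) : int * int :=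
  let: (j0, k, i) := q in
  ((J + j0 - i)%N%:Z * (y k).1 + i%:Z * (y k.+1).1,
   (J + j0 - i)%N%:Z * (y k).2 + i%:Z * (y k.+1).2).
pose lev (q : 'I_J1 * 'I_m.-1 * 'I_J) : nat := (kp * (J + q.1.1))%N.
pose g q := lat N (lev q) (X q).
have yb k : (k < m)%N -> `|(y k).1| <= T%:Z /\ `|(y k).2| <= T%:Z.
  by move/yx => [i ->]; exact: pos_bound.
have Xb q : `|(X q).1| <= (2 * J * T)%:Z /\ `|(X q).2| <= (2 * J * T)%:Z.
  case: q => [[j0 k] i] /=.
  have km : (k < m)%N by have := ltn_ord k; lia.
  have k1m : (k.+1 < m)%N by have := ltn_ord k; lia.
  have [u1 u2] := yb _ km; have [v1 v2] := yb _ k1m.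
  have iJ := ltn_ord i; have j0J := ltn_ord j0.
  have aux (u v : int) : `|u| <= T%:Z -> `|v| <= T%:Z ->
      `|(J + j0 - i)%N%:Z * u + i%:Z * v| <= (2 * J * T)%:Z.
    move=> uT vT; apply: le_trans (ler_normD _ _) _; rewrite !normrM.
    apply: le_trans (_ : (J + j0 - i)%N%:Z * T%:Z + i%:Z * T%:Z <= _).
      by apply: lerD; apply: ler_wpM2l.
    rewrite -mulrDl -PoszD subnK; last by lia.
    by rewrite -PoszM lez_nat leq_mul2r; move: iJ j0J J1J; clear; lia.
  by split; apply: aux.
have := @packing R _ p B p01 s _ g; rewrite !card_prod !card_ord.
rewrite mulnAC; apply => [q q' z h1 h2|q].
  have [b1 b2] := Xb q; have [b3 b4] := Xb q'.
  have [n1 n2] : (W + `|(X q).1 - (X q').1| <= N)%N /\ (W + `|(X q).2 - (X q').2| <= N)%N.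
    move: b1 b2 b3 b4 NT; clear; move: (X q) (X q') => u v b1 b2 b3 b4.
    have : (2 * J * T <= 2 * (J + 1) * T)%N by rewrite leq_mul2r; lia.
    lia.
  have [d1 d2 d3] := window_sep N1 n1 n2 h1 h2.
  have {d3} lv : lev q = lev q'.
    have aux r : (lev r < N)%N.
      have := ltn_ord r.1.1; move: NT J1J; rewrite /lev; clear; move: r.1.1 => j0.
      move=> h3 h4 h5.
      have : (kp * (J + j0) <= kp * (2 * J))%N by rewrite leq_mul2l; lia.
      lia.
    by apply: (Zp_natr_inj N1).
  have {h1 h2 n1 n2 b1 b2 b3 b4} dl : `|l (X q) - l (X q')| < ((M + 1) * W)%:Z.
    move: d1 d2 aM; rewrite /l; clear; move: (X q) (X q') => [u1 u2] [v1 v2] /= h1 h2 h3.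
    have -> : u1 + a%:Z * u2 - (v1 + a%:Z * v2) = (u1 - v1) + a%:Z * (u2 - v2) by ring.
    apply: le_lt_trans (ler_normD _ _) _; rewrite normrM.
    have : `|a%:Z| * `|u2 - v2| <= M%:Z * W%:Z by apply: ler_pM => //; exact: ltW.
    by rewrite PoszM PoszD; lia.
  move: q q' lv dl {d1 d2} => [[j0 k] i] [[j0' k'] i'] lv dl.
  (* A single level leaves only one [j0]; otherwise the third coordinate [J + j0] determines it. *)
  have jj : j0 = j0'.
    apply/val_inj; move: lv (ltn_ord j0) (ltn_ord j0'); rewrite /lev /=.
    move: (nat_of_ord j0) (nat_of_ord j0') => u v.
    by case: kpJ => ->; clear; lia.
  subst j0'; suff ki : (nat_of_ord k, nat_of_ord i) = (nat_of_ord k', nat_of_ord i').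
    by case: ki => /val_inj -> /val_inj ->.
  apply/eqP; apply: contraLR dl => ne; rewrite -leNgt.
  have lX k0 i0 : l (X (j0, k0, i0)) =
      (J + j0 - i0)%N%:Z * l (y k0) + i0%:Z * l (y k0.+1) by rewrite /l /=; ring.
  rewrite !lX; apply: (@chain_separated _ _ _ _ _ _ (fun b => l (y b))) => //.
  - move=> a0 b0 ab0 bm; apply: gap => //.
    have := ltn_ord k; have := ltn_ord k'; move: bm; clear; lia.
  - by have := ltn_ord i; clear; lia.
  - by have := ltn_ord i'; clear; lia.
case: q => [[j0 k] i]; rewrite /g /lev /X /=.
have iJ := ltn_ord i; have j0J := ltn_ord j0.
have E : (J + j0 - i + i = J + j0)%N by move: iJ; clear; lia.
have := @lat_chain N kp (J + j0 - i) i (y k) (y k.+1); rewrite E => <-.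
(* A sum of fewer than [2J] almost periods: [incr_sum] costs the square of their number, which [cJ]
   absorbs. *)
apply: le_trans (_ : (J + j0)%:R ^+ 2 * (c * nrg p B s) <= _).
  have cen k0 : (k0 < m)%N -> incr p B s (lat N kp (y k0)) <= c * nrg p B s.
    by move/yx => [i0 ->]; apply: Cs; exact: enum_valP.
  set ls := _ ++ _.
  have lsc v : v \in ls -> incr p B s v <= c * nrg p B s.
    rewrite mem_cat !mem_nseq => /orP [] /andP [_ /eqP ->]; apply: cen.
      by have := ltn_ord k; clear; lia.
    by have := ltn_ord k; clear; lia.
  by have := incr_sum lsc; rewrite size_cat !size_nseq E.
rewrite mulrA -[leRHS]mul1r; apply: ler_wpM2r; first exact: nrg_ge0.
apply: le_trans cJ; rewrite mulrC; apply: ler_wpM2l => //.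
rewrite lerXn2r ?nnegrE ?ler0n ?mulr_ge0 ?ler0n // -natrM ler_nat.
by move: j0J J1J; clear; lia.
Qed.

(** Take a maximal [F]-separated set of almost periods. Maximality makes it a net, the crude bound
    gives [#|C| <= 2/r], and then [centers_bound] applies; the [1 +] pays for its [#|C|.-1]. *)
Lemma centers (r : R) :
  0 < r -> r * #|B|%:R <= nrg p B s -> (2 / r) ^+ 2 <= M%:R ->
  exists C : {set cell T},
    (forall x : cell T, incr p B s (lat N kp (pos x)) <= c * nrg p B s ->
       exists2 y, y \in C & near F (pos x) (pos y)) /\
    #|C|%:R <= 1 + 2 / (J1 * J)%:R * (#|B|%:R / nrg p B s).
Proof.
move=> r0 rn rM; pose D := [set x : cell T | incr p B s (lat N kp (pos x)) <= c * nrg p B s].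
pose P (C : {set cell T}) := (C \subset D) &&
  [forall x in C, forall y in C, (x != y) ==> ~~ near F (pos x) (pos y)].
have P0 : P finset.set0.
  by rewrite /P finset.sub0set; apply/forall_inP => x; rewrite inE.
have [C /maxsetP [/andP [/fintype.subsetP CD sep] Cmax] _] := maxset_exists P0.
have Cs x : x \in C -> incr p B s (lat N kp (pos x)) <= c * nrg p B s.
  by move/CD; rewrite inE.
have Cf x y : x \in C -> y \in C -> x != y -> ~~ near F (pos x) (pos y).
  by move=> xC yC; move/forall_inP: sep => /(_ x xC) /forall_inP /(_ y yC) /implyP.
have B0 : 0 < #|B|%:R :> R by rewrite ltr0n card_window_gt0.
have n0 : 0 < nrg p B s by apply: lt_le_trans rn; rewrite mulr_gt0.
have nearC x y : near F x y = near F y x.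
  by rewrite /near ![`|x.1 - _|]distrC ![`|x.2 - _|]distrC.
have F0 : (0 < F)%N by rewrite /F; move: W0; clear; nia.
exists C; split.
  move=> x xD; case: (boolP (x \in C)) => [xC|xC].
    by exists x => //; rewrite /near !subrr normr0 ltz_nat F0.
  have [/existsP [y /andP [yC yn]]|/existsPn no] := boolP [exists y, (y \in C) && near F (pos x) (pos y)].
    by exists y.
  suff /Cmax : P (x |: C).
    by move/(_ (finset.subsetUr _ _)) => E; move: xC; rewrite -E finset.setU11.
  have no' y : y \in C -> ~~ near F (pos x) (pos y).
    by move=> yC; have := no y; rewrite yC.
  apply/andP; split.
    apply/fintype.subsetP => y; rewrite in_setU1 => /orP [/eqP ->|/CD //].
    by rewrite inE.
  apply/forall_inP => y yC; apply/forall_inP => z zC; apply/implyP => yz.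
  move: yC zC yz; rewrite !in_setU1 => /orP [/eqP ->|yC] /orP [/eqP ->|zC] yz.
  - by rewrite eqxx in yz.
  - exact: no'.
  - by rewrite nearC; exact: no'.
  - exact: Cf.
have Cn := centers_trivial_bound Cs Cf.
have CM : (#|C| * #|C| <= M)%N.
  rewrite -(ler_nat R) natrM; apply: le_trans rM.
  have C2 : #|C|%:R <= 2 / r.
    rewrite ler_pdivlMr // -(ler_pM2r B0) -mulrA.
    by apply: le_trans Cn; apply: ler_wpM2l.
  by rewrite expr2; apply: ler_pM.
have := centers_bound CM Cs Cf.
have J10 : (0 < J1)%N by case/andP: J1J.
have J1J0 : 0 < (J1 * J)%:R :> R by rewrite ltr0n muln_gt0 J10.
rewrite natrM mulrC => h.
have : (#|C|.-1)%:R <= 2 / (J1 * J)%:R * (#|B|%:R / nrg p B s) :> R.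
  rewrite mulrA ler_pdivlMr // mulrAC ler_pdivlMr //.
  by apply: le_trans h; rewrite le_eqVlt; apply/orP; left; apply/eqP; ring.
case: #|C| => [|k] /=; first by move/le_trans; apply; rewrite lerDr.
by rewrite -natr1; lra.
Qed.

End Centers.

(** * Small-ball events *)

Section Forms.
Variables (R : realType) (n : nat) (r : signvec n).
Implicit Types (x : signvec n) (i : 'I_n) (a b : 'I_n -> R).

(* With [z1 + i z2 = z sqrt n], [form z1 z2 x i a b] and [form z1 (- z2) x i b a]
   are the real and imaginary parts of the product of row [i] with [a + i b]. *)
Definition form (z1 z2 : R) x i a b : R :=
  \sum_l (sgn R (x l) + sgn R (r l)) * a l + z1 * a i - z2 * b i.

Definition small (z1 z2 : R) x i a b (rho : R) : bool :=
  (`|form z1 z2 x i a b| <= rho) && (`|form z1 (- z2) x i b a| <= rho).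

Lemma formB z1 z2 x i a b a' b' :
  form z1 z2 x i (fun l => a l - a' l) (fun l => b l - b' l) =
  form z1 z2 x i a b - form z1 z2 x i a' b'.
Proof.
rewrite /form (_ : \sum_l _ = \sum_l (sgn R (x l) + sgn R (r l)) * a l
   - \sum_l (sgn R (x l) + sgn R (r l)) * a' l); first by ring.
by rewrite -sumrB; apply: eq_bigr => l _; rewrite mulrBr.
Qed.

Lemma formZ z1 z2 x i a b t :
  form z1 z2 x i (fun l => t * a l) (fun l => t * b l) = t * form z1 z2 x i a b.
Proof.
rewrite /form (_ : \sum_l _ = t * \sum_l (sgn R (x l) + sgn R (r l)) * a l); first by ring.
by rewrite mulr_sumr; apply: eq_bigr => l _; rewrite mulrCA.
Qed.

Lemma sgn_norm (b : bool) : `|sgn R b| = 1.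
Proof. by case: b; rewrite /sgn ?normrN normr1. Qed.

Lemma form_bound z1 z2 x i a b (D : R) :
  (forall l, `|a l| <= D) -> (forall l, `|b l| <= D) ->
  `|form z1 z2 x i a b| <= (2 * n%:R + `|z1| + `|z2|) * D.
Proof.
move=> aD bD; rewrite /form.
apply: le_trans (ler_normB _ _) _; rewrite (mulrDl _ _ D) normrM; apply: lerD; last first.
  by apply: ler_wpM2l.
apply: le_trans (ler_normD _ _) _; rewrite mulrDl normrM; apply: lerD; last first.
  by apply: ler_wpM2l.
apply: le_trans (ler_norm_sum _ _ _) _.
apply: le_trans (_ : \sum_(l < n) 2 * D <= _); last first.
  by rewrite sumr_const card_ord -[(2 * D) *+ n]mulr_natr mulrAC.
apply: ler_sum => l _; rewrite normrM; apply: ler_pM => //.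
by apply: le_trans (ler_normD _ _) _; rewrite !sgn_norm.
Qed.

Lemma small_near z1 z2 x i a b a' b' (rho D : R) :
  (forall l, `|a l - a' l| <= D) -> (forall l, `|b l - b' l| <= D) ->
  small z1 z2 x i a b rho ->
  small z1 z2 x i a' b' (rho + (2 * n%:R + `|z1| + `|z2|) * D).
Proof.
move=> aD bD /andP [h1 h2]; apply/andP; split.
  have := form_bound z1 z2 x i aD bD; rewrite formB => h.
  rewrite -[form z1 z2 x i a' b'](subKr (form z1 z2 x i a b)).
  by apply: le_trans (ler_normB _ _) _; apply: lerD.
have := form_bound z1 (- z2) x i bD aD; rewrite formB normrN => h.
rewrite -[form z1 _ x i b' a'](subKr (form z1 (- z2) x i b a)).
by apply: le_trans (ler_normB _ _) _; apply: lerD.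
Qed.

Lemma smallZ z1 z2 x i a b rho (t : R) : 0 < t ->
  small z1 z2 x i (fun l => t * a l) (fun l => t * b l) (t * rho) = small z1 z2 x i a b rho.
Proof.
by move=> t0; rewrite /small !formZ !normrM gtr0_norm // !ler_pM2l.
Qed.

Lemma form_bits z1 z2 x i a b :
  form z1 z2 x i a b = 2 * \sum_(l | x l) a l +
   (\sum_l (sgn R (r l) - 1) * a l + z1 * a i - z2 * b i).
Proof.
rewrite /form addrA addrA; congr (_ + _ - _).
rewrite [\sum_(l | x l) _]big_mkcond mulr_sumr -big_split /=.
by apply: eq_bigr => l _; rewrite {1}/sgn; case: (x l); ring.
Qed.

Definition wexp (w : signvec n -> R) (F : signvec n -> R) : R := \sum_x w x * F x.

Definition ire (u : 'I_n -> int * int) l : R := (u l).1%:~R.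
Definition iim (u : 'I_n -> int * int) l : R := (u l).2%:~R.

Definition inwin (W : nat) (x : signvec n) (u : 'I_n -> int * int) (c1 c2 : int) : bool :=
  (0 <= \sum_(l | x l) (u l).1 - c1 < W%:Z) && (0 <= \sum_(l | x l) (u l).2 - c2 < W%:Z).

(** In terms of bits a form is [2 m + K] with [m] a subset sum and [K] independent of [x];
    [|2 m + K| <= rho] confines [m] to an interval of length [rho < W]. *)
Lemma small_inwin z1 z2 i u rho (W : nat) : rho < W%:R ->
  exists c1 c2 : int, forall x, small z1 z2 x i (ire u) (iim u) rho -> inwin W x u c1 c2.
Proof.
move=> rW.
have aux (f : 'I_n -> int) (K : R) : exists c : int, forall x : signvec n,
    `|2 * \sum_(l | x l) (f l)%:~R + K| <= rho -> 0 <= \sum_(l | x l) f l - c < W%:Z.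
  exists (Num.ceil ((- K - rho) / 2)) => x.
  rewrite -rmorph_sum /=; move: (\sum_(l | x l) f l) => m.
  rewrite ler_norml => /andP [h1 h2]; apply/andP; split.
    by rewrite subr_ge0 ceil_le_int; lra.
  rewrite ltrBlDr -(ltr_int R) rmorphD /=.
  apply: lt_le_trans (_ : W%:R + ((- K - rho) / 2) <= _).
    by rewrite -/(m%:~R); lra.
  by rewrite lerD2l ceil_ge.
have [c1 h1] := aux (fun l => (u l).1) (\sum_l (sgn R (r l) - 1) * ire u l + z1 * ire u i - z2 * iim u i).
have [c2 h2] := aux (fun l => (u l).2) (\sum_l (sgn R (r l) - 1) * iim u l + z1 * iim u i - - z2 * ire u i).
exists c1, c2 => x /andP []; rewrite !form_bits => /h1 k1 /h2 k2.
by rewrite /inwin k1 k2.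
Qed.

End Forms.

(** * Transfer of concentration between nearby lattice vectors *)

Section LatticeTransfer.
Variables (R : realFieldType) (p : R) (N kp n : nat).
Hypothesis p01 : 0 <= p <= 1.
Hypothesis N1 : (1 < N)%N.

Definition latseq (u : 'I_n -> int * int) := [seq lat N kp (u i) | i <- enum 'I_n].

(** Subset sums of [u] and [v] differ by at most [n D] in each coordinate, so it suffices to widen
    the window by [2 n D]. *)
Lemma conc_transfer (u v : 'I_n -> int * int) (D W W' : nat) t :
  (forall i, near D (u i) (v i)) -> (W + 2 * n * D <= W')%N ->
  exists t', conc p (window N W) (latseq u) t <= conc p (window N W') (latseq v) t'.
Proof.
move=> uv WW'.
(* The shift moves the error from [[-nD, nD]] to [[0, 2nD]]. *)
exists (t - ((n * D)%:R, (n * D)%:R, 0)).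
rewrite /conc /latseq -!ev_pexp ?enum_uniq //.
have bw0 y : 0 <= bw p y by move: p01 => /andP [? ?]; rewrite /bw; case: y => //; rewrite subr_ge0.
apply: ler_pexp => // b.
case: (boolP (_ \in window N W)) => [|_]; last by rewrite ler0n.
case/imset2P=> i j _ _ E.
suff -> : \sum_(i <- enum 'I_n) (if b i then lat N kp (v i) else 0) - (t - ((n * D)%:R, (n * D)%:R, 0))
   \in window N W' by [].
pose d1 := \sum_(l | b l) ((v l).1 - (u l).1); pose d2 := \sum_(l | b l) ((v l).2 - (u l).2).
have dB (f : 'I_n -> int) : (forall l, `|f l| <= D%:Z) -> `|\sum_(l | b l) f l| <= (n * D)%:Z.
  move=> fD; apply: le_trans (ler_norm_sum _ _ _) _.
  apply: le_trans (_ : \sum_(l < n) D%:Z <= _); last first.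
    by rewrite sumr_const card_ord -mulr_natl natz PoszM.
  by rewrite big_mkcond; apply: ler_sum => l _; case: (b l).
have d1B : `|d1| <= (n * D)%:Z.
  by apply: dB => l; have /andP [h _] := uv l; rewrite distrC ltW.
have d2B : `|d2| <= (n * D)%:Z.
  by apply: dB => l; have /andP [_ h] := uv l; rewrite distrC ltW.
have Ed : \sum_(i <- enum 'I_n) (if b i then lat N kp (v i) else 0) =
   \sum_(i <- enum 'I_n) (if b i then lat N kp (u i) else 0) + (d1%:~R, d2%:~R, 0).
  rewrite !big_enum -!big_mkcond /=.
  have -> : (d1%:~R, d2%:~R, 0) = \sum_(l | b l) (((v l).1 - (u l).1)%:~R, ((v l).2 - (u l).2)%:~R, 0)
      :> 'Z_N * 'Z_N * 'Z_N.
    rewrite /d1 /d2; elim/big_rec3: _ => [|l y1 y2 y3 _ <-] //.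
    by rewrite !rmorphD /=; congr (_, _, _); rewrite /= ?addr0.
  rewrite -big_split; apply: eq_bigr => l _ /=.
  rewrite /lat; congr (_, _, _); rewrite /= ?addr0 // -rmorphD /=; congr (_%:~R); ring.
rewrite Ed opprB [_ - t]addrC addrACA E.
have coord (k : 'I_W) (d : int) : `|d| <= (n * D)%:Z ->
    exists k' : 'I_W', k%:R + (d%:~R + (n * D)%:R) = k'%:R :> 'Z_N.
  move=> dB'; have kW := ltn_ord k.
  have k'W : (`|(k%:Z + (d + (n * D)%N%:Z))%R| < W')%N.
    by move: kW WW' dB'; rewrite -mulnA; move: (n * D)%N => e; clear; lia.
  exists (Ordinal k'W) => /=; rewrite (pmulrn _ `|_|%N) gez0_abs.
    by rewrite !rmorphD /= -!pmulrn.
  by move: dB'; clear; lia.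
have [k1 e1] := coord i _ d1B; have [k2 e2] := coord j _ d2B.
apply/imset2P; exists k1 k2 => //; rewrite -e1 -e2.
by congr (_, _, _); rewrite /= !addr0.
Qed.

End LatticeTransfer.

(** Padding with [None] encodes the lists of length at most [K] in a finite type, so that codes can
    be counted. *)
Lemma pmap_tuple (K : nat) (X : eqType) (s : seq X) : (size s <= K)%N ->
  exists t : K.-tuple (option X), pmap id t = s.
Proof.
move=> sK; have st : size (map Some s ++ nseq (K - size s) None) == K.
  by rewrite size_cat size_map size_nseq subnKC.
exists (Tuple st); rewrite /= pmap_cat map_pK // (_ : pmap id _ = [::]) ?cats0 //.
by elim: (K - size s)%N.
Qed.

Lemma round_cell (R : realType) (T n : nat) (a b : 'I_n -> R) :
  (forall l, `|a l| <= 1) -> (forall l, `|b l| <= 1) ->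
  exists v : 'I_n -> cell T, forall l,
    `|T%:R * a l - (pos (v l)).1%:~R| <= 1 /\ `|T%:R * b l - (pos (v l)).2%:~R| <= 1.
Proof.
move=> a1 b1.
have aux (t : R) : `|t| <= 1 -> exists i : 'I_(2 * T + 1), `|T%:R * t - (i%:Z - T%:Z)%:~R| <= 1.
  move=> t1; pose m := Num.floor (T%:R * t).
  have [mlo mhi] := andP (floor_itv (T%:R * t)); rewrite -/m in mlo mhi.
  have T0 : 0 <= T%:R :> R by rewrite ler0n.
  have /andP [tlo thi] : - T%:R <= T%:R * t <= T%:R.
    by move: t1; rewrite ler_norml => /andP [h1 h2]; apply/andP; split; nra.
  have mT : (- T%:Z <= m) && (m <= T%:Z).
    apply/andP; split; first by rewrite floor_ge_int rmorphN.
    by rewrite -(ler_int R); apply: le_trans mlo thi.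
  have iT : (`|(m + T%:Z)%R| < 2 * T + 1)%N by move: mT; clear; lia.
  exists (Ordinal iT) => /=; rewrite gez0_abs; last by move: mT; clear; lia.
  rewrite addrK ger0_norm ?subr_ge0 //.
  by move: mhi; rewrite rmorphD /=; lra.
have [f fP] := choice (fun l => aux _ (a1 l)); have [g gP] := choice (fun l => aux _ (b1 l)).
by exists (fun l => (f l, g l)) => l; split; [exact: fP|exact: gP].
Qed.

(** * The union bound over bad normal vectors *)

Section Main.
Variables (R : realType) (n : nat) (r : signvec n) (z1 z2 : R) (w : signvec n -> R).
Variables (p : R) (N kp J J1 K M Q T A : nat) (W : nat -> nat) (L theta q eta : R).

(** [F j] is the mesh of the net at scale [W j], [rho j] the tolerance for row forms at a net point
    near a rescaled normal vector, and [eta1] a lower bound for the normalised energy of a bad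
    vector. *)
Let F j := ((2 * M + 1) * ((M + 1) * W j))%N.
Let rho j : R := (A * (F j + 1))%:R.
Let c : R := ((2 * J%:R) ^+ 2)^-1.
Let eta1 : R := eta / (4 * L).
Let G : R := 2 / (J1 * J)%:R.

Definition csup (u : 'I_n -> int * int) (W : nat) : R :=
  conc p (window N W) (latseq N kp u)
    [arg max_(t > 0 : 'Z_N * 'Z_N * 'Z_N) conc p (window N W) (latseq N kp u) t]%O.

Lemma conc_le_csup u W' t : conc p (window N W') (latseq N kp u) t <= csup u W'.
Proof. by rewrite /csup; case: arg_maxP => // i _; apply. Qed.

Hypothesis p01 : 0 <= p <= 1.
Hypothesis J0 : (0 < J)%N.
Hypothesis J1J : (0 < J1 <= J)%N.
Hypothesis kpJ : J1 = 1%N \/ kp = 1%N.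
Hypothesis eta0 : 0 < eta.
Hypothesis L1 : 1 <= L.
Hypothesis q1 : 1 <= q.
Hypothesis theta01 : 0 <= theta <= 1.
Hypothesis A_large : 2 * n%:R + `|z1| + `|z2| <= A%:R.
Hypothesis W_first : (A + 1 < W 0)%N.
Hypothesis W_step : forall j, (A * (F j + 1) + 1 + 2 * n * F j <= W j.+1)%N.
Hypothesis T_large : forall j, (j < Q)%N -> (A * (F j + 1) + F j + 1 < T)%N.
Hypothesis N_large : forall j, (j < Q)%N -> (8 * (J + 1) * T + W j + kp * (2 * J) < N)%N.
Hypothesis N1 : (1 < N)%N.
Hypothesis K_large : 4 * (1 - p * (1 - p) * c) ^+ K <= eta / L.
Hypothesis M_large : (2 / eta1) ^+ 2 <= M%:R.
Hypothesis Q_large : 1 <= q ^+ Q * (eta / L).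
(** A code of normalised energy [e] allows at most [1 + G/e] values per free coordinate and
    probability at most [min(1 - theta, 4 L q e)] per row; this keeps the product at most
    [1 - theta/2]. *)
Hypothesis gain : 4 * L * q * G <= theta / 2.

Hypothesis w0 : forall x, 0 <= w x.
Hypothesis w1 : \sum_x w x = 1.
(** Comparison of the row law with Bernoulli sums: [L] is [1] for Bernoulli rows and of order
    [sqrt n] for the slices. *)
Hypothesis w_window : forall u W (rr : R) c1 c2,
  (forall t, conc p (window N W) (latseq N kp u) t <= rr) ->
  wexp w (fun x => (inwin W x u c1 c2)%:R) <= L * rr.
Hypothesis w_nondeg : forall i (a b : 'I_n -> R) (rh : R) l, (rh < `|a l|) || (rh < `|b l|) ->
  wexp w (fun x => (small r z1 z2 x i a b rh)%:R) <= 1 - theta.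

Definition bad (k : 'I_n) (X : family n) : Prop :=
  exists a b : 'I_n -> R,
  [/\ forall l, `|a l| <= 1, forall l, `|b l| <= 1,
      exists l, 1 <= `|a l| \/ 1 <= `|b l|,
      forall l : 'I_n, (l < k)%N -> small r z1 z2 (X l) l a b 0
    & eta < wexp w (fun x => (small r z1 z2 x k a b (1 / T%:R))%:R)].

Let L0 : 0 < L. Proof. by apply: lt_le_trans L1. Qed.
Let c0 : 0 <= c. Proof. by rewrite invr_ge0 sqr_ge0. Qed.
Let J0R : 0 < J%:R :> R. Proof. by rewrite ltr0n. Qed.
Let cJ : c * (2 * J%:R) ^+ 2 <= 1.
Proof. by rewrite /c mulVf // expf_neq0 // mulf_neq0 ?pnatr_eq0 // -lt0n. Qed.
Let pc1 : p * (1 - p) * c <= 1.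
Proof.
have c1 : c <= 1.
  rewrite /c invf_le1 ?exprn_gt0 ?mulr_gt0 //.
  have : 1 <= J%:R :> R by rewrite ler1n.
  by rewrite expr2; nra.
move: p01 => /andP [p0 p1].
apply: mulr_ile1 => //; [by rewrite mulr_ge0 // subr_ge0 | by nra].
Qed.
Let W0 j : (0 < W j)%N.
Proof.
case: j => [|j]; first exact: leq_ltn_trans (leq0n _) W_first.
by apply: leq_trans (W_step j); rewrite addnAC addn1.
Qed.
Let eta10 : 0 < eta1. Proof. by rewrite divr_gt0 // mulr_gt0. Qed.

Lemma wexp_le f g : (forall x, f x <= g x) -> wexp w f <= wexp w g.
Proof. by move=> fg; apply: ler_sum => x _; apply: ler_wpM2l. Qed.

Lemma small_csup i u (rh : R) W' : rh < W'%:R ->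
  wexp w (fun x => (small r z1 z2 x i (ire R u) (iim R u) rh)%:R) <= L * csup u W'.
Proof.
move=> rW; have [c1 [c2 h]] := small_inwin r z1 z2 i u rW.
apply: le_trans (w_window c1 c2 (conc_le_csup u W')).
apply: wexp_le => x; case: (boolP (small _ _ _ _ _ _ _ _)) => [/h -> //|_].
by rewrite ler0n.
Qed.

(** Normalised to be comparable with a probability: for the greedy set chosen below, four times this
    value bounds [csup]. *)
Definition e_of (j : nat) (s : seq (cell T)) : R :=
  nrg p (window N (W j)) [seq lat N kp (pos y) | y <- s] / #|window N (W j)|%:R.

Definition cellre (u : 'I_n -> cell T) := ire R (fun l => pos (u l)).
Definition cellim (u : 'I_n -> cell T) := iim R (fun l => pos (u l)).

Lemma window_card j : 0 < #|window N (W j)|%:R :> R.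
Proof. by rewrite ltr0n card_window_gt0. Qed.

(** Scale the vector by [T] and round it to [v]. Its concentration stays above [eta / L], so at some
    scale the passage to the next one costs at most a factor [q]; the greedy structure is taken
    there. Every lattice vector near [v] inherits approximate orthogonality and the bounds on row
    probabilities. *)
Lemma bad_structure k X : bad k X ->
  exists j (s s' : seq 'I_n) (v : 'I_n -> cell T), (j < Q)%N /\
  [/\ (size s <= K)%N /\ (size s' <= K)%N,
   eta1 <= e_of j (map v s),
   forall i, i \notin s ++ s' ->
     incr p (window N (W j)) [seq lat N kp (pos y) | y <- map v s] (lat N kp (pos (v i)))
     <= c * nrg p (window N (W j)) [seq lat N kp (pos y) | y <- map v s],
   forall u : 'I_n -> cell T, (forall i, near (F j) (pos (u i)) (pos (v i))) ->
     (forall l : 'I_n, (l < k)%N -> small r z1 z2 (X l) l (cellre u) (cellim u) (rho j)) &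
   forall u : 'I_n -> cell T, (forall i, near (F j) (pos (u i)) (pos (v i))) ->
     forall l, wexp w (fun x => (small r z1 z2 x l (cellre u) (cellim u) (rho j))%:R)
       <= Num.min (1 - theta) (4 * L * q * e_of j (map v s))].
Proof.
case=> a [b [a1 b1 [l0 ab0] ort hk]].
have [v vP] := round_cell T a1 b1.
pose vi l := pos (v l).
(* For [Q = 0] the hypotheses would give [eta >= L >= 1], contradicting [hk]. *)
have T0 : 0 < T%:R :> R.
  rewrite ltr0n; case: (posnP Q) => [Q0|Q0]; last by exact: leq_ltn_trans (leq0n _) (T_large Q0).
  have := Q_large; rewrite Q0 expr0 mul1r => eL.
  have : eta < 1.
    apply: lt_le_trans hk _; rewrite -[leRHS]w1; apply: ler_sum => x _.
    by rewrite -[leRHS]mulr1; apply: ler_wpM2l => //; rewrite lern1 leq_b1.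
  move: eL; rewrite ler_pdivlMr // mul1r => eL e1; exfalso.
  by have := le_lt_trans (le_trans L1 eL) e1; rewrite ltxx.
(* After scaling, the tolerance [1/T] becomes [1] and rounding adds at most [A]; together this is
   less than [W 0]. *)
have big0 : eta / L < csup vi (W 0).
  rewrite ltr_pdivrMr // mulrC; apply: lt_le_trans hk _.
  apply: le_trans (small_csup k vi (_ : (1 + A%:R * 1) < _)); last first.
    by rewrite mulr1 addrC natr1 ltr_nat -addn1.
  apply: wexp_le => x; case: (boolP (small r z1 z2 x k a b _)) => [sm|_]; last by rewrite ler0n.
  rewrite (_ : small _ _ _ _ _ _ _ _ = true) //.
  have := sm; rewrite -(@smallZ _ _ r z1 z2 x k a b _ _ T0) mulrC divfK ?gt_eqF // => sm'.
  have := small_near (fun l => (vP l).1) (fun l => (vP l).2) sm'.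
  rewrite /small => /andP [h1 h2]; apply/andP; split.
    by apply: le_trans h1 _; rewrite lerD2l ler_wpM2r.
  by apply: le_trans h2 _; rewrite lerD2l ler_wpM2r.
have csup1 W' : csup vi W' <= 1 by exact: conc_le1.
(* Otherwise the concentration would gain a factor [q] at each of [Q] scales and exceed [1]. *)
have [j [jQ jstep jbig]] : exists j, [/\ (j < Q)%N, csup vi (W j.+1) <= q * csup vi (W j)
    & eta / L < csup vi (W j)].
  apply: contrapT => /forallNP no.
  have grow j : (j <= Q)%N -> q ^+ j * (eta / L) < csup vi (W j).
    elim: j => [|j IH] jQ; first by rewrite expr0 mul1r.
    have h := IH (ltnW jQ).
    have q0 : 0 < q by apply: lt_le_trans q1.
    have etaL : 0 < eta / L by rewrite divr_gt0.
    case: (lerP (csup vi (W j.+1)) (q * csup vi (W j))) => [le|gt].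
      exfalso; apply: (no j); split=> //; apply: le_lt_trans h.
      by rewrite -[leLHS]mul1r ler_pM2r // exprn_ege1.
    apply: lt_trans gt; rewrite exprS -mulrA ltr_pM2l //.
  have := grow Q (leqnn _); move/(le_lt_trans Q_large)/lt_le_trans => /(_ _ (csup1 _)).
  by rewrite ltxx.
pose B := window N (W j).
have Bp : 0 < #|B|%:R :> R := window_card j.
have cover x y : x \in B -> y \in B -> exists qq : bool * bool,
   x - y - ((if qq.1 then - (W j)%:R else 0, if qq.2 then - (W j)%:R else 0, 0) : 'Z_N * 'Z_N * 'Z_N) \in B.
  exact: window_cover.
have := @almost_period_structure R _ p B p01 n (fun i => lat N kp (vi i)) c K _ _ c0 pc1 cover.
have cardQ : #|{: bool * bool}|%:R = 4 :> R by rewrite card_prod card_bool.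
rewrite cardQ; case; last first.
  move=> h; exfalso.
  have := h [arg max_(t > 0 : 'Z_N * 'Z_N * 'Z_N) conc p (window N (W j)) (latseq N kp vi) t]%O.
  rewrite -/(latseq N kp vi) -/(csup vi (W j)) mulrC mulrA ler_pM2r // => h'.
  by have := lt_le_trans jbig (le_trans h' K_large); rewrite ltxx.
case=> s [s' [sK sK' sin sconc]].
exists j, s, s', v; split=> //.
have mapE : [seq lat N kp (pos y) | y <- map v s] = [seq lat N kp (vi i) | i <- s].
  by rewrite -map_comp.
have cse : csup vi (W j) <= 4 * e_of j (map v s).
  rewrite /e_of mapE mulrA ler_pdivlMr // mulrC.
  exact: sconc.
have e1 : eta1 <= e_of j (map v s).
  rewrite /eta1 invfM mulrA mulrAC ler_pdivrMr ?ltr0n // [_ * 4]mulrC.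
  exact: le_trans (ltW jbig) cse.
have uclose u : (forall i, near (F j) (pos (u i)) (pos (v i))) -> forall l,
    `|T%:R * a l - cellre u l| <= (F j + 1)%:R /\ `|T%:R * b l - cellim u l| <= (F j + 1)%:R.
  move=> un l; have [h1 h2] := vP l; have /andP [g1 g2] := un l.
  have aux (x : R) (m m' : int) : `|x - m'%:~R| <= 1 -> `|m - m'| < (F j)%:Z -> `|x - m%:~R| <= (F j + 1)%:R.
    move=> hx hm; rewrite (_ : x - m%:~R = (x - m'%:~R) - (m%:~R - m'%:~R)); last by ring.
    apply: le_trans (ler_normB _ _) _; rewrite natrD addrC; apply: lerD => //.
    by rewrite -rmorphB /= -intr_norm (_ : (F j)%:R = (F j)%:Z%:~R) // ler_int ltW.
  by split; [exact: aux h1 g1|exact: aux h2 g2].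
have FA : (2 * n%:R + `|z1| + `|z2|) * (F j + 1)%:R <= rho j.
  by rewrite /rho natrM ler_wpM2r.
split=> //.
- by move=> i /sin; rewrite mapE.
- move=> u /uclose uc l lk.
  have := ort l lk; rewrite -(@smallZ _ _ r z1 z2 (X l) l a b _ _ T0) mulr0 => sm.
  have := small_near (fun l => (uc l).1) (fun l => (uc l).2) sm; rewrite add0r.
  by rewrite /small => /andP [h1 h2]; rewrite (le_trans h1 FA) (le_trans h2 FA).
(* The bound [1 - theta] needs an entry of [u] above [rho j]: the normalised entry is scaled to at
   least [T] and moved by at most [F j + 1]. *)
move=> u un l; rewrite le_min; apply/andP; split.
  apply: (@w_nondeg l (cellre u) (cellim u) (rho j) l0).
  have [h1 h2] := uclose u un l0.
  have TF : rho j + (F j + 1)%:R < T%:R by rewrite /rho -natrD ltr_nat addnA T_large.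
  case: ab0 => ab; apply/orP; [left|right].
    have : T%:R <= `|T%:R * a l0| by rewrite normrM gtr0_norm // -[leLHS]mulr1 ler_pM2l.
    have := ler_normB (T%:R * a l0) (T%:R * a l0 - cellre u l0); rewrite subKr.
    have := ler_normD (T%:R * a l0 - cellre u l0) (cellre u l0); rewrite subrK; lra.
  have : T%:R <= `|T%:R * b l0| by rewrite normrM gtr0_norm // -[leLHS]mulr1 ler_pM2l.
  have := ler_normD (T%:R * b l0 - cellim u l0) (cellim u l0); rewrite subrK; lra.
(* Tolerance [rho j] for [u] is a window event for [u], hence one for [v] at scale [W j.+1]; the
   choice of [j] brings it back to [W j] at the cost of [q]. *)
apply: le_trans (small_csup l (fun l => pos (u l)) (_ : rho j < (A * (F j + 1) + 1)%:R)) _.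
  by rewrite /rho ltr_nat [X in (_ < X)%N]addn1.
rewrite -!mulrA mulrCA ler_pM2l // [X in _ <= X]mulrCA.
apply: le_trans (_ : q * csup vi (W j) <= _); last by rewrite ler_wpM2l // (le_trans _ q1).
apply: le_trans jstep.
have [t' ht] := @conc_transfer R p N kp n p01 _ _ _ _ _ 
    [arg max_(t > 0 : 'Z_N * 'Z_N * 'Z_N) conc p (window N (A * (F j + 1) + 1)) (latseq N kp (fun l => pos (u l))) t]%O un (W_step j).
by apply: le_trans ht (conc_le_csup _ _ _).
Qed.

(* A net point is described by the scale, the values of [v] on the greedy set
   and the positions and values of all coordinates outside the almost periods. *)
Definition code := ('I_Q * (K.-tuple (option (cell T))) *
  ((2 * K).-tuple (option ('I_n * cell T))))%type.

Let val_of (cd : code) : seq (cell T) := pmap id cd.1.2.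
Let en (cd : code) : R := e_of cd.1.1 (val_of cd).
Let cap (cd : code) : R := Num.min (1 - theta) (4 * L * q * en cd).

(** Looks up [i] among the recorded pairs: a recorded coordinate has one value, any other ranges
    over the net of almost periods. *)
Definition options (C : code -> {set cell T}) (cd : code) (i : 'I_n) : {set cell T} :=
  if ohead [seq x.2 | x <- pmap id cd.2 & x.1 == i] is Some y then [set y] else C cd.

Definition covers (cd : code) (C : {set cell T}) : Prop :=
  (forall x : cell T,
     incr p (window N (W cd.1.1)) [seq lat N kp (pos y) | y <- val_of cd] (lat N kp (pos x))
     <= c * nrg p (window N (W cd.1.1)) [seq lat N kp (pos y) | y <- val_of cd] ->
     exists2 y, y \in C & near (F cd.1.1) (pos x) (pos y)) /\
  #|C|%:R <= 1 + G / en cd.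

Lemma covers_exist : exists C : code -> {set cell T}, forall cd,
  eta1 <= en cd -> covers cd (C cd).
Proof.
suff H cd : exists C : {set cell T}, eta1 <= en cd -> covers cd C.
  by have [C CP] := choice H; exists C.
case: (boolP (eta1 <= en cd)) => [e1|]; last by exists finset.set0.
have Bp := window_card cd.1.1.
have nB : eta1 * #|window N (W cd.1.1)|%:R
    <= nrg p (window N (W cd.1.1)) [seq lat N kp (pos y) | y <- val_of cd].
  by rewrite -ler_pdivlMr.
have [C [h1 h2]] := centers p01 (W0 _) (N_large (ltn_ord cd.1.1)) J0 J1J kpJ cJ c0 eta10 nB M_large.
exists C => _; split=> //.
by rewrite /en /e_of invf_div.
Qed.

(** Does not depend on the sampled rows, so the union bound can be restricted to these [u]. *)
Let admissible (cd : code) (u : {ffun 'I_n -> cell T}) : bool :=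
  [forall l, wexp w (fun x => (small r z1 z2 x l (cellre u) (cellim u) (rho cd.1.1))%:R) <= cap cd].

Lemma ohead_assoc (I : eqType) (X : Type) (v : I -> X) (l : seq I) i :
  ohead [seq x.2 | x <- [seq (i', v i') | i' <- l] & x.1 == i] =
  if i \in l then Some (v i) else None.
Proof.
elim: l => //= a l IH; rewrite inE eq_sym.
by case: eqP => [->|] //=.
Qed.

(** [u] copies [v] on the two greedy sets; elsewhere [v i] is an almost period and [u i] is a net
    point near it. *)
Lemma bad_net (C : code -> {set cell T}) k X :
  (forall cd, eta1 <= en cd -> covers cd (C cd)) ->
  bad k X -> exists cd (u : {ffun 'I_n -> cell T}),
    [/\ eta1 <= en cd, u \in family_mem (fun i => mem (options C cd i)), admissible cd u &
     forall l : 'I_n, (l < k)%N -> small r z1 z2 (X l) l (cellre u) (cellim u) (rho cd.1.1)].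
Proof.
move=> CP /bad_structure [j [s [s' [v [jQ [[sK sK'] e1 sin sort sprob]]]]]].
have [t1 t1E] : exists t : K.-tuple (option (cell T)), pmap id t = map v s.
  by apply: pmap_tuple; rewrite size_map.
have [t2 t2E] : exists t : (2 * K).-tuple (option ('I_n * cell T)),
    pmap id t = [seq (i, v i) | i <- s ++ s'].
  by apply: pmap_tuple; rewrite size_map size_cat mul2n -addnn leq_add.
pose cd : code := (Ordinal jQ, t1, t2).
have vE : val_of cd = map v s by [].
have enE : en cd = e_of j (map v s) by rewrite /en vE.
have e1' : eta1 <= en cd by rewrite enE.
have [near_c _] := CP cd e1'; rewrite vE in near_c.
have F0 : (0 < F j)%N.
  by rewrite /F muln_gt0 addn1 /= muln_gt0 W0 addn1.
have [u uP] : exists u : 'I_n -> cell T, forall i,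
    near (F j) (pos (u i)) (pos (v i)) /\ u i \in options C cd i.
  suff H i : exists y : cell T, near (F j) (pos y) (pos (v i)) /\ y \in options C cd i.
    by have [u uP] := choice H; exists u.
  rewrite /options t2E ohead_assoc.
  case: (boolP (i \in s ++ s')) => [_|/sin /near_c [y yC ny]].
    by exists (v i); split; [rewrite /near !subrr normr0 ltz_nat F0|rewrite inE].
  by exists y; split=> //; rewrite /near ![`|(pos y).1 - _|]distrC ![`|(pos y).2 - _|]distrC.
exists cd, [ffun i => u i].
have un i : near (F j) (pos ([ffun i => u i] i)) (pos (v i)) by rewrite ffunE; case: (uP i).
split=> //.
- by apply/familyP => i; rewrite ffunE; case: (uP i).
- apply/forallP => l; rewrite /cap enE; exact: (sprob _ un l).
- exact: (sort _ un).
Qed.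

Lemma prod_ord_lt (k : nat) (m : R) : (k <= n)%N ->
  \prod_(l < n) (if (l < k)%N then m else 1) = m ^+ k.
Proof. by move=> kn; rewrite -big_mkcond -(big_ord_widen _ (fun=> m)) // prodr_const card_ord. Qed.

(** Union bound over codes and net points, with independence of the rows. A code of normalised
    energy [e] contributes at most [(1 + G/e)^n cap^k]; [k] of the coordinates are paired with the
    [k] rows, and each of the others costs at most [1 + G/eta1]. *)
Lemma bad_prob (k : 'I_n) :
  pexp w (fun X : family n => `[< bad k X >]%:R)
  <= #|{: code}|%:R * ((1 - theta / 2) ^+ k * (1 + G / eta1) ^+ (n - k)).
Proof.
have [C CP] := covers_exist.
pose P (cd : code) (u : {ffun 'I_n -> cell T}) :=
  [&& eta1 <= en cd, u \in family_mem (fun i => mem (options C cd i)) & admissible cd u].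
(* Rows from [k] on get the factor [1], so that the expectation factorises over all rows. *)
pose fac (cd : code) (u : {ffun 'I_n -> cell T}) (l : 'I_n) (x : signvec n) : R :=
  if (l < k)%N then (small r z1 z2 x l (cellre u) (cellim u) (rho cd.1.1))%:R else 1.
have fac0 cd u (X : family n) : 0 <= \prod_l fac cd u l (X l).
  by apply: prodr_ge0 => l _; rewrite /fac; case: ifP.
apply: le_trans (_ : \sum_cd \sum_(u | P cd u) pexp w (fun X : family n => \prod_l fac cd u l (X l)) <= _).
  under eq_bigr => cd _ do rewrite -pexp_sum.
  rewrite -pexp_sum; apply: ler_pexp => // X.
  case: (boolP `[< bad k X >]) => [/asboolP /(bad_net CP) [cd [u [h1 h2 h3 h4]]]|_]; last first.
    by apply: sumr_ge0 => cd _; apply: sumr_ge0.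
  rewrite (bigD1 cd) //= (bigD1 u) /=; last by rewrite /P h1 h2 h3.
  rewrite (_ : \prod_l fac cd u l (X l) = 1).
    rewrite -addrA lerDl addr_ge0 //; first by apply: sumr_ge0.
    by apply: sumr_ge0 => ? _; apply: sumr_ge0.
  by rewrite big1 // => l _; rewrite /fac; case: ifP => // lk; rewrite h4.
rewrite -sum1_card natr_sum mulr_suml; apply: ler_sum => cd _; rewrite mul1r.
have G0 : 0 <= G by rewrite /G divr_ge0.
have t0 : 0 <= 1 - theta / 2 by move: theta01 => /andP [_ h]; lra.
have ge0 : 0 <= (1 - theta / 2) ^+ k * (1 + G / eta1) ^+ (n - k).
  by rewrite mulr_ge0 ?exprn_ge0 // addr_ge0 // divr_ge0 // ltW.
case: (boolP (eta1 <= en cd)) => e1; last first.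
  by rewrite big1 // => u; rewrite /P (negbTE e1).
have en0 : 0 < en cd by apply: lt_le_trans e1.
have cap0 : 0 <= cap cd.
  rewrite /cap le_min subr_ge0 (andP theta01).2 /= mulr_ge0 ?(ltW en0) // mulr_ge0 ?mulr_ge0 //.
    exact: ltW.
  exact: le_trans q1.
pose a := 1 + G / en cd.
have a0 : 0 <= a by rewrite addr_ge0 // divr_ge0 // ltW.
have [_ Cc] := CP cd e1.
apply: le_trans (_ : \sum_(u in family_mem (fun i => mem (options C cd i))) cap cd ^+ k <= _).
  rewrite [X in X <= _]big_mkcond [X in _ <= X]big_mkcond /=; apply: ler_sum => u _.
  case: ifP => [/and3P [_ uf /forallP ua]|_]; last by case: ifP => // _; rewrite exprn_ge0.
  rewrite uf pexp_prod -(prod_ord_lt (cap cd) (ltnW (ltn_ord k))).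
  apply: ler_prod => l _; rewrite /fac; case: ifP => lk.
    rewrite (ua l) andbT; apply: sumr_ge0 => x _.
    by rewrite mulr_ge0 ?ler0n.
  by under eq_bigr do rewrite mulr1; rewrite w1 ler01 lexx.
rewrite sumr_const -[X in X <= _]mulr_natl card_family.
have cardle : (foldr muln 1 [seq #|options C cd i| | i : 'I_n])%N%:R <= a ^+ n :> R.
  rewrite foldrE big_map big_enum natr_prod /=.
  apply: le_trans (_ : \prod_(i < n) a <= _); last by rewrite prodr_const card_ord.
  apply: ler_prod => i _; rewrite ler0n /= /options.
  case: ohead => [y|] //; rewrite cards1.
  by rewrite /a lerDl divr_ge0 // ltW.
apply: le_trans (_ : a ^+ n * cap cd ^+ k <= _).
  by apply: ler_wpM2r => //; rewrite exprn_ge0.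
rewrite -{1}(subnKC (ltnW (ltn_ord k))) exprD mulrAC -exprMn.
apply: ler_pM; rewrite ?exprn_ge0 ?mulr_ge0 //.
  apply: lerXn2r; rewrite ?nnegrE ?mulr_ge0 //.
  rewrite /a mulrDl mul1r.
  (* The summand [1] of [a] is multiplied by the bound [1 - theta] for [cap], the summand
     [G / en cd] by the bound [4 L q en cd]. *)
  have h1 : cap cd <= 1 - theta by rewrite /cap ge_min lexx.
  have h2 : G / en cd * cap cd <= theta / 2.
    apply: le_trans gain.
    rewrite [4 * L * q * G]mulrC -mulrA; apply: ler_wpM2l => //.
    by rewrite mulrC ler_pdivrMr // /cap ge_min lexx orbT.
  lra.
have h : G / en cd <= G / eta1 by apply: ler_wpM2l => //; rewrite lef_pV2 ?posrE.
by apply: lerXn2r; rewrite ?nnegrE ?lerD2l // addr_ge0 // divr_ge0 // ltW.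
Qed.

End Main.

(** * Distances and normal vectors *)

Section Distance.
Variables (R : realType) (n : nat) (r : signvec n) (z : R[i]).
Let z1 : R := complex.Re z * Num.sqrt n%:R.
Let z2 : R := complex.Im z * Num.sqrt n%:R.

Lemma complexReD (x y : R[i]) : complex.Re (x + y) = complex.Re x + complex.Re y.
Proof. by case: x; case: y. Qed.

Lemma complexImD (x y : R[i]) : complex.Im (x + y) = complex.Im x + complex.Im y.
Proof. by case: x; case: y. Qed.

Lemma complexRe_sum I (s : seq I) (P : pred I) (f : I -> R[i]) :
  complex.Re (\sum_(i <- s | P i) f i) = \sum_(i <- s | P i) complex.Re (f i).
Proof. exact: (big_morph (@complex.Re R) complexReD). Qed.

Lemma complexIm_sum I (s : seq I) (P : pred I) (f : I -> R[i]) :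
  complex.Im (\sum_(i <- s | P i) f i) = \sum_(i <- s | P i) complex.Im (f i).
Proof. exact: (big_morph (@complex.Im R) complexImD). Qed.

Lemma complexReM (x y : R[i]) :
  complex.Re (x * y) = complex.Re x * complex.Re y - complex.Im x * complex.Im y.
Proof. by case: x; case: y. Qed.

Lemma complexImM (x y : R[i]) :
  complex.Im (x * y) = complex.Re x * complex.Im y + complex.Im x * complex.Re y.
Proof. by case: x; case: y. Qed.

Lemma row_vecE (X : family n) i l : row_vec z r X i l =
  ((sgn R (X i l) + sgn R (r l) + (if i == l then z1 else 0)) +i* (if i == l then z2 else 0))%C.
Proof.
rewrite /row_vec /z1 /z2; case: z => a b /=.
by case: eqP => _; apply/eqP; rewrite eq_complex /=; apply/andP; split; apply/eqP; ring.
Qed.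

Lemma form_row_vec (X : family n) i (v : 'I_n -> R[i]) :
  let a l := complex.Re (v l) in let b l := complex.Im (v l) in
  complex.Re (\sum_l row_vec z r X i l * v l) = form r z1 z2 (X i) i a b /\
  complex.Im (\sum_l row_vec z r X i l * v l) = form r z1 (- z2) (X i) i b a.
Proof.
move=> a b; rewrite complexRe_sum complexIm_sum /form.
have pick (f : 'I_n -> R) : \sum_l (if i == l then f l else 0) = f i.
  rewrite (bigD1 i) //= eqxx big1 ?addr0 // => l; rewrite eq_sym.
  by move/negbTE => ->.
split.
  rewrite -(pick (fun l => z1 * a l)) -(pick (fun l => z2 * b l)) -!big_split -sumrB /=.
  apply: eq_bigr => l _; rewrite complexReM row_vecE /= -/(a l) -/(b l).
  by case: eqP => _; ring.
rewrite mulNr opprK -(pick (fun l => z1 * b l)) -(pick (fun l => z2 * a l)) -!big_split /=.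
apply: eq_bigr => l _; rewrite complexImM row_vecE /= -/(a l) -/(b l).
by case: eqP => _; ring.
Qed.

(** The square matrix whose columns are the first [k] rows, padded with zero columns, is singular
    since column [k] vanishes. A kernel vector is divided by the largest absolute value among its
    real and imaginary parts. The product is bilinear, without conjugation. *)
Lemma normal_vector (X : family n) (k : 'I_n) : exists a b : 'I_n -> R,
  [/\ forall l, `|a l| <= 1, forall l, `|b l| <= 1,
      exists l, 1 <= `|a l| \/ 1 <= `|b l| &
      forall l : 'I_n, (l < k)%N -> small r z1 z2 (X l) l a b 0].
Proof.
pose M : 'M[R[i]]_n := \matrix_(l, j) (if (j < k)%N then row_vec z r X j l else 0).
have : \det M = 0.
  rewrite -det_tr (expand_det_row _ k) big1 // => j _.
  by rewrite mxE mxE ltnn mul0r.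
move/eqP/det0P => [v v0 vM].
have ort (j : 'I_n) : (j < k)%N -> \sum_l row_vec z r X j l * v ord0 l = 0.
  move=> jk; have := congr1 (fun u : 'rV_n => u ord0 j) vM; rewrite !mxE => h; rewrite -[RHS]h.
  by apply: eq_bigr => l _; rewrite mxE jk mulrC.
pose m l := Num.max `|complex.Re (v ord0 l)| `|complex.Im (v ord0 l)|.
pose l0 := [arg max_(l > k) m l]%O.
have mmax l : m l <= m l0 by rewrite /l0; case: arg_maxP => // i _; apply.
have m0 : 0 < m l0.
  rewrite lt_neqAle (le_trans _ (mmax k)) ?andbT; last by rewrite le_max normr_ge0.
  apply: contraNneq v0 => m0; apply/eqP/rowP => l; rewrite mxE.
  have := mmax l; rewrite -m0 ge_max !normr_le0 => /andP [/eqP e1 /eqP e2].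
  by apply/eqP; rewrite eq_complex e1 e2 !eqxx.
exists (fun l => (m l0)^-1 * complex.Re (v ord0 l)), (fun l => (m l0)^-1 * complex.Im (v ord0 l)).
have nm x : `|(m l0)^-1 * x| = `|x| / m l0.
  by rewrite normrM gtr0_norm ?invr_gt0 // mulrC.
split.
- by move=> l; rewrite nm ler_pdivrMr // mul1r; apply: le_trans (mmax l); rewrite le_max lexx.
- by move=> l; rewrite nm ler_pdivrMr // mul1r; apply: le_trans (mmax l); rewrite le_max lexx orbT.
- exists l0; rewrite !nm !ler_pdivlMr // !mul1r /m.
  by case: (leP `|complex.Re (v ord0 l0)| `|complex.Im (v ord0 l0)|) => _; [right|left].
move=> l lk; have [e1 e2] := form_row_vec X l (fun j => v ord0 j).
rewrite -[0](mulr0 (m l0)^-1) smallZ ?invr_gt0 // /small.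
by rewrite -e1 -e2 (ort l lk) /= normr0 lexx.
Qed.

Lemma cnorm_bound (v : cvec R n) l : `|complex.Re (v l)| <= cnorm v /\ `|complex.Im (v l)| <= cnorm v.
Proof.
have ge (j : 'I_n) : 0 <= complex.Re (v j) ^+ 2 + complex.Im (v j) ^+ 2.
  by rewrite addr_ge0 ?sqr_ge0.
have le : complex.Re (v l) ^+ 2 + complex.Im (v l) ^+ 2 <=
   \sum_(j < n) (complex.Re (v j) ^+ 2 + complex.Im (v j) ^+ 2).
  by rewrite (bigD1 l) //= lerDl; apply: sumr_ge0.
by rewrite /cnorm -!sqrtr_sqr; split; apply: ler_wsqrtr; apply: le_trans le;
  rewrite ?lerDl ?lerDr sqr_ge0.
Qed.

(** Subtracting a combination of earlier rows does not change the product of row [k] with the normal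
    vector, and a vector of norm below [d] has product at most [2 n d] in each part. *)
Lemma dist_span_small (X : family n) (k : 'I_n) (a b : 'I_n -> R) (d : R) :
  (forall l, `|a l| <= 1) -> (forall l, `|b l| <= 1) ->
  (forall l : 'I_n, (l < k)%N -> small r z1 z2 (X l) l a b 0) ->
  dist_span (row_vec z r X k) (row_vec z r X) k < d ->
  small r z1 z2 (X k) k a b (2 * n%:R * d).
Proof.
move=> a1 b1 ort dd.
have [c cd] : exists c : 'I_n -> R[i],
    cnorm (fun l => row_vec z r X k l - \sum_(j < n | (j < k)%N) c j * row_vec z r X j l) < d.
  apply: contrapT => /forallNP no; move: dd; rewrite ltNge => /negP; apply.
  apply: lb_le_inf; first by exists (cnorm (fun l => row_vec z r X k l - \sum_(j < n | (j < k)%N) 0 * row_vec z r X j l)), (fun=> 0).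
  by move=> _ [c ->]; rewrite leNgt; apply/negP; exact: no.
set y := (fun l => _) in cd.
pose v l : R[i] := (a l +i* b l)%C.
have e (i : 'I_n) := form_row_vec X i v.
have ort0 (j : 'I_n) : (j < k)%N -> \sum_l row_vec z r X j l * v l = 0.
  move=> jk; have [e1 e2] := e j; have := ort j jk; rewrite /small !normr_le0.
  move=> /andP [/eqP o1 /eqP o2]; apply/eqP; rewrite eq_complex e1 e2 /=.
  by apply/andP; split; apply/eqP.
have yv : \sum_l row_vec z r X k l * v l = \sum_l y l * v l.
  transitivity (\sum_l row_vec z r X k l * v l - \sum_(j < n | (j < k)%N) c j * \sum_l row_vec z r X j l * v l).
    by rewrite [X in _ - X]big1 ?subr0 // => j jk; rewrite ort0 // mulr0.
  under [X in _ - X]eq_bigr do rewrite mulr_sumr.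
  rewrite exchange_big -sumrB; apply: eq_bigr => l _ /=.
  by rewrite mulrBl mulr_suml; congr (_ - _); apply: eq_bigr => j _; rewrite mulrA.
have bd (s t u1 u2 : R) : `|s| <= cnorm y -> `|t| <= cnorm y -> `|u1| <= 1 -> `|u2| <= 1 ->
    `|s * u1| + `|t * u2| <= 2 * d.
  move=> s1 t1 h1 h2; rewrite !normrM.
  have : `|s| * `|u1| <= d * 1 by apply: ler_pM => //; apply: le_trans (ltW cd).
  have : `|t| * `|u2| <= d * 1 by apply: ler_pM => //; apply: le_trans (ltW cd).
  lra.
have sumbd (f : 'I_n -> R) : (forall l, `|f l| <= 2 * d) -> `|\sum_l f l| <= 2 * n%:R * d.
  move=> fd; apply: le_trans (ler_norm_sum _ _ _) _.
  apply: le_trans (_ : \sum_(l < n) 2 * d <= _); first by apply: ler_sum.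
  by rewrite sumr_const card_ord -[(2 * d) *+ n]mulr_natr mulrAC.
have [e1 e2] := e k; rewrite /small -e1 -e2 yv complexRe_sum complexIm_sum.
apply/andP; split; apply: sumbd => l; have [y1 y2] := cnorm_bound y l.
  by rewrite complexReM; apply: le_trans (ler_normB _ _) _; apply: bd => //; [exact: a1|exact: b1].
by rewrite complexImM; apply: le_trans (ler_normD _ _) _; apply: bd => //; [exact: b1|exact: a1].
Qed.

(** The zero combination bounds the distance by the norm of the row. *)
Lemma dist_span_le (X : family n) (k : 'I_n) :
  0 <= dist_span (row_vec z r X k) (row_vec z r X) k <=
    (2 * n%:R + 1) * (2 + `|z1| + `|z2|).
Proof.
apply/andP; split.
  apply: lb_le_inf; last by move=> _ [c ->]; exact: sqrtr_ge0.
  by exists (cnorm (fun l => row_vec z r X k l - \sum_(j < n | (j < k)%N) 0 * row_vec z r X j l)), (fun=> 0).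
apply: le_trans (_ : cnorm (fun l => row_vec z r X k l - \sum_(j < n | (j < k)%N) 0 * row_vec z r X j l) <= _).
  apply: ge_inf; last by exists (fun=> 0).
  by exists 0 => _ [c ->]; exact: sqrtr_ge0.
set D := 2 + _ + _.
have D0 : 0 <= D by rewrite /D !addr_ge0.
rewrite /cnorm -[leRHS]ger0_norm; last by rewrite mulr_ge0 // addr_ge0 // mulr_ge0.
rewrite -sqrtr_sqr; apply: ler_wsqrtr.
apply: le_trans (_ : \sum_(j < n) (2 * D ^+ 2) <= _).
  apply: ler_sum => l _.
  rewrite big1 ?subr0; last by move=> j _; rewrite mul0r.
  have sq (x : R) : `|x| <= D -> x ^+ 2 <= D ^+ 2.
    by move=> xD; rewrite -(real_normK (num_real x)) lerXn2r ?nnegrE.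
  rewrite row_vecE /= (_ : 2 * D ^+ 2 = D ^+ 2 + D ^+ 2); last by ring.
  apply: lerD; apply: sq; rewrite /D.
    apply: le_trans (ler_normD _ _) _.
    have : `|sgn R (X k l) + sgn R (r l)| <= 2.
      by apply: le_trans (ler_normD _ _) _; rewrite !sgn_norm.
    have := normr_ge0 z1; have := normr_ge0 z2.
    by case: eqP => _; rewrite ?normr0; lra.
  have := normr_ge0 z1; have := normr_ge0 z2.
  by case: eqP => _; rewrite ?normr0; lra.
rewrite sumr_const card_ord -[_ *+ n]mulr_natr exprMn mulrAC; apply: ler_wpM2r; first exact: sqr_ge0.
have : 0 <= n%:R :> R by []. nra.
Qed.

End Distance.

(** Row [k] is resampled given the others. Badness and the normal vector depend only on earlier
    rows, so they survive the resampling, and if [X] is not bad the fresh row is close to the span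
    with probability at most [eta]. *)
Lemma dist_prob (R : realType) (n : nat) (r : signvec n) (z : R[i]) (w : signvec n -> R)
    (T : nat) (eta d : R) (k : 'I_n) :
  (forall x, 0 <= w x) -> \sum_x w x = 1 -> 0 <= eta ->
  2 * n%:R * d <= 1 / T%:R ->
  pexp w (fun X : family n => (dist_span (row_vec z r X k) (row_vec z r X) k < d)%R%:R)
  <= pexp w (fun X : family n =>
       `[< bad r (complex.Re z * Num.sqrt n%:R) (complex.Im z * Num.sqrt n%:R) w T eta k X >]%:R) + eta.
Proof.
move=> w0 w1 eta0 dT; rewrite (pexp_resample k) //.
have etaE : pexp w (fun X : family n => eta * 1) = eta by rewrite pexpZ pexp1 ?mulr1.
rewrite -[X in _ <= _ + X]etaE -pexpD.
apply: ler_pexp => // X; rewrite mulr1.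
case: (boolP `[< _ >]) => [_|/asboolPn nb] /=.
  apply: le_trans (_ : \sum_y w y <= _); last by rewrite w1 lerDl.
  apply: ler_sum => y _; rewrite -[leRHS]mulr1; apply: ler_wpM2l => //.
  by rewrite lern1 leq_b1.
rewrite add0r; have [a [b [a1 b1 ab ort]]] := normal_vector r z X k.
rewrite leNgt; apply/negP => gt; apply: nb; exists a, b; split=> //.
apply: lt_le_trans gt _; apply: ler_sum => y _; apply: ler_wpM2l => //.
case: (boolP (dist_span _ _ _ < d)) => [dd|_]; last by rewrite ler0n.
have ort' (l : 'I_n) : (l < k)%N ->
    small r (complex.Re z * Num.sqrt n%:R) (complex.Im z * Num.sqrt n%:R) (upd X k y l) l a b 0.
  move=> lk; rewrite ffunE; case: eqP => [lk'|_]; last exact: ort.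
  by rewrite lk' ltnn in lk.
have := dist_span_small a1 b1 ort' dd; rewrite ffunE eqxx => /andP [h1 h2].
by rewrite /small (le_trans h1 dT) (le_trans h2 dT).
Qed.

(** * Bernoulli rows and rows uniform on two slices *)

Section Models.
Variables (R : realType) (n : nat) (s : int).
Let p : R := 2^-1 + s%:~R / (2 * n%:R).

Definition ones (x : signvec n) : nat := #|[set i | x i]|.

Lemma wBE : wB R s = (fun x : signvec n => \prod_j bw p (x j)).
Proof.
apply: funext => x; apply: eq_bigr => j _; rewrite /bw /p.
by case: (x j) => //; set t := _ / _; field.
Qed.

Lemma wexp_wB (F : signvec n -> R) : wexp (wB R s) F = pexp (bw p) F.
Proof. by rewrite wBE. Qed.

Hypothesis p01 : 0 <= p <= 1.

Let bw0 y : 0 <= bw p y.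
Proof. by move: p01 => /andP [? ?]; rewrite /bw; case: y => //; rewrite subr_ge0. Qed.

Lemma wB_ge0 (x : signvec n) : 0 <= wB R s x :> R.
Proof. by rewrite wBE; apply: prodr_ge0. Qed.

Lemma wB_sum : \sum_(x : signvec n) wB R s x = 1 :> R.
Proof.
rewrite wBE -[RHS](@pexp1 _ 'I_n _ (bw p) (bw_sum p)).
by apply: eq_bigr => x _; rewrite mulr1.
Qed.

Lemma lat_sum N kp (u : 'I_n -> int * int) (P : pred 'I_n) :
  \sum_(l | P l) lat N kp (u l) = ((\sum_(l | P l) (u l).1)%:~R, (\sum_(l | P l) (u l).2)%:~R,
    (kp * #|P|)%:R) :> 'Z_N * 'Z_N * 'Z_N.
Proof.
have -> : (kp * #|P|)%:R = \sum_(l | P l) kp%:R :> 'Z_N.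
  by rewrite (eq_bigl (mem P)) // sumr_const -mulrnA.
rewrite !rmorph_sum /=; elim: (index_enum _) => [|l t IH]; first by rewrite !big_nil.
by rewrite !big_cons; case: ifP => Pl; rewrite IH.
Qed.

Lemma inwin_lat N kp W (x : signvec n) u c1 c2 : (1 < N)%N -> inwin W x u c1 c2 ->
  \sum_(i <- enum 'I_n) (if x i then lat N kp (u i) else 0)
    - (c1%:~R, c2%:~R, (kp * ones x)%:R) \in window N W.
Proof.
move=> N1 /andP [/andP [h1 h2] /andP [h3 h4]].
set y1 := \sum_(l | x l) (u l).1 in h1 h2; set y2 := \sum_(l | x l) (u l).2 in h3 h4.
have -> : \sum_(i <- enum 'I_n) (if x i then lat N kp (u i) else 0)
   = (y1%:~R, y2%:~R, (kp * ones x)%:R).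
  by rewrite big_enum -big_mkcond /= lat_sum /ones cardsE.
have a1W : (`|(y1 - c1)%R| < W)%N by move: h1 h2; clear; lia.
have a2W : (`|(y2 - c2)%R| < W)%N by move: h3 h4; clear; lia.
apply/imset2P; exists (Ordinal a1W) (Ordinal a2W) => //=.
rewrite !(pmulrn _ `|_|%N) !gez0_abs //.
by congr (_, _, _); rewrite /= ?rmorphB ?subrr.
Qed.

Lemma wB_lat N kp W u (rr : R) t :
  (forall t, conc p (window N W) (latseq N kp u) t <= rr) ->
  wexp (wB R s) (fun x : signvec n => (\sum_(i <- enum 'I_n) (if x i then lat N kp (u i) else 0) - t
      \in window N W)%:R) <= rr.
Proof.
move=> h; apply: le_trans (h t); rewrite wexp_wB /conc /latseq.
by rewrite -(ev_pexp p _ _ (enum_uniq _)).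
Qed.

Lemma wB_window N W u (rr : R) c1 c2 : (1 < N)%N ->
  (forall t, conc p (window N W) (latseq N 0 u) t <= rr) ->
  wexp (wB R s) (fun x : signvec n => (inwin W x u c1 c2)%:R) <= 1 * rr.
Proof.
move=> N1 h; rewrite mul1r; apply: le_trans (wB_lat (c1%:~R, c2%:~R, 0) h).
apply: ler_sum => x _; apply: ler_wpM2l; first exact: wB_ge0.
case: (boolP (inwin _ _ _ _ _)) => [|_]; last by rewrite ler0n.
by move/(inwin_lat 0 N1); rewrite mul0n => ->.
Qed.

(** Flipping bit [l] changes the two forms by [2 a l] and [2 b l]; if both configurations were
    small, these changes would be at most [2 rh]. *)
Lemma small_flip r (z1 z2 : R) i (a b : 'I_n -> R) (rh : R) l (x : signvec n) :
  (rh < `|a l|) || (rh < `|b l|) ->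
  small r z1 z2 (upd x l true) i a b rh -> small r z1 z2 (upd x l false) i a b rh -> False.
Proof.
have df z z' (f g : 'I_n -> R) :
    form r z z' (upd x l true) i f g - form r z z' (upd x l false) i f g = 2 * f l.
  rewrite /form (bigD1 l) //= [X in _ - (X + _ - _)](bigD1 l) //= !ffunE eqxx /sgn.
  rewrite (eq_bigr (fun j => (sgn R (upd x l false j) + sgn R (r j)) * f j)); first by rewrite /sgn; ring.
  by move=> j /negbTE jl; rewrite !ffunE jl.
move=> big /andP [h1 h2] /andP [h3 h4].
case/orP: big => big.
  have := ler_normB (form r z1 z2 (upd x l true) i a b) (form r z1 z2 (upd x l false) i a b).
  rewrite df normrM (ger0_norm (_ : 0 <= 2)) //; lra.
have := ler_normB (form r z1 (- z2) (upd x l true) i b a) (form r z1 (- z2) (upd x l false) i b a).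
rewrite df normrM (ger0_norm (_ : 0 <= 2)) //; lra.
Qed.

(** Given the other bits, at most one value of bit [l] lies in the event, and either value has
    probability at most [1 - theta]. *)
Lemma wB_nondeg r (z1 z2 : R) i (a b : 'I_n -> R) (rh : R) l theta :
  theta <= p -> theta <= 1 - p ->
  (rh < `|a l|) || (rh < `|b l|) ->
  wexp (wB R s) (fun x : signvec n => (small r z1 z2 x i a b rh)%:R) <= 1 - theta.
Proof.
move=> tp t1p big; rewrite wexp_wB (pexp_resample l) ?bw_sum //.
have t1 : pexp (bw p) (fun x : {ffun 'I_n -> bool} => (1 - theta) * 1) = 1 - theta.
  by rewrite pexpZ pexp1 ?bw_sum ?mulr1.
rewrite -[leRHS]t1; apply: ler_pexp => // x.
rewrite big_bool /= mulr1; have := @small_flip r z1 z2 i a b rh l x big.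
case: (small _ _ _ (upd x l true) _ _ _ _); case: (small _ _ _ (upd x l false) _ _ _ _).
- by move=> /(_ isT isT).
all: move=> _ /=; lra.
Qed.

(** * The uniform measure on two adjacent slices of the cube *)

Section Slices.
Variables (k0 m : nat) (beta : R).
(** Vectors of coordinate sum [s - 1] and [s + 1] have [k0] and [k0 + 1] ones. *)
Hypothesis k0E : (2 * k0 + 1)%N%:Z = n%:Z + s.
Hypothesis n0 : (0 < n)%N.
Hypothesis beta0 : 0 < beta.
Hypothesis betap : beta <= p.
Hypothesis beta1p : beta <= 1 - p.
Hypothesis m2 : (n <= m * m)%N.

Let np : p * n%:R = k0%:R + 2^-1.
Proof.
have h : (2 * k0 + 1)%N%:R = n%:R + s%:~R :> R.
  by have := congr1 (fun x : int => x%:~R : R) k0E; rewrite /= intrD -!pmulrn.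
have -> : p * n%:R = (n%:R + s%:~R) / 2 by rewrite /p; field; rewrite pnatr_eq0 -lt0n.
by rewrite -h natrD natrM; field.
Qed.

Let k0n : (k0 < n)%N.
Proof.
have : p * n%:R < n%:R.
  by rewrite -[ltRHS]mul1r ltr_pM2r ?ltr0n // -subr_gt0; exact: lt_le_trans beta0 beta1p.
rewrite np -(ltr_nat R) => h; lra.
Qed.

Lemma vsum_ones (v : signvec n) : vsum v = 2 * (ones v)%:Z - n%:Z.
Proof.
have -> : (ones v)%:Z = \sum_(j < n) (if v j then 1 else 0).
  by rewrite -big_mkcond /= /ones cardsE -sum1_card -natz natr_sum; apply: eq_bigr.
have -> : n%:Z = \sum_(j < n) 1 by rewrite sumr_const card_ord natz.
by rewrite mulr_sumr -sumrB; apply: eq_bigr => j _; case: (v j).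
Qed.

Lemma in_setS (v : signvec n) : (v \in setS n s) = (ones v == k0) || (ones v == k0.+1).
Proof.
by rewrite inE vsum_ones; move: k0E; move: (ones v) => o; lia.
Qed.

Lemma slice_card_gen (P : {set 'I_n} -> bool) :
  #|[set v : signvec n | P [set i | v i]]| = #|[set A : {set 'I_n} | P A]|.
Proof.
pose f (v : signvec n) := [set i | v i].
have fK : cancel f (fun A => [ffun i => i \in A]) by move=> v; apply/ffunP => i; rewrite ffunE inE.
rewrite -(card_imset _ (can_inj fK)); apply: eq_card => A; rewrite !inE.
apply/imsetP/idP => [[v]|PA]; first by rewrite inE => Pv ->.
exists [ffun i => i \in A].
  by rewrite inE (_ : [set i | _] = A) //; apply/setP => i; rewrite inE ffunE.
by apply/setP => i; rewrite inE ffunE.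
Qed.

Lemma slice_card k : #|[set v : signvec n | ones v == k]| = 'C(n, k).
Proof. by rewrite (slice_card_gen (fun A => #|A| == k)) card_draws card_ord. Qed.

Lemma setS_card : #|setS n s| = 'C(n.+1, k0.+1).
Proof.
rewrite binS -!slice_card addnC -cardsUI.
rewrite [X in (_ + X)%N](_ : _ = 0%N) ?addn0; last first.
  apply/eqP; rewrite cards_eq0; apply/eqP/setP => v; rewrite !inE.
  by case: eqP => // ->; rewrite eqn_leq ltnn andbF.
by apply: eq_card => v; rewrite in_setS !inE.
Qed.

Lemma wB_ones (x : signvec n) : wB R s x = p ^+ ones x * (1 - p) ^+ (n - ones x) :> R.
Proof.
rewrite wBE /bw (bigID (fun i => x i)) /=; congr (_ * _).
  rewrite (eq_bigr (fun=> p)); last by move=> i ->.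
  by rewrite prodr_const /ones cardsE.
rewrite (eq_bigr (fun=> 1 - p)); last by move=> i /negbTE ->.
rewrite prodr_const; congr (_ ^+ _).
rewrite -[n in (n - _)%N]card_ord -(cardsC [set i | x i]) /ones addKn.
by apply: eq_card => i; rewrite !inE.
Qed.

Let B k : R := 'C(n, k)%:R * (p ^+ k * (1 - p) ^+ (n - k)).

Let B_ge0 k : 0 <= B k.
Proof.
move: p01 => /andP [? ?].
by rewrite mulr_ge0 ?ler0n // mulr_ge0 ?exprn_ge0 // subr_ge0.
Qed.

Lemma binom_ratio k : (k < n)%N -> B k.+1 * (k.+1%:R * (1 - p)) = B k * ((n - k)%:R * p).
Proof.
move=> kn; rewrite /B.
have E : (n - k = (n - k.+1).+1)%N by rewrite -subSn.
have h : 'C(n, k.+1)%:R * k.+1%:R = 'C(n, k)%:R * (n - k.+1).+1%:R :> R.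
  by rewrite -E -!natrM mulnC mul_bin_left mulnC.
rewrite E; move: (n - k.+1)%N h => d h.
rewrite !exprS.
transitivity (('C(n, k.+1)%:R * k.+1%:R) * (p * p ^+ k * ((1 - p) ^+ d * (1 - p)))); first by ring.
by rewrite h; ring.
Qed.

(** The ratio [B (k+1) / B k = (n-k) p / ((k+1) (1-p))] is at least [1] while [k + 1 <= k0] and at
    most [1] from [k = k0 + 1] on, because [p n = k0 + 1/2]. *)
Lemma binom_unimodal k : (k <= n)%N -> B k <= Num.max (B k0) (B k0.+1).
Proof.
move: p01 => /andP [p0 p1] kn; rewrite le_max; case: (leqP k k0) => kk0; apply/orP; [left|right].
  have down d : (d <= k0)%N -> B (k0 - d) <= B k0.
    elim: d => [|d IH] dk; first by rewrite subn0.
    apply: le_trans (IH (ltnW dk)).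
    set k' := (k0 - d.+1)%N; have -> : (k0 - d = k'.+1)%N by rewrite /k'; lia.
    have k'n : (k' < n)%N by rewrite /k'; have := k0n; lia.
    have pos : 0 < (n - k')%:R * p.
      by rewrite mulr_gt0 ?ltr0n ?subn_gt0 // (lt_le_trans beta0).
    rewrite -(ler_pM2r pos) -binom_ratio //; apply: ler_wpM2l => //.
    rewrite natrB; last exact: ltnW.
    have : k'.+1%:R <= k0%:R :> R by rewrite ler_nat /k'; lia.
    rewrite -natr1 mulrBl [n%:R * p]mulrC np.
    nra.
  by have := down (k0 - k)%N (leq_subr _ _); rewrite subKn.
have up d : (k0.+1 + d <= n)%N -> B (k0.+1 + d) <= B k0.+1.
  elim: d => [|d IH] dk; first by rewrite addn0.
  have dk' : (k0.+1 + d < n)%N by rewrite -addnS.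
  apply: le_trans (IH (ltnW dk')); rewrite addnS.
  set k' := (k0.+1 + d)%N in dk' *.
  have pos : 0 < k'.+1%:R * (1 - p) by rewrite mulr_gt0 ?ltr0n // (lt_le_trans beta0).
  rewrite -(ler_pM2r pos) binom_ratio //; apply: ler_wpM2l => //.
  rewrite natrB; last exact: ltnW.
  have : k0.+1%:R <= k'%:R :> R by rewrite ler_nat /k'; lia.
  rewrite -!natr1 mulrBl [n%:R * p]mulrC np.
  nra.
by have := up (k - k0.+1)%N; rewrite subnKC //; apply.
Qed.

Lemma ev_variance k (x : R) :
  ev p (nseq k (1 : R)) (fun y => (y - x) ^+ 2) = k%:R * (p * (1 - p)) + (k%:R * p - x) ^+ 2.
Proof.
elim: k x => [|k IH] x; first by rewrite /= !mul0r !add0r.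
rewrite [ev _ _ _]/= IH (@eq_ev _ _ _ _ _ (fun y => (y - (x - 1)) ^+ 2)).
  by rewrite IH -natr1; ring.
by move=> y; congr (_ ^+ 2); ring.
Qed.

Lemma ones_variance :
  \sum_(x : signvec n) wB R s x * ((ones x)%:R - p * n%:R) ^+ 2 = n%:R * (p * (1 - p)).
Proof.
transitivity (ev p (nseq n (1 : R)) (fun y => (y - p * n%:R) ^+ 2)); last first.
  by rewrite ev_variance [n%:R * p]mulrC subrr expr0n addr0.
have -> : nseq n (1 : R) = [seq 1 | i <- enum 'I_n].
  rewrite -[n in LHS](size_enum_ord n); elim: (enum 'I_n) => //= a t IH.
  by rewrite IH.
rewrite -(ev_pexp p _ _ (enum_uniq _)) wBE; apply: eq_bigr => x _.
congr (_ * (_ - _) ^+ 2); rewrite big_enum -big_mkcond /= /ones cardsE -sum1_card natr_sum.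
exact: eq_bigr.
Qed.

Lemma sum_ones (g : nat -> R) :
  \sum_(x : signvec n) wB R s x * g (ones x) = \sum_(k < n.+1) B k * g k.
Proof.
have on (x : signvec n) : (ones x < n.+1)%N.
  by rewrite ltnS -[leqRHS]card_ord /ones; exact: max_card.
rewrite (partition_big (fun x => Ordinal (on x)) predT) //=.
apply: eq_bigr => k _; rewrite (eq_bigr (fun=> p ^+ k * (1 - p) ^+ (n - k) * g k)).
  rewrite sumr_const (_ : #|_| = 'C(n, k)).
    by rewrite -[_ *+ _]mulr_natl /B mulrA.
  by rewrite -slice_card; apply: eq_card => x; rewrite [RHS]inE unfold_in.
by move=> x /eqP/(congr1 val) /= <-; rewrite wB_ones.
Qed.

(* Chebyshev's inequality; the mean [p n = k0 + 1/2] lies between the two slices,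
   which therefore contain the mode. *)
Lemma mode_bound : 3 / 4 <= (2 * m + 1)%:R * Num.max (B k0) (B k0.+1).
Proof.
set Mx := Num.max _ _.
have Mx0 : 0 <= Mx by rewrite /Mx le_max B_ge0.
have m0 : 0 < m%:R :> R.
  by rewrite ltr0n; case: (posnP m) m2 => // ->; rewrite leqNgt n0.
pose nearb (k : nat) := (k0 <= k + m)%N && (k <= k0 + m)%N.
(* A value that is not near deviates from the mean by at least [m], so [g >= 1]. Its expectation is
   the probability of [nearb] plus [n p (1-p) / m^2 <= 1/4]. *)
pose g (k : nat) : R := (nearb k)%:R + (k%:R - p * n%:R) ^+ 2 / m%:R ^+ 2.
have g1 k : 1 <= g k.
  rewrite /g; case: (boolP (nearb k)) => nk; first by rewrite lerDl divr_ge0 ?sqr_ge0.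
  rewrite add0r ler_pdivlMr ?exprn_gt0 // mul1r np.
  have : (m%:R <= k0%:R + 2^-1 - k%:R :> R) \/ (m%:R <= k%:R - (k0%:R + 2^-1) :> R).
    move: nk; rewrite /nearb negb_and -!ltnNge => /orP [h|h]; [left|right].
      have : (k + m)%:R <= k0%:R :> R by rewrite ler_nat ltnW.
      by rewrite natrD; lra.
    have : (k0 + m).+1%:R <= k%:R :> R by rewrite ler_nat.
    by rewrite -natr1 natrD; lra.
  by case=> h; nra.
have : 1 <= \sum_(x : signvec n) wB R s x * g (ones x).
  rewrite -wB_sum; apply: ler_sum => x _.
  by rewrite -[leLHS]mulr1; apply: ler_wpM2l; rewrite ?wB_ge0.
have -> : \sum_(x : signvec n) wB R s x * g (ones x) =
   \sum_(x : signvec n) wB R s x * (nearb (ones x))%:R + n%:R * (p * (1 - p)) / m%:R ^+ 2.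
  rewrite -ones_variance mulr_suml -big_split; apply: eq_bigr => x _ /=.
  by rewrite /g mulrDr mulrA.
have v4 : n%:R * (p * (1 - p)) / m%:R ^+ 2 <= 1 / 4.
  rewrite ler_pdivrMr ?exprn_gt0 //.
  have : n%:R <= m%:R ^+ 2 :> R by rewrite expr2 -natrM ler_nat.
  have : p * (1 - p) <= 1 / 4 by have := sqr_ge0 (p - 1 / 2); rewrite expr2; nra.
  have : 0 <= n%:R :> R by [].
  have : 0 <= p * (1 - p) by move: p01 => /andP [? ?]; rewrite mulr_ge0 // subr_ge0.
  nra.
rewrite (sum_ones (fun k => (nearb k)%:R)).
have : \sum_(k < n.+1) B k * (nearb k)%:R <= (2 * m + 1)%:R * Mx.
  apply: le_trans (_ : \sum_(k < n.+1) Mx * (nearb k)%:R <= _).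
    by apply: ler_sum => k _; apply: ler_wpM2r => //; apply: binom_unimodal; rewrite -ltnS.
  rewrite -mulr_sumr mulrC; apply: ler_wpM2r => //; rewrite -natr_sum ler_nat.
  pose f (k : 'I_n.+1) : 'I_(2 * m).+1 := inord (k + m - k0).
  have finj : {in [set k : 'I_n.+1 | nearb k] &, injective f}.
    move=> j k; rewrite !inE /nearb => /andP [j1 j2] /andP [h1 h2] /(congr1 (@nat_of_ord _)).
    rewrite /f !inordK; [|by move: j1 j2 h1 h2; clear; lia..].
    by move=> e; apply/val_inj; move: e j1 j2 h1 h2; clear; rewrite /=; lia.
  have mc : (#|f @: [set k : 'I_n.+1 | nearb k]| <= (2 * m).+1)%N.
    by rewrite -[leqRHS]card_ord max_card.
  rewrite addn1; apply: leq_trans mc.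
  rewrite card_in_imset // -sum1_card [X in (_ <= X)%N]big_mkcond /=.
  by apply: leq_sum => k _; rewrite inE; case: (nearb k).
lra.
Qed.

Let L0 : R := 2 * (2 * m + 1)%:R / beta.

Let L0_ge0 : 0 <= L0.
Proof. by rewrite /L0 divr_ge0 ?mulr_ge0 // ltW. Qed.

(** Up to factors [p] and [1 - p], both at least [beta], the Bernoulli weights on the slices all
    equal one number [c]. The size of [S] times [c] dominates the mode, which [mode_bound] bounds
    below by a constant over [m]. *)
Lemma wS_le (x : signvec n) : wS R s x <= L0 * wB R s x.
Proof.
rewrite /wS; case: ifP => xS; last first.
  by rewrite mulr_ge0 ?wB_ge0.
have S0 : 0 < #|setS n s|%:R :> R by rewrite ltr0n; apply/card_gt0P; exists x.
rewrite -[leLHS]mul1r ler_pdivrMr //.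
suff h : beta * Num.max (B k0) (B k0.+1) <= wB R s x * #|setS n s|%:R.
  rewrite -mulrA; apply: le_trans (_ : L0 * (beta * Num.max (B k0) (B k0.+1)) <= _); last first.
    exact: ler_wpM2l.
  rewrite /L0 mulrA divfK ?gt_eqF // -mulrA.
  by have := mode_bound; lra.
move: p01 => /andP [p0 p1].
have nk : (n - k0 = (n - k0.+1).+1)%N by rewrite -subSn.
set d := (n - k0.+1)%N in nk.
pose c := p ^+ k0 * (1 - p) ^+ d.
have c0 : 0 <= c by rewrite mulr_ge0 ?exprn_ge0 // subr_ge0.
have B0E : B k0 = 'C(n, k0)%:R * (c * (1 - p)) by rewrite /B nk exprS /c; ring.
have B1E : B k0.+1 = 'C(n, k0.+1)%:R * (c * p) by rewrite /B exprS /c; ring.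
have wc : beta * c <= wB R s x.
  move: xS; rewrite in_setS wB_ones => /orP [/eqP ->|/eqP ->].
    by rewrite nk exprS [X in _ <= X]mulrCA -/c ler_wpM2r.
  by rewrite exprS -[X in _ <= X]mulrA -/c ler_wpM2r.
rewrite setS_card binS natrD addrC.
have C0 : 0 <= 'C(n, k0)%:R :> R by []. have C1 : 0 <= 'C(n, k0.+1)%:R :> R by [].
apply: le_trans (_ : beta * c * ('C(n, k0)%:R + 'C(n, k0.+1)%:R) <= _); last first.
  by apply: ler_wpM2r => //; rewrite addr_ge0.
rewrite -mulrA; apply: ler_wpM2l; first exact: ltW.
rewrite mulrDr ge_max B0E B1E; apply/andP; split.
  apply: le_trans (_ : c * 'C(n, k0)%:R <= _); last by rewrite lerDl mulr_ge0.
  by rewrite mulrC ler_wpM2r // -[leRHS]mulr1 ler_wpM2l // lerBlDr lerDl.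
apply: le_trans (_ : c * 'C(n, k0.+1)%:R <= _); last by rewrite lerDr mulr_ge0.
by rewrite mulrC ler_wpM2r // -[leRHS]mulr1 ler_wpM2l.
Qed.

Lemma setS_gt0 : (0 < #|setS n s|)%N.
Proof. by rewrite setS_card bin_gt0 ltnS (ltnW k0n). Qed.

Lemma wS_ge0 (x : signvec n) : 0 <= wS R s x.
Proof. by rewrite /wS; case: ifP => // _; rewrite invr_ge0. Qed.

Lemma wexp_wS (F : signvec n -> R) : wexp (wS R s) F = (\sum_(x in setS n s) F x) / #|setS n s|%:R.
Proof.
rewrite /wexp mulr_suml [RHS]big_mkcond; apply: eq_bigr => x _.
by rewrite /wS; case: ifP => _; rewrite ?mul0r // mulrC.
Qed.

Lemma wS_sum : \sum_(x : signvec n) wS R s x = 1.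
Proof.
transitivity (wexp (wS R s) (fun _ : signvec n => 1)); first by apply: eq_bigr => x _; rewrite mulr1.
by rewrite wexp_wS sumr_const mulfV // pnatr_eq0 -lt0n setS_gt0.
Qed.

(** On each slice the third coordinate of the lattice sum is constant, so the event becomes a window
    event for the Bernoulli measure on the whole cube; [2] counts the slices and [L0] is the loss in
    [wS_le]. *)
Lemma wS_window N W u (rr : R) c1 c2 : (1 < N)%N ->
  (forall t, conc p (window N W) (latseq N 1 u) t <= rr) ->
  wexp (wS R s) (fun x : signvec n => (inwin W x u c1 c2)%:R) <= (2 * L0) * rr.
Proof.
move=> N1 h.
pose hit k (x : signvec n) : bool :=
  \sum_(i <- enum 'I_n) (if x i then lat N 1 (u i) else 0) - (c1%:~R, c2%:~R, k%:R) \in window N W.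
apply: le_trans (_ : L0 * (wexp (wB R s) (fun x => (hit k0 x)%:R) + wexp (wB R s) (fun x => (hit k0.+1 x)%:R)) <= _).
  rewrite -big_split mulr_sumr; apply: ler_sum => x _ /=.
  rewrite -mulrDr mulrA.
  case: (boolP (x \in setS n s)) => xS; last first.
    by rewrite /wS (negbTE xS) mul0r mulr_ge0 ?addr_ge0 ?ler0n // mulr_ge0 ?wB_ge0.
  apply: ler_pM; rewrite ?wS_ge0 ?wS_le //.
  case: (boolP (inwin _ _ _ _ _)) => [iw|_]; last by rewrite addr_ge0.
  have := inwin_lat 1 N1 iw; rewrite mul1n.
  move: xS; rewrite in_setS => /orP [/eqP ->|/eqP ->]; rewrite -/(hit _ x) => ->.
    by rewrite lerDl.
  by rewrite lerDr.
rewrite (_ : 2 * L0 * rr = L0 * (rr + rr)); last by ring.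
apply: ler_wpM2l => //.
by apply: lerD; apply: wB_lat.
Qed.

Lemma ones_upd (x : signvec n) l : ~~ x l -> ones (upd x l true) = (ones x).+1.
Proof.
move=> xl; rewrite /ones (_ : [set i | _] = l |: [set i | x i]).
  by rewrite cardsU1 inE xl.
by apply/setP => i; rewrite !inE ffunE; case: eqP.
Qed.

(* Flipping coordinate [l] matches the vectors of [S] with [ones x = k0], [x l]
   false, with those with [ones x = k0.+1], [x l] true; at most one vector of
   each pair is in the event. *)
Lemma wS_nondeg r (z1 z2 : R) i (a b : 'I_n -> R) (rh : R) l :
  (rh < `|a l|) || (rh < `|b l|) ->
  wexp (wS R s) (fun x : signvec n => (small r z1 z2 x i a b rh)%:R) <= 1 - beta ^+ 2 / 2.
Proof.
move=> big.
pose A := [set x : signvec n | (ones x == k0) && ~~ x l].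
pose Sm := [set x in setS n s | small r z1 z2 x i a b rh].
(* [g] picks from each pair a vector outside the event, so at least [#|A|] vectors of [S] avoid
   it. *)
pose g (x : signvec n) := if small r z1 z2 x i a b rh then upd x l true else x.
have updF (x : signvec n) : ~~ x l -> upd x l false = x.
  by move=> xl; apply/ffunP => j; rewrite ffunE; case: eqP => // ->; rewrite (negbTE xl).
have cA : #|A| = 'C(n.-1, k0).
  rewrite /A (_ : [set x | _] = [set v : signvec n | (fun A => (#|A| == k0) && (l \notin A)) [set i | v i]]).
    rewrite (slice_card_gen (fun A => (#|A| == k0) && (l \notin A))).
    rewrite -[n in n.-1]card_ord -(cardsC1 l) -cards_draws; apply: eq_card => C.
    by rewrite !inE andbC finset.subsetC finset.sub1set inE.
  by apply/setP => v; rewrite !inE.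
have cS : (#|Sm| + #|A| <= #|setS n s|)%N.
  have ginj : {in A &, injective g}.
    move=> x y; rewrite !inE => /andP [_ xl] /andP [_ yl]; rewrite /g.
    case: ifP => _; case: ifP => _ // E.
    - by rewrite -(updF x xl) -(updF y yl); apply/ffunP => j; have := congr1 (fun f : signvec n => f j) E;
        rewrite !ffunE; case: eqP.
    - by move: yl; rewrite -E ffunE eqxx.
    - by move: xl; rewrite E ffunE eqxx.
  rewrite -(card_in_imset ginj) -cardsUI.
  rewrite [X in (_ + X)%N](_ : _ = 0%N) ?addn0; last first.
    apply/eqP; rewrite cards_eq0; apply/eqP/setP => y; rewrite !inE.
    apply/negP => /andP [/andP [_ ysm] /imsetP [x]]; rewrite !inE /g => /andP [_ xl].
    case: ifP => xsm E; last by rewrite -E ysm in xsm.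
    rewrite -(updF x xl) in xsm; rewrite E in ysm.
    exact: (@small_flip r z1 z2 i a b rh l x big).
  apply: subset_leq_card; apply/fintype.subsetP => y; rewrite finset.in_setU => /orP [|/imsetP [x]].
    by rewrite inE => /andP [].
  rewrite inE => /andP [/eqP xk xl] ->; rewrite /g in_setS; case: ifP => _.
    by rewrite ones_upd // xk eqxx orbT.
  by rewrite xk eqxx.
have S0 : 0 < #|setS n s|%:R :> R by rewrite ltr0n setS_gt0.
rewrite wexp_wS ler_pdivrMr // (_ : \sum_(x in setS n s) _ = #|Sm|%:R); last first.
  rewrite -sum1_card natr_sum big_mkcond [RHS]big_mkcond; apply: eq_bigr => x _ /=.
  have -> : (x \in Sm) = (x \in setS n s) && small r z1 z2 x i a b rh by rewrite inE.
  by case: (x \in setS n s) => //=; case: (small _ _ _ _ _ _ _ _).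
have : #|Sm|%:R + #|A|%:R <= #|setS n s|%:R :> R by rewrite -natrD ler_nat.
(* ['C(n-1, k0) / 'C(n, k0) = (n - k0) / n >= beta] and ['C(n, k0) / 'C(n+1, k0+1) = (k0+1) / (n+1)
   >= beta / 2]. *)
suff : beta ^+ 2 / 2 * #|setS n s|%:R <= #|A|%:R by rewrite mulrBl mul1r; lra.
rewrite cA setS_card.
have h1 : k0.+1%:R * 'C(n.+1, k0.+1)%:R = n.+1%:R * 'C(n, k0)%:R :> R.
  by rewrite -!natrM -mul_bin_diag.
have h2 : (n - k0)%:R * 'C(n, k0)%:R = n%:R * 'C(n.-1, k0)%:R :> R.
  by rewrite -!natrM mul_bin_down.
have kp1 : p * n%:R <= k0.+1%:R by rewrite np -[k0.+1%:R]natr1; lra.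
have kp2 : (1 - p) * n%:R <= (n - k0)%:R.
  by rewrite natrB ?(ltnW k0n) // mulrBl mul1r np; lra.
have nn : n.+1%:R <= 2 * n%:R :> R by rewrite -natrM ler_nat mul2n -addnn -addn1 leq_add2l.
have n0R : 0 < n%:R :> R by rewrite ltr0n.
set X := 'C(n.+1, k0.+1)%:R in h1 *; set Y := 'C(n, k0)%:R in h1 h2.
set Z := 'C(n.-1, k0)%:R in h2 *.
have X0 : 0 <= X by []. have Y0 : 0 <= Y by []. have Z0 : 0 <= Z by [].
have k1 : beta * n%:R <= k0.+1%:R by apply: le_trans kp1; rewrite ler_pM2r.
have k2 : beta * n%:R <= (n - k0)%:R by apply: le_trans kp2; rewrite ler_pM2r.
have e1 : beta * X <= 2 * Y.
  rewrite -(ler_pM2r n0R).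
  apply: le_trans (_ : k0.+1%:R * X <= _); first by rewrite mulrAC ler_wpM2r.
  by rewrite h1 mulrAC ler_wpM2r.
have e2 : beta * Y <= Z.
  rewrite -(ler_pM2r n0R).
  apply: le_trans (_ : (n - k0)%:R * Y <= _); first by rewrite mulrAC ler_wpM2r.
  by rewrite h2 mulrC.
have e3 : beta * (beta * X) <= beta * (2 * Y) by apply: ler_wpM2l => //; exact: ltW.
apply: le_trans e2; rewrite (_ : _ * X = beta * (beta * X) / 2); last by field.
by rewrite ler_pdivrMr // -[leRHS]mulrA [Y * 2]mulrC.
Qed.

End Slices.
End Models.

(** * Choice of parameters *)

(** With [u = t / 2a], [t <= 2a 2^u] gives [t^a <= (2a)^a 2^(t/2)], and for [t >= 2 (2a)^a] the
    first factor is at most [2^(t/2)]. *)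
Lemma pow_le_exp2 (a : nat) : exists t0, forall t, (t0 <= t)%N -> (t ^ a <= 2 ^ t)%N.
Proof.
case: a => [|a']; first by exists 0%N => t _; rewrite expn0 expn_gt0.
set a := a'.+1; exists (2 * (2 * a) ^ a)%N => t ht.
set u := (t %/ (2 * a))%N.
have tu : (t <= 2 * a * 2 ^ u)%N.
  apply: ltnW; apply: leq_trans (ltn_ceil t (_ : 0 < 2 * a)%N) _ => //.
  by rewrite mulnC leq_mul2l ltn_expl // orbT.
apply: leq_trans (_ : (2 * a * 2 ^ u) ^ a <= _)%N; first by rewrite leq_exp2r.
rewrite expnMn -expnM.
have h1 : ((2 * a) ^ a <= 2 ^ ((2 * a) ^ a))%N by apply: ltnW; apply: ltn_expl.
apply: leq_trans (_ : 2 ^ ((2 * a) ^ a) * 2 ^ (u * a) <= _)%N; first by rewrite leq_mul2r h1 orbT.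
rewrite -expnD leq_exp2l // -(leq_pmul2l (_ : 0 < 2)%N) // mulnDr.
have h2 : (2 * (u * a) <= t)%N.
  by rewrite mulnCA mulnC [(_ * u)%N]mulnC leq_divM.
by rewrite [(2 * t)%N]mul2n -addnn leq_add.
Qed.

(** Induction gives [(1 - x)^m (1 + m x) <= 1], and the second factor is at least [2]. *)
Lemma one_minus_pow_half (R : realFieldType) (x : R) (m : nat) :
  0 <= x <= 1 -> 1 <= m%:R * x -> (1 - x) ^+ m <= 1 / 2.
Proof.
move=> /andP [x0 x1] mx.
have h : (1 - x) ^+ m * (1 + m%:R * x) <= 1.
  elim: m {mx} => [|m IH]; first by rewrite expr0 mul0r addr0 mulr1.
  have p0 : 0 <= (1 - x) ^+ m by rewrite exprn_ge0 // subr_ge0.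
  apply: le_trans IH; rewrite exprSr -mulrA; apply: ler_wpM2l => //.
  by rewrite -natr1; have : 0 <= m%:R :> R by []; nra.
have p0 : 0 <= (1 - x) ^+ m by rewrite exprn_ge0 // subr_ge0.
nra.
Qed.

Definition model (R : realType) (n : nat) (r : signvec n) (z1 z2 : R)
    (w : signvec n -> R) (p : R) (kp : nat) (L theta : R) : Prop :=
  [/\ forall x, 0 <= w x, \sum_x w x = 1,
      forall N W u (rr : R) c1 c2, (1 < N)%N ->
        (forall t, conc p (window N W) (latseq N kp u) t <= rr) ->
        wexp w (fun x => (inwin W x u c1 c2)%:R) <= L * rr &
      forall i (a b : 'I_n -> R) (rh : R) l, (rh < `|a l|) || (rh < `|b l|) ->
        wexp w (fun x => (small r z1 z2 x i a b rh)%:R) <= 1 - theta].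

Lemma mul_pow_le (t a i : nat) : (a <= t)%N -> (a * t ^ i <= t ^ i.+1)%N.
Proof. by move=> ?; rewrite expnS leq_mul2r; apply/orP; right. Qed.

(* [t] is the integer part of [n^(1/30)]. *)
Section Core.
Variables (R : realType) (beta : R) (z : R[i]) (e : nat).
Hypothesis beta0 : 0 < beta.

(** [t^D] is the ratio of consecutive scales; there are [Q] scales, enough for [t^Q >= L t^e]; [t^b]
    bounds the choices for one entry of a code; [t^-c] is the distance threshold. *)
Let D := (4 * e + 102)%N.
Let Q := (e + 16)%N.
Let b := (31 + 2 * (36 + Q * D) + 1)%N.
Let c := (34 + Q * D + 33)%N.

Section Fixed.
Variables (t n : nat).
Hypothesis t8 : (8 <= t)%N.
Hypothesis tz : 2 + `|complex.Re z| + `|complex.Im z| <= t%:R.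
Hypothesis t30 : (2 ^ 30 <= t)%N.
Hypothesis tQ : (Q <= t)%N.
Hypothesis tbeta : 32 <= beta ^+ 2 * t%:R.
Hypothesis texp : (t ^ (e + 18) <= 2 ^ t)%N.
Hypothesis tc : (e + 3 * b + 22 <= t)%N.
Hypothesis nlo : (t ^ 30 <= n)%N.
Hypothesis nhi : (n < t.+1 ^ 30)%N.

(** With [eta = t^-e], the choice [J = t^12] makes [J^2] beat [L t <= t^17]; [K = t^26] beats
    [J^2 t] in the greedy decay and stays far below [n >= t^30]. *)
Let M := (t ^ (2 * e + 34))%N.
Let A := (t ^ 32)%N.
Let W (j : nat) := (t ^ (33 + j * D))%N.
Let T := (t ^ (34 + Q * D))%N.
Let J := (t ^ 12)%N.
Let K := (t ^ 26)%N.
Let F j := ((2 * M + 1) * ((M + 1) * W j))%N.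
Let eta : R := (t%:R ^+ e)^-1.

Let t0 : (0 < t)%N. Proof. exact: leq_trans t8. Qed.
Let tR0 : 0 < t%:R :> R. Proof. by rewrite ltr0n. Qed.
Let tR1 : 1 <= t%:R :> R. Proof. by rewrite ler1n. Qed.
Let tR8 : 8 <= t%:R :> R. Proof. by rewrite ler_nat. Qed.

Lemma n_le_pow : (n <= t ^ 31)%N.
Proof.
apply: ltnW; apply: leq_trans nhi _.
apply: leq_trans (_ : (2 * t) ^ 30 <= _)%N.
  by rewrite leq_exp2r // mul2n -addnn -addn1 leq_add2l.
by rewrite expnMn; apply: mul_pow_le.
Qed.

Let W0 j : (0 < W j)%N. Proof. by rewrite expn_gt0 t0. Qed.
Let F0 j : (0 < F j)%N. Proof. rewrite muln_gt0 addn_gt0 orbT /= muln_gt0 addn_gt0 orbT /=; exact: W0. Qed.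

Lemma F_le j : (F j <= t ^ (4 * e + 69) * W j)%N.
Proof.
have M0 : (0 < M)%N by rewrite expn_gt0 t0.
have -> : (t ^ (4 * e + 69) = t * (M * M))%N.
  by rewrite /M -expnD -expnS; congr (_ ^ _)%N; clear; lia.
rewrite /F mulnA leq_mul2r; apply/orP; right.
apply: leq_trans (_ : 3 * M * (2 * M) <= _)%N.
  by apply: leq_mul; move: M0; clear; lia.
have -> : (3 * M * (2 * M) = 6 * (M * M))%N by clear; lia.
by rewrite leq_mul2r; apply/orP; right; apply: leq_trans t8.
Qed.

Lemma F_step j : (5 * (A * F j) <= W j.+1)%N.
Proof.
apply: leq_trans (_ : 5 * (A * (t ^ (4 * e + 69) * W j)) <= _)%N.
  by rewrite leq_mul2l leq_mul2l F_le orbT.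
have -> : (A * (t ^ (4 * e + 69) * W j) = t ^ (33 + j * D + 4 * e + 101))%N.
  by rewrite /A /W -!expnD; congr (_ ^ _)%N; clear; lia.
have -> : (W j.+1 = t ^ (33 + j * D + 4 * e + 101).+1)%N.
  by rewrite /W mulSn; congr (_ ^ _)%N; rewrite {1}/D; clear; lia.
by apply: mul_pow_le; apply: leq_trans t8.
Qed.

Let nA : (n <= A)%N.
Proof. by apply: leq_trans n_le_pow _; rewrite leq_exp2l //; apply: leq_trans t8. Qed.

Lemma W_step j : (A * (F j + 1) + 1 + 2 * n * F j <= W j.+1)%N.
Proof.
apply: leq_trans (F_step j).
have A0 : (0 < A)%N by rewrite expn_gt0 t0.
have f0 := F0 j.
have h1 : (n * F j <= A * F j)%N by rewrite leq_mul2r nA orbT.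
have h2 : (A <= A * F j)%N by rewrite leq_pmulr.
have h3 : (1 <= A * F j)%N by rewrite muln_gt0 A0.
rewrite mulnDr muln1 -mulnA.
move: (A * F j)%N (n * F j)%N h1 h2 h3 => u v; clear; lia.
Qed.

Lemma W_mono i j : (i <= j)%N -> (W i <= W j)%N.
Proof.
move=> ij; rewrite leq_exp2l; last exact: leq_trans t8.
by rewrite leq_add2l leq_mul2r ij orbT.
Qed.

Lemma T_large j : (j < Q)%N -> (A * (F j + 1) + F j + 1 < T)%N.
Proof.
move=> jQ; apply: leq_ltn_trans (_ : W Q < T)%N; last by rewrite ltn_exp2l //; apply: leq_trans t8.
apply: leq_trans (W_mono jQ); apply: leq_trans (F_step j).
have A0 : (0 < A)%N by rewrite expn_gt0 t0.
have f0 := F0 j.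
have h1 : (F j <= A * F j)%N by rewrite leq_pmull.
have h2 : (A <= A * F j)%N by rewrite leq_pmulr.
have h3 : (1 <= A * F j)%N by rewrite muln_gt0 A0.
rewrite mulnDr muln1.
move: (A * F j)%N h1 h2 h3 => u; clear; lia.
Qed.

Lemma rows_le : 2 * n%:R + `|complex.Re z * Num.sqrt n%:R| + `|complex.Im z * Num.sqrt n%:R| <= A%:R :> R.
Proof.
have n1 : 1 <= n%:R :> R.
  by rewrite ler1n; apply: leq_trans nlo; rewrite expn_gt0 t0.
have sn : Num.sqrt n%:R <= n%:R :> R.
  rewrite -[leRHS]ger0_norm // -sqrtr_sqr; apply: ler_wsqrtr.
  by rewrite expr2 ler_peMl.
have s0 : 0 <= Num.sqrt n%:R :> R by exact: sqrtr_ge0.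
rewrite !normrM [`|Num.sqrt _|]ger0_norm //.
apply: le_trans (_ : (2 + `|complex.Re z| + `|complex.Im z|) * n%:R <= _).
  rewrite !mulrDl; apply: lerD; first apply: lerD => //.
    by apply: ler_wpM2l.
  by apply: ler_wpM2l.
apply: le_trans (_ : t%:R * (t ^ 31)%N%:R <= _); last by rewrite -natrM -expnS.
apply: ler_pM => //; first by rewrite !addr_ge0.
by rewrite ler_nat n_le_pow.
Qed.

Lemma half_pow_small : (1 / 2 : R) ^+ t <= (t%:R ^+ (e + 18))^-1.
Proof.
rewrite expr_div_n expr1n div1r lef_pV2 ?posrE ?exprn_gt0 //.
by rewrite -!natrX ler_nat.
Qed.

Section OneModel.
Variables (r : signvec n) (w : signvec n -> R) (p L : R) (kp J1 : nat).
Let theta : R := beta ^+ 2 / 2.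
Let z1 : R := complex.Re z * Num.sqrt n%:R.
Let z2 : R := complex.Im z * Num.sqrt n%:R.
Hypothesis bp : beta <= p.
Hypothesis b1p : beta <= 1 - p.
Hypothesis L1 : 1 <= L.
Hypothesis L16 : L <= t%:R ^+ 16.
Hypothesis kpJ : (J1 = 1%N /\ L = 1) \/ (J1 = J /\ kp = 1%N).
Hypothesis wm : model r z1 z2 w p kp L theta.

Let N := (8 * (J + 1) * T + W Q + kp * (2 * J) + 2)%N.
Let G : R := 2 / (J1 * J)%:R.
Let eta1 : R := eta / (4 * L).

Let L0 : 0 < L. Proof. exact: lt_le_trans L1. Qed.
Let eta0 : 0 < eta. Proof. by rewrite invr_gt0 exprn_gt0. Qed.
Let eta10 : 0 < eta1. Proof. by rewrite divr_gt0 // mulr_gt0. Qed.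
Let beta1 : beta <= 1 / 2. Proof. by move: bp b1p; lra. Qed.
Let theta01 : 0 <= theta <= 1.
Proof. by rewrite /theta; move: beta0 beta1 => h1 h2; apply/andP; split; nra. Qed.
Let J0 : (0 < J)%N. Proof. by rewrite expn_gt0 t0. Qed.
Let J1J : (0 < J1 <= J)%N.
Proof. by case: kpJ => [[-> _]|[-> _]]; rewrite ?leqnn ?andbT J0. Qed.
Let JJ0 : 0 < (J1 * J)%:R :> R.
Proof. by rewrite ltr0n muln_gt0 J0 andbT; case/andP: J1J. Qed.
Let p01 : 0 <= p <= 1.
Proof. by move: bp b1p beta0 => h1 h2 h3; apply/andP; split; lra. Qed.

Lemma four_L_le (X : R) : 0 <= X -> 4 * L * X <= t%:R ^+ 17 * X.
Proof.
move=> X0; apply: ler_wpM2r => //; rewrite exprS; apply: ler_pM => //; first exact: ltW.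
by apply: le_trans tR8; rewrite ler_nat.
Qed.

(** For [L = 1] a single level gives [G] of order [t^-12]; for the slices [L t] may reach [t^17],
    which takes the [J^2 = t^24] gained from all levels. *)
Lemma gain_ok : 4 * L * t%:R * G <= theta / 2.
Proof.
rewrite /G mulrA ler_pdivrMr // /theta natrM.
have tb (i : nat) : 32 * t%:R ^+ i <= beta ^+ 2 * t%:R ^+ i.+1.
  by rewrite [t%:R ^+ i.+1]exprS mulrA; apply: ler_wpM2r; rewrite ?exprn_ge0.
have tm (i j : nat) : (i <= j)%N -> t%:R ^+ i <= t%:R ^+ j :> R by move=> ij; exact: ler_weXn2l.
have b2 : 0 <= beta ^+ 2 by exact: sqr_ge0.
rewrite /J natrX; case: kpJ => [[-> ->]|[-> _]].
  have h := tb 1%N; have h2 := ler_wpM2l b2 (tm 2%N 12%N isT).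
  by rewrite expr1 in h; lra.
have h := tb 17%N; have h2 := ler_wpM2l b2 (tm 18%N 24%N isT).
have h3 : L * t%:R <= t%:R ^+ 17 by rewrite exprSr; apply: ler_wpM2r.
have -> : (t ^ 12)%N%:R * t%:R ^+ 12 = t%:R ^+ 24 :> R by rewrite natrX -exprD.
lra.
Qed.

(** By [xlo], each block of [t^25] factors contributes at most [1/2]; the [t] blocks give [2^-t],
    below the required power of [1/t]. *)
Lemma K_ok : 4 * (1 - p * (1 - p) / (2 * J%:R) ^+ 2) ^+ K <= eta / L.
Proof.
set x := p * (1 - p) / _.
have JR : 0 < J%:R :> R by rewrite ltr0n.
have xlo : beta ^+ 2 / (4 * t%:R ^+ 24) <= x.
  have -> : 4 * t%:R ^+ 24 = (2 * J%:R) ^+ 2 :> R.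
    by rewrite /J natrX exprMn -exprM; congr (_ * _); ring.
  rewrite /x ler_pM2r ?invr_gt0 ?exprn_gt0 ?mulr_gt0 // expr2.
  by apply: ler_pM => //; exact: ltW.
have x01 : 0 <= x <= 1.
  apply/andP; split; first by apply: le_trans xlo; rewrite divr_ge0 ?sqr_ge0 // mulr_ge0 ?exprn_ge0.
  rewrite /x ler_pdivrMr ?exprn_gt0 ?mulr_gt0 // mul1r.
  have J1' : 1 <= J%:R :> R by rewrite ler1n.
  have pp : p * (1 - p) <= 1 by move: p01 (sqr_ge0 p) => /andP [_ h2]; rewrite mulrBr mulr1 expr2; lra.
  by apply: le_trans pp _; rewrite expr2; nra.
have x1 : 1 <= (t ^ 25)%N%:R * x.
  apply: le_trans (_ : (t ^ 25)%N%:R * (beta ^+ 2 / (4 * t%:R ^+ 24)) <= _); last by apply: ler_wpM2l.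
  have -> : (t ^ 25)%N%:R * (beta ^+ 2 / (4 * t%:R ^+ 24)) = beta ^+ 2 * t%:R / 4.
    by rewrite natrX (exprSr _ 24); field; rewrite gt_eqF.
  by move: tbeta; lra.
have := one_minus_pow_half x01 x1 => h.
have -> : K = (t ^ 25 * t)%N by rewrite /K expnSr.
rewrite exprM.
have h0 : 0 <= (1 - x) ^+ (t ^ 25) by rewrite exprn_ge0 // subr_ge0; case/andP: x01.
have h2 : ((1 - x) ^+ (t ^ 25)) ^+ t <= (t%:R ^+ (e + 18))^-1.
  by apply: le_trans half_pow_small; apply: lerXn2r; rewrite ?nnegrE ?divr_ge0.
rewrite ler_pdivlMr // mulrAC.
apply: le_trans (_ : t%:R ^+ 17 * (t%:R ^+ (e + 18))^-1 <= _).
  by apply: le_trans (four_L_le _) _; [rewrite exprn_ge0|apply: ler_wpM2l; rewrite ?exprn_ge0].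
rewrite /eta exprD invfM mulrCA -[leRHS]mulr1; apply: ler_wpM2l; first by rewrite invr_ge0 exprn_ge0.
rewrite ler_pdivrMr ?exprn_gt0 // mul1r; exact: ler_weXn2l.
Qed.

Lemma M_ok : (2 / eta1) ^+ 2 <= M%:R.
Proof.
have -> : M%:R = (t%:R ^+ (e + 17)) ^+ 2 :> R.
  by rewrite /M natrX -exprM; congr (_ ^+ _); clear; lia.
suff h : 2 / eta1 <= t%:R ^+ (e + 17).
  by apply: lerXn2r => //; rewrite nnegrE ?exprn_ge0 // divr_ge0 // ltW.
have -> : 2 / eta1 = 2 * (4 * L * t%:R ^+ e).
  by rewrite /eta1 /eta; field; rewrite expf_neq0 ?lt0r_neq0.
apply: le_trans (_ : t%:R ^+ 17 * t%:R ^+ e <= _); last by rewrite -exprD addnC.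
rewrite mulrA; apply: ler_wpM2r; first by rewrite exprn_ge0.
rewrite (_ : 2 * (4 * L) = 8 * L); last by ring.
by rewrite exprS; apply: ler_pM => //; exact: ltW.
Qed.

Lemma Q_ok : 1 <= t%:R ^+ Q * (eta / L).
Proof.
have -> : t%:R ^+ Q * (eta / L) = t%:R ^+ 16 / L.
  by rewrite /Q /eta exprD; field; rewrite expf_neq0 ?lt0r_neq0.
by rewrite ler_pdivlMr // mul1r.
Qed.

Let S0 := ((2 * T + 1) * (2 * T + 1))%N.

Let t1n : (1 < t)%N. Proof. exact: leq_trans t8. Qed.

Lemma S0_le : (S0 <= t ^ (2 * (35 + Q * D)))%N.
Proof.
have T0 : (0 < T)%N by rewrite expn_gt0 t0.
have h : (2 * T + 1 <= t ^ (35 + Q * D))%N.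
  apply: leq_trans (_ : 3 * T <= _)%N; first by move: T0; clear; lia.
  by apply: mul_pow_le; apply: leq_trans t8.
apply: leq_trans (leq_mul h h) _.
by rewrite -expnD addnn mul2n.
Qed.

(** A scale index below [Q <= t], and [3K] entries with at most [t^b] values each. *)
Lemma code_card : (#|{: code n K Q T}| <= t ^ (1 + 3 * b * K))%N.
Proof.
rewrite !card_prod !card_tuple !card_option !card_prod !card_ord -/S0.
have P0 (i : nat) : (0 < t ^ i)%N by rewrite expn_gt0 t0.
have h1 : (S0.+1 <= t ^ b)%N.
  apply: leq_trans (_ : 2 * t ^ (2 * (35 + Q * D)) <= _)%N.
    by have := S0_le; have := P0 (2 * (35 + Q * D))%N; clear; lia.
  apply: leq_trans (mul_pow_le _ (leq_trans _ t8)) _ => //.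
  by rewrite leq_exp2l // /b; clear; lia.
have h2 : ((n * S0).+1 <= t ^ b)%N.
  apply: leq_trans (_ : 2 * t ^ (31 + 2 * (35 + Q * D)) <= _)%N.
    have : (n * S0 <= t ^ (31 + 2 * (35 + Q * D)))%N.
      by rewrite expnD; apply: leq_mul; [exact: n_le_pow|exact: S0_le].
    by have := P0 (31 + 2 * (35 + Q * D))%N; clear; lia.
  apply: leq_trans (mul_pow_le _ (leq_trans _ t8)) _ => //.
  by rewrite leq_exp2l // /b; clear; lia.
rewrite expnD expn1 -mulnA; apply: leq_mul => //.
apply: leq_trans (_ : (t ^ b) ^ K * (t ^ b) ^ (2 * K) <= _)%N.
  by apply: leq_mul; rewrite leq_exp2r ?muln_gt0 ?expn_gt0 ?t0.
by rewrite -!expnM -expnD leq_exp2l //; clear; lia.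
Qed.

(** The codes and the at most [K] unpaired coordinates cost a power of [t] with exponent [O(K)],
    hence [2] to a power [O(t^27)], against [(1 - theta/2)^k <= 2^-(t^28)] from the rows. *)
Lemma bad_small (k : 'I_n) : (n - k <= K)%N ->
  pexp w (fun X : family n => `[< bad r z1 z2 w T eta k X >]%:R) <= eta.
Proof.
move=> nk; case: wm => w0 w1 ww wn.
have W_first : (A + 1 < W 0)%N.
  rewrite /W mul0n addn0 expnS; have : (0 < A)%N by rewrite expn_gt0 t0.
  have : (8 * A <= t * A)%N by rewrite leq_mul2r t8 orbT.
  rewrite -/A; clear; lia.
have N_large j : (j < Q)%N -> (8 * (J + 1) * T + W j + kp * (2 * J) < N)%N.
  move=> jQ; rewrite /N; have := W_mono (ltnW jQ); clear; lia.
have N1 : (1 < N)%N by rewrite /N; clear; lia.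
have kpJ' : J1 = 1%N \/ kp = 1%N by case: kpJ => [[? _]|[_ ?]]; [left|right].
have ww' u W' rr c1 c2 := ww N W' u rr c1 c2 N1.
apply: le_trans (bad_prob p01 J0 J1J kpJ' eta0 L1 tR1 theta01 rows_le W_first
  W_step T_large N_large N1 K_ok M_ok Q_ok gain_ok w0 w1 ww' wn k) _.
have x01 : 0 <= theta / 2 <= 1 by move: theta01 => /andP [? ?]; apply/andP; split; lra.
have y0 : 0 <= 1 - theta / 2 by rewrite subr_ge0; case/andP: x01.
have G0 : 0 <= G by rewrite divr_ge0.
have f1 : 0 <= 1 + G / eta1 by rewrite addr_ge0 // divr_ge0 // ltW.
have half : (1 - theta / 2) ^+ t <= 1 / 2.
  by apply: one_minus_pow_half => //; rewrite /theta; move: tbeta; lra.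
(* [k >= n - K >= t^30 - t^26]; each block of [t] rows yields a factor [1/2], and there are at least
   [t^28] blocks. *)
have klo : (t * t ^ 28 <= k)%N.
  have h0 : (t ^ 30 <= k + K)%N by apply: leq_trans nlo _; move: nk; clear; lia.
  have h1 : (8 * t ^ 29 <= t ^ 30)%N by exact: mul_pow_le.
  have h2 : (K <= t ^ 29)%N by rewrite /K leq_exp2l.
  rewrite -expnS; move: h0 h1 h2; move: (t ^ 29)%N (t ^ 30)%N K (nat_of_ord k) => u v x y.
  by clear; lia.
have e1 : (1 - theta / 2) ^+ k <= (1 / 2) ^+ (t ^ 28).
  rewrite -(subnK klo) exprD -[leRHS]mul1r exprM; apply: ler_pM; rewrite ?exprn_ge0 //.
    by rewrite exprn_ile1 // lerBlDr lerDl; case/andP: x01.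
  by apply: lerXn2r; rewrite ?nnegrE ?exprn_ge0 ?divr_ge0.
have e2 : (1 + G / eta1) ^+ (n - k) <= t%:R ^+ ((e + 18) * K).
  have a1 : 1 + G / eta1 <= t%:R ^+ (e + 18).
    have G2 : G <= 2.
      by rewrite /G ler_pdivrMr // ler_peMr // ler1n muln_gt0 J0 andbT; case/andP: J1J.
    have h : G / eta1 <= 2 * (4 * L * t%:R ^+ e).
      have -> : 2 * (4 * L * t%:R ^+ e) = 2 / eta1.
        by rewrite /eta1 /eta; field; rewrite expf_neq0 ?lt0r_neq0.
      by apply: ler_wpM2r; rewrite ?invr_ge0 ?(ltW eta10).
    have h3 : 4 * L * t%:R ^+ e <= t%:R ^+ 17 * t%:R ^+ e by apply: four_L_le; rewrite exprn_ge0.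
    have h4 : 1 <= t%:R ^+ 17 * t%:R ^+ e :> R by rewrite -exprD exprn_ege1.
    have -> : t%:R ^+ (e + 18) = t%:R * (t%:R ^+ 17 * t%:R ^+ e) :> R.
      by rewrite -exprD -exprS; congr (_ ^+ _); clear; lia.
    have := ler_wpM2r (le_trans ler01 h4) tR8; lra.
  have a2 : 1 <= t%:R ^+ (e + 18) :> R by rewrite exprn_ege1.
  apply: le_trans (_ : (t%:R ^+ (e + 18)) ^+ (n - k) <= _).
    by apply: lerXn2r; rewrite ?nnegrE // exprn_ge0.
  rewrite exprM; exact: ler_weXn2l.
have e3 : #|{: code n K Q T}|%:R <= t%:R ^+ (1 + 3 * b * K) :> R.
  by rewrite -natrX ler_nat code_card.
apply: le_trans (_ : t%:R ^+ (1 + 3 * b * K) * ((1 / 2) ^+ (t ^ 28) * t%:R ^+ ((e + 18) * K)) <= _).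
  apply: ler_pM => //; first by rewrite mulr_ge0 ?exprn_ge0.
  by apply: ler_pM; rewrite ?exprn_ge0.
pose m := (t * ((e + 3 * b + 19) * K))%N.
have mle : (m + t <= t ^ 28)%N.
  have -> : (t ^ 28 = t * (t * K))%N by rewrite /K -!expnS.
  rewrite /m -mulnSr leq_mul2l; apply/orP; right.
  apply: leq_trans (_ : (e + 3 * b + 22) * K <= _)%N; last by rewrite leq_mul2r tc orbT.
  have : (0 < K)%N by rewrite expn_gt0 t0.
  by rewrite -addn1 !mulnDl; move: (e * K)%N (3 * b * K)%N => u v; clear; lia.
have e4 : t%:R ^+ (1 + 3 * b * K) * t%:R ^+ ((e + 18) * K) <= 2 ^+ m :> R.
  rewrite -exprD; apply: le_trans (_ : t%:R ^+ ((e + 3 * b + 19) * K) <= _).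
    apply: ler_weXn2l => //; have : (0 < K)%N by rewrite expn_gt0 t0.
    by rewrite !mulnDl; move: (e * K)%N (3 * b * K)%N => u v; clear; lia.
  rewrite /m [X in _ <= X]exprM; apply: lerXn2r; rewrite ?nnegrE ?exprn_ge0 //.
  by rewrite -natrX ler_nat ltnW // ltn_expl.
rewrite [_ ^+ (t ^ 28) * _]mulrC mulrA.
apply: le_trans (_ : 2 ^+ m * (1 / 2) ^+ (m + t) <= _).
  apply: ler_pM => //; rewrite ?mulr_ge0 ?exprn_ge0 ?divr_ge0 //.
  apply: ler_wiXn2l => //; first by rewrite divr_ge0.
  by rewrite ler_pdivrMr // mul1r ler1n.
have -> : 2 ^+ m * (1 / 2) ^+ (m + t) = (1 / 2) ^+ t :> R.
  by rewrite exprD mulrA -exprMn (_ : 2 * (1 / 2) = 1) ?expr1n ?mul1r; last by field.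
apply: le_trans half_pow_small _.
rewrite lef_pV2 ?posrE ?exprn_gt0 //; apply: ler_weXn2l => //.
exact: leq_addr.
Qed.

Lemma dist_small (k : 'I_n) : (n - k <= K)%N ->
  pexp w (fun X : family n =>
    (dist_span (row_vec z r X k) (row_vec z r X) k < (t%:R ^+ c)^-1)%R%:R) <= 2 * eta.
Proof.
move=> nk; case: (wm) => w0 w1 _ _.
rewrite mulr_natl mulr2n.
apply: le_trans (dist_prob (T := T) (eta := eta) r z k w0 w1 (ltW eta0) _) _; last first.
  by rewrite lerD2r; exact: bad_small.
have T0 : 0 < T%:R :> R by rewrite ltr0n expn_gt0 t0.
(* [c] exceeds the exponent of [T] by [33], and [2 n <= t^32]. *)
rewrite ler_pdivrMr ?exprn_gt0 // mulrAC ler_pdivlMr // mul1r.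
rewrite -!natrM -natrX ler_nat /c addnC expnD; apply: leq_mul.
  apply: leq_trans (_ : 2 * t ^ 31 <= _)%N; first by rewrite leq_mul2l n_le_pow orbT.
  apply: leq_trans (mul_pow_le _ (leq_trans _ t8)) _ => //.
  by rewrite leq_exp2l.
by rewrite /T leq_exp2l.
Qed.

End OneModel.

End Fixed.
End Core.

(** * Both models, the joint event and the final bound *)

Section Assembly.
Variable R : realType.

Lemma model_wB n (s : int) (r : signvec n) (z1 z2 beta : R) :
  let p := 2^-1 + s%:~R / (2 * n%:R) in
  0 < beta -> beta <= p -> beta <= 1 - p ->
  model r z1 z2 (wB R s) p 0 1 (beta ^+ 2 / 2).
Proof.
move=> p b0 bp b1p.
have p01 : 0 <= p <= 1 by apply/andP; split; lra.
split.
- exact: wB_ge0.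
- exact: wB_sum.
- by move=> N W u rr c1 c2 N1 h; exact: (wB_window p01 c1 c2 N1 h).
- move=> i a b rh l big; apply: (wB_nondeg p01 _ _ _ _ _ _ big); rewrite -/p; nra.
Qed.

Lemma model_wS n (s : int) (r : signvec n) (z1 z2 beta : R) (k0 m : nat) :
  let p := 2^-1 + s%:~R / (2 * n%:R) in
  0 < beta -> beta <= p -> beta <= 1 - p ->
  (2 * k0 + 1)%N%:Z = n%:Z + s -> (0 < n)%N -> (n <= m * m)%N ->
  model r z1 z2 (wS R s) p 1 (2 * (2 * (2 * m + 1)%:R / beta)) (beta ^+ 2 / 2).
Proof.
move=> p b0 bp b1p k0E n0 m2.
have p01 : 0 <= p <= 1 by apply/andP; split; lra.
split.
- exact: wS_ge0.
- exact: (wS_sum p01 k0E n0 b0 bp b1p m2).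
- by move=> N W u rr c1 c2 N1 h; exact: (wS_window p01 k0E n0 b0 bp b1p m2 c1 c2 N1 h).
- by move=> i a b rh l big; exact: (wS_nondeg p01 k0E n0 b0 bp b1p m2 _ _ _ _ big).
Qed.

Lemma abs_ln_prod (I : finType) (P : pred I) (x : I -> R) (U : R) : 1 <= U ->
  (forall k, P k -> U^-1 <= x k <= U) ->
  0 < \prod_(k | P k) x k /\ `|ln (\prod_(k | P k) x k)| <= #|P|%:R * ln U.
Proof.
move=> U1 xU; have U0 : 0 < U by apply: lt_le_trans U1.
have -> : #|P|%:R * ln U = \sum_(k | P k) ln U by rewrite (eq_bigl (mem P)) // sumr_const mulr_natl.
elim/big_rec2: _ => [|k y1 y2 Pk [y0 yl]]; first by rewrite ln1 normr0.
have /andP [x1 x2] := xU k Pk.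
have x0 : 0 < x k by apply: lt_le_trans x1; rewrite invr_gt0.
split; first by rewrite mulr_gt0.
rewrite lnM ?posrE //; apply: le_trans (ler_normD _ _) _; apply: lerD => //.
rewrite ler_norml -lnV ?posrE // !ler_ln ?posrE ?invr_gt0 //.
by rewrite x1.
Qed.

Lemma card_tail (n m : nat) : (#|[pred k : 'I_n | (n - k <= m.+1)%N]| <= m.+1)%N.
Proof.
pose f (k : 'I_n) : 'I_m.+1 := inord (n - k.+1).
have finj : {in [pred k : 'I_n | (n - k <= m.+1)%N] &, injective f}.
  move=> j k; rewrite !inE => j1 k1 /(congr1 (@nat_of_ord _)).
  have jn := ltn_ord j; have kn := ltn_ord k.
  rewrite /f !inordK; [|by move: j1 k1 jn kn; clear; lia..].
  by move=> e; apply/val_inj; move: e j1 k1 jn kn; clear; rewrite /=; lia.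
by rewrite -(card_in_imset finj) -[leqRHS]card_ord max_card.
Qed.

(** Pointwise, the indicator of [E] is at least [1] minus the indicators of the two failures, and
    the total weights are [1]. *)
Lemma prob_ge n (s : int) (E1 E2 : pred (family n)) (E : family n -> family n -> bool) :
  (forall x : signvec n, 0 <= wS R s x) -> \sum_(x : signvec n) wS R s x = 1 ->
  (forall x : signvec n, 0 <= wB R s x) -> \sum_(x : signvec n) wB R s x = 1 ->
  (forall X X', E1 X -> E2 X' -> E X X') ->
  1 - pexp (wS R s) (fun X : family n => (~~ E1 X)%:R)
    - pexp (wB R s) (fun X : family n => (~~ E2 X)%:R) <= prob s E.
Proof.
move=> S0 S1 B0 B1 EE.
set a := pexp (wS R s) _; set b := pexp (wB R s) _.
have e1 : \sum_(X : family n) wfam (wS R s) X = 1.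
  rewrite -[RHS](@pexp1 _ 'I_n _ _ S1); apply: eq_bigr => X _.
  by rewrite mulr1.
have e2 : \sum_(X : family n) wfam (wB R s) X = 1.
  rewrite -[RHS](@pexp1 _ 'I_n _ _ B1); apply: eq_bigr => X _.
  by rewrite mulr1.
have -> : 1 - a - b = \sum_(X : family n) \sum_(X' : family n)
    (wfam (wS R s) X * wfam (wB R s) X' * (1 - (~~ E1 X)%:R - (~~ E2 X')%:R)).
  transitivity (\sum_(X : family n) (wfam (wS R s) X * (1 - (~~ E1 X)%:R) - wfam (wS R s) X * b)).
    rewrite sumrB -mulr_suml e1 mul1r; congr (_ - _).
    rewrite -{1}e1 -sumrB; apply: eq_bigr => X _.
    by rewrite mulrBr mulr1.
  apply: eq_bigr => X _.
  transitivity (\sum_(X' : family n) (wfam (wS R s) X * (1 - (~~ E1 X)%:R) * wfam (wB R s) X' -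
     wfam (wS R s) X * (wfam (wB R s) X' * (~~ E2 X')%:R))).
    by rewrite sumrB -!mulr_sumr e2 mulr1.
  by apply: eq_bigr => X' _; ring.
apply: ler_sum => X _; apply: ler_sum => X' _.
have w0 : 0 <= wfam (wS R s) X * wfam (wB R s) X' by rewrite mulr_ge0 //; apply: prodr_ge0.
case: ifP => [_|/negbT nE].
  rewrite -[leRHS]mulr1; apply: ler_wpM2l => //.
  by case: (E1 X); case: (E2 X') => /=; lra.
rewrite -oppr_ge0 -mulrN mulr_ge0 //.
have : ~~ E1 X || ~~ E2 X' by rewrite -negb_and; apply: contra nE => /andP [? ?]; exact: EE.
by case: (E1 X); case: (E2 X') => //= _; lra.
Qed.

Lemma pexp_exists n (w : signvec n -> R) (P : pred 'I_n) (F : 'I_n -> family n -> bool) (x : R) :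
  (forall y, 0 <= w y) ->
  (forall k, P k -> pexp w (fun X : family n => (F k X)%:R) <= x) ->
  pexp w (fun X : family n => (~~ [forall (k | P k), ~~ F k X])%:R) <= #|P|%:R * x.
Proof.
move=> w0 Fx.
apply: le_trans (_ : \sum_(k | P k) pexp w (fun X : family n => (F k X)%:R) <= _); last first.
  apply: le_trans (_ : \sum_(k | P k) x <= _); first exact: ler_sum.
  by rewrite (eq_bigl (mem P)) // sumr_const mulr_natl.
rewrite -pexp_sum; apply: ler_pexp => // X.
rewrite negb_forall; case: (boolP [exists _, _]) => [/existsP [k]|_]; last by rewrite sumr_ge0.
rewrite negb_imply negbK => /andP [Pk Fk].
by rewrite (bigD1 k) //= Fk lerDl sumr_ge0.
Qed.

Lemma root_exists (a n : nat) : (0 < a)%N -> exists t, (t ^ a <= n)%N && (n < t.+1 ^ a)%N.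
Proof.
move=> a0; elim: n => [|n [t /andP [h1 h2]]]; first by exists 0%N; rewrite exp0n // exp1n.
have [lt|ge] := ltnP n.+1 (t.+1 ^ a)%N; first by exists t; rewrite lt (leq_trans h1).
exists t.+1; rewrite ge /=; apply: leq_ltn_trans h2 _.
by rewrite ltn_exp2r.
Qed.

Lemma nat_above (x : R) : exists m : nat, forall t, (m <= t)%N -> x <= t%:R.
Proof.
exists (Num.truncn x).+1 => t mt; apply: le_trans (ltW (truncnS_gt x)) _.
by rewrite ler_nat.
Qed.

End Assembly.

(** Collects what is needed at scale [t]: [t0] dominates all largeness requirements, and [c >= 67]
    lets [t^c] also bound the distances from above. *)
Lemma scale_constants (R : realType) (beta : R) (z : R[i]) (e : nat) : 0 < beta ->
  exists c t0 : nat, (67 <= c)%N /\ forall t, (t0 <= t)%N ->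
  [/\ (8 <= t)%N, 2 ^+ 19 / beta <= t%:R :> R, (t ^ 31 <= 2 ^ t)%N,
   forall n, (t ^ 30 <= n)%N -> (n < t.+1 ^ 30)%N -> (n <= t ^ 31)%N /\
     2 * n%:R + `|complex.Re z * Num.sqrt n%:R| + `|complex.Im z * Num.sqrt n%:R| <= t%:R ^+ 32 :> R &
   forall n (r : signvec n) (w : signvec n -> R) (p L : R) (kp J1 : nat),
     (t ^ 30 <= n)%N -> (n < t.+1 ^ 30)%N ->
     beta <= p -> beta <= 1 - p -> 1 <= L -> L <= t%:R ^+ 16 ->
     (J1 = 1%N /\ L = 1) \/ (J1 = (t ^ 12)%N /\ kp = 1%N) ->
     model r (complex.Re z * Num.sqrt n%:R) (complex.Im z * Num.sqrt n%:R) w p kp L (beta ^+ 2 / 2) ->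
     forall k : 'I_n, (n - k <= t ^ 26)%N ->
     pexp w (fun X : family n =>
       (dist_span (row_vec z r X k) (row_vec z r X) k < (t%:R ^+ c)^-1)%R%:R) <= 2 / t%:R ^+ e].
Proof.
move=> beta0.
have [a1 h1] := nat_above (2 + `|complex.Re z| + `|complex.Im z|).
have [a2 h2] := nat_above (32 / beta ^+ 2).
have [a3 h3] := nat_above (2 ^+ 19 / beta).
have [a4 h4] := pow_le_exp2 (e + 18).
have [a5 h5] := pow_le_exp2 31.
pose a6 := (e + 16)%N.
pose a7 := (e + 3 * (31 + 2 * (36 + (e + 16) * (4 * e + 102)) + 1) + 22)%N.
exists (34 + (e + 16) * (4 * e + 102) + 33)%N, (8 + 2 ^ 30 + a1 + a2 + a3 + a4 + a5 + a6 + a7)%N.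
split; first by rewrite addnAC leq_addr.
have le_sum x y u : (x + y <= u)%N -> (x <= u)%N /\ (y <= u)%N.
  by move=> h; split; apply: leq_trans h; rewrite ?leq_addr ?leq_addl.
move=> t /le_sum [/le_sum [/le_sum [/le_sum [/le_sum [/le_sum [/le_sum [/le_sum [t8 t30] t1] t2] t3] t4] t5] t6] t7].
split; [by []|exact: h3|exact: h5| |].
  move=> n nlo nhi; split; first exact: n_le_pow t8 t30 nhi.
  by have := rows_le t8 (h1 t t1) t30 nlo nhi; rewrite natrX.
move=> n r w p L kp J1 nlo nhi bp b1p L1 L16 kpJ wm k nk.
have tb : 32 <= beta ^+ 2 * t%:R by have := h2 t t2; rewrite ler_pdivrMr ?exprn_gt0 // mulrC.
exact: (dist_small beta0 t8 (h1 t t1) t30 t6 tb (h4 t t4) t7 nlo nhi bp b1p L1 L16 kpJ wm nk).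
Qed.

Lemma ln_le_exponent (R : realType) (n t : nat) : (0 < n)%N -> (n <= 2 ^ t)%N -> ln (n%:R : R) <= t%:R.
Proof.
move=> n0 nt; rewrite -[leRHS]expRK ler_ln ?posrE ?expR_gt0 ?ltr0n //.
rewrite -[t%:R]mulr1 expRM_natl; apply: le_trans (_ : 2%:R ^+ t <= _).
  by rewrite -natrX ler_nat.
apply: lerXn2r; rewrite ?nnegrE ?expR_ge0 //.
by apply: le_trans (expR_ge1Dx 1); rewrite -[1 + 1]/(2%:R).
Qed.

Lemma half_index (n : nat) (s : int) : odd (n + `|s|) -> (`|s| <= n)%N ->
  exists k0 : nat, (2 * k0 + 1)%N%:Z = n%:Z + s.
Proof.
move=> od sn; exists (`|(n%:Z + s)%R|%N)./2.
have o : odd `|(n%:Z + s)%R|%N.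
  move: od sn; case: s => m sn; first by rewrite -PoszD.
  by rewrite NegzE; move: sn; rewrite NegzE abszN => h1 h2; move: h1; lia.
have := odd_double_half `|(n%:Z + s)%R|%N; rewrite o -mul2n => E.
by move: E sn; clear; lia.
Qed.

Lemma bias_bounds (R : realFieldType) (eps x : R) : `|x| <= (1 - eps) / 2 ->
  eps / 2 <= 2^-1 + x /\ eps / 2 <= 1 - (2^-1 + x).
Proof. by rewrite ler_norml => /andP [h1 h2]; split; lra. Qed.

(** [(t+1)^15 <= 2^15 t^15], so the loss is at most [2^19 t^15 / beta], and one more factor [t]
    absorbs the constant. *)
Lemma slice_loss_bounds (R : realFieldType) (beta : R) (t : nat) : (0 < t)%N -> 0 < beta -> beta <= 1 ->
  2 ^+ 19 / beta <= t%:R ->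
  1 <= 2 * (2 * (2 * t.+1 ^ 15 + 1)%N%:R / beta) <= t%:R ^+ 16.
Proof.
move=> t0 b0 b1 tb.
have t1 : 1 <= t%:R :> R by rewrite ler1n.
set m := (t.+1 ^ 15)%N; have m1 : 1 <= m%:R :> R by rewrite ler1n expn_gt0.
have -> : 2 * (2 * (2 * m + 1)%:R / beta) = 4 * (2 * m%:R + 1) / beta.
  by rewrite natrD natrM; field; rewrite gt_eqF.
apply/andP; split; first by rewrite ler_pdivlMr // mul1r; lra.
have mle : m%:R <= 2 ^+ 15 * t%:R ^+ 15 :> R.
  rewrite -exprMn /m natrX; apply: lerXn2r; rewrite ?nnegrE ?mulr_ge0 //.
  by rewrite -natr1; lra.
apply: le_trans (_ : (2 ^+ 19 / beta) * t%:R ^+ 15 <= _); last first.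
  by rewrite [leRHS]exprS; apply: ler_wpM2r => //; rewrite exprn_ge0.
rewrite [X in _ <= X]mulrAC; apply: ler_wpM2r; first by rewrite invr_ge0 ltW.
rewrite (_ : 2 ^+ 19 * _ = 16 * (2 ^+ 15 * t%:R ^+ 15)); last by rewrite (exprD 2 4 15); ring.
by move: mle m1; move: (2 ^+ 15 * _) => u; lra.
Qed.

(** With [y = ln^8 n] the product runs over at most [y + 1] final indices, well within the last
    [t^26], where the distance estimate holds. *)
Lemma range_tail (R : realType) (n k t : nat) (y : R) : (2 <= t)%N -> 0 <= y -> y <= t%:R ^+ 8 ->
  n%:R - y < k.+1%:R ->
  (n - k <= (Num.truncn y).+1)%N /\ (n - k <= t ^ 26)%N.
Proof.
move=> t2 y0 yt h.
have h1 : (n - k <= (Num.truncn y).+1)%N.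
  rewrite leqNgt; apply/negP => lt.
  have lt' : (Num.truncn y < n - k.+1)%N by move: lt; clear; lia.
  move: lt'; rewrite truncn_lt_nat // natrB; last by move: lt; clear; lia.
  by move: h; lra.
split=> //; apply: leq_trans h1 _.
have h2 : (Num.truncn y <= t ^ 8)%N.
  by rewrite truncn_le_nat -natr1 natrX; apply: le_lt_trans yt _; rewrite ltrDl.
apply: leq_trans (_ : t ^ 9 <= _)%N; last by rewrite leq_exp2l.
rewrite (expnS t 8); have : (2 * t ^ 8 <= t * t ^ 8)%N by rewrite leq_mul2r t2 orbT.
have : (0 < t ^ 8)%N by rewrite expn_gt0 (ltnW t2).
by move: h2; move: (t ^ 8)%N (t * _)%N (Num.truncn y) => u v x; clear; lia.
Qed.

Lemma dist_span_le_pow (R : realType) (z : R[i]) (t n c : nat) (r : signvec n) (X : family n) (k : 'I_n) :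
  (2 <= t)%N -> (67 <= c)%N -> (0 < n)%N ->
  2 * n%:R + `|complex.Re z * Num.sqrt n%:R| + `|complex.Im z * Num.sqrt n%:R| <= t%:R ^+ 32 :> R ->
  dist_span (row_vec z r X k) (row_vec z r X) k <= t%:R ^+ c.
Proof.
move=> t2 c67 n0 rows; have /andP [_ h] := dist_span_le r z X k; apply: le_trans h _.
set u := `|_ * _| in rows *; set v := `|_ * _| in rows *.
have u0 : 0 <= u by exact: normr_ge0. have v0 : 0 <= v by exact: normr_ge0.
have n1 : 1 <= n%:R :> R by rewrite ler1n.
have tR2 : 2 <= t%:R :> R by rewrite ler_nat.
have tR1 : 1 <= t%:R :> R by apply: le_trans tR2; rewrite ler1n.
apply: le_trans (_ : t%:R ^+ 33 * t%:R ^+ 33 <= _); last by rewrite -exprD; apply: ler_weXn2l => //; exact: leq_trans c67.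
have p33 : 2 * t%:R ^+ 32 <= t%:R ^+ 33 :> R by rewrite [leRHS]exprS; apply: ler_wpM2r => //; rewrite exprn_ge0.
clearbody u v; move: rows p33 n1 u0 v0.
move: (t%:R ^+ 32) (t%:R ^+ 33) (n%:R) => a b x rows p33 n1 u0 v0; clear -rows p33 n1 u0 v0.
by apply: ler_pM; lra.
Qed.

Theorem theorem2p2 (R : realType) (eps : R) (z : R[i])
    (s : nat -> int) (r : forall n : nat, signvec n) :
  0 < eps <= 1 ->
  (forall n : nat, (`|s n|%:~R : R) <= (1 - eps) * n%:R) ->
  exists C : R, 0 < C /\ exists N : nat, forall n : nat, (N <= n)%N ->
    (* S is nonempty, i.e. n + s(n) is odd *)
    odd (n + `|s n|) ->
    1 - C / n%:R ^+ 100 <=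
    prob (s n) (fun X X' =>
      let T := S2 z (r n) X in let T' := S2 z (r n) X' in
      [&& 0 < T, 0 < T' &
          (`|ln T| + `|ln T'|) / n%:R <= C * (ln n%:R ^+ 9 / n%:R)]).
Proof.
move=> /andP [eps0 eps1] sbound.
have beta0 : 0 < eps / 2 by rewrite divr_gt0.
set beta := eps / 2 in beta0.
(* [n <= t^31], so [t^e] exceeds [n^101], which pays for [n^-100] and a union bound over at most [n]
   indices. The existential keeps [e] abstract. *)
have [e eE] : exists e : nat, e = (31 * 102)%N by exists (31 * 102)%N.
have [c [t0 [c67 tP]]] := scale_constants z e beta0.
(* [n >= exp 1] ensures [ln n >= 1]. *)
have [n1 n1P] := nat_above (sequences.expR 1 : R).
(* [4 c] is twice the bound [2 c] for one logarithm over [ln^9 n], and [4] is the coefficient of the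
   failure probability. *)
exists (4 * c%:R + 4); split; first by rewrite ltr_wpDl // mulr_ge0.
exists (t0.+1 ^ 30 + n1)%N => n nN od.
have [t /andP [nlo nhi]] := root_exists n (isT : (0 < 30)%N).
have nt0 : (t0.+1 ^ 30 <= n)%N by apply: leq_trans nN; exact: leq_addr.
have tt0 : (t0 <= t)%N.
  rewrite -ltnS -(ltn_exp2r _ _ (isT : (0 < 30)%N)).
  apply: leq_ltn_trans nhi; apply: leq_trans nt0.
  by rewrite leq_exp2r.
have [t8 tb t31 tn31 dist_small] := tP t tt0.
have t_gt0 : (0 < t)%N by apply: leq_trans t8.
have tR0 : 0 < t%:R :> R by rewrite ltr0n.
have tR1 : 1 <= t%:R :> R by rewrite ler1n.
have n0 : (0 < n)%N by apply: leq_trans nlo; rewrite expn_gt0 t_gt0.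
have nR0 : 0 < n%:R :> R by rewrite ltr0n.
have nR1 : 1 <= n%:R :> R by rewrite ler1n.
have [n31 rows] := tn31 n nlo nhi.
have tn : (t <= n)%N by apply: leq_trans nlo; rewrite -[leqLHS]expn1 leq_exp2l // (leq_trans _ t8).
pose p : R := 2^-1 + (s n)%:~R / (2 * n%:R).
have [bp b1p] : beta <= p /\ beta <= 1 - p.
  have := sbound n; rewrite intr_norm => sb; apply: bias_bounds.
  rewrite normrM [`|_^-1|]ger0_norm ?invr_ge0 ?mulr_ge0 // ler_pdivrMr ?mulr_gt0 //.
  by rewrite mulrA divfK // pnatr_eq0.
have [k0 k0E] : exists k0 : nat, (2 * k0 + 1)%N%:Z = n%:Z + s n.
  apply: half_index => //; rewrite -(ler_nat R).
  have := sbound n; rewrite -abszE -pmulrn => h; apply: le_trans h _.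
  by rewrite ler_piMl // lerBlDr lerDl ltW.
pose m := (t.+1 ^ 15)%N.
have m2 : (n <= m * m)%N by rewrite /m -expnD ltnW.
pose L : R := 2 * (2 * (2 * m + 1)%:R / beta).
have /andP [L1 L16] : 1 <= L <= t%:R ^+ 16.
  by apply: slice_loss_bounds => //; rewrite /beta ler_pdivrMr // mul1r (le_trans eps1) // ler1n.
pose inrange (k : 'I_n) : bool := n%:R - ln (n%:R : R) ^+ 8 < (k.+1)%:R.
(* On the good event every factor of the product lies between [U^-1] and [U]. *)
pose U : R := t%:R ^+ c.
have U0 : 0 < U by rewrite exprn_gt0.
pose far (k : 'I_n) (X : family n) := dist_span (row_vec z (r n) X k) (row_vec z (r n) X) k < U^-1.
pose y := ln (n%:R : R) ^+ 8.
have lnn1 : 1 <= ln (n%:R : R).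
  rewrite -[leLHS]expRK ler_ln ?posrE ?expR_gt0 //; apply: n1P.
  by apply: leq_trans nN; exact: leq_addl.
have lnn_t : ln (n%:R : R) <= t%:R by apply: ln_le_exponent => //; exact: leq_trans t31.
have y1 : 1 <= y by rewrite exprn_ege1.
have y0 : 0 <= y by apply: le_trans y1.
have yt : y <= t%:R ^+ 8 by apply: lerXn2r; rewrite ?nnegrE // (le_trans ler01).
have t2 : (2 <= t)%N by apply: leq_trans t8.
have range_K (k : 'I_n) : inrange k -> (n - k <= t ^ 26)%N.
  by move=> h; case: (range_tail t2 y0 yt h).
have range_card : #|inrange|%:R <= 2 * y.
  apply: le_trans (_ : (Num.truncn y).+1%:R <= _).
    rewrite ler_nat; apply: leq_trans (card_tail n _); apply: subset_leq_card.
    by apply/fintype.subsetP => k h; rewrite inE; case: (range_tail t2 y0 yt h).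
  have /andP [h _] := truncn_itv y0.
  by rewrite -natr1; move: h y1; clear; lra.
have U1 : 1 <= U by rewrite exprn_ege1.
have lnU : ln U <= c%:R * ln (n%:R : R).
  rewrite lnXn // -[ln _ *+ c]mulr_natl; apply: ler_wpM2l => //.
  by rewrite ler_ln ?posrE // ler_nat.
have good_S2 X : [forall (k | inrange k), ~~ far k X] ->
    0 < S2 z (r n) X /\ `|ln (S2 z (r n) X)| <= 2 * c%:R * ln (n%:R : R) ^+ 9.
  move=> /forall_inP ok.
  have [|h1 h2] := @abs_ln_prod R _ inrange (fun k => dist_span (row_vec z (r n) X k) (row_vec z (r n) X) k) U U1.
    move=> k kin; apply/andP; split; first by rewrite leNgt; exact: ok.
    exact: dist_span_le_pow t2 c67 n0 rows.
  split=> //; apply: le_trans h2 _.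
  rewrite (_ : 2 * _ * _ = (2 * y) * (c%:R * ln (n%:R : R))); last by rewrite /y exprSr; ring.
  by apply: ler_pM => //; apply: ln_ge0.
have eta_small : 2 * (n%:R * (2 / t%:R ^+ e)) <= 4 / n%:R ^+ 100 :> R.
  rewrite (_ : 2 * _ = 4 * (n%:R / t%:R ^+ e)); last by ring.
  apply: ler_wpM2l => //.
  rewrite ler_pdivrMr ?exprn_gt0 // mulrC ler_pdivlMr ?exprn_gt0 // -exprS.
  apply: le_trans (_ : (t%:R ^+ 31) ^+ 101 <= _).
    by apply: lerXn2r; rewrite ?nnegrE ?exprn_ge0 // -natrX ler_nat.
  by rewrite -exprM; apply: ler_weXn2l => //; rewrite eE leq_mul2l.
have fail (w : signvec n -> R) L' kp J1 : 1 <= L' -> L' <= t%:R ^+ 16 ->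
    (J1 = 1%N /\ L' = 1) \/ (J1 = (t ^ 12)%N /\ kp = 1%N) ->
    model (r n) (complex.Re z * Num.sqrt n%:R) (complex.Im z * Num.sqrt n%:R) w p kp L' (beta ^+ 2 / 2) ->
    pexp w (fun X : family n => (~~ [forall (k | inrange k), ~~ far k X])%:R) <= n%:R * (2 / t%:R ^+ e).
  move=> L'1 L'16 kJ wm; have [w0 _ _ _] := wm.
  apply: le_trans (_ : #|inrange|%:R * (2 / t%:R ^+ e) <= _).
    apply: pexp_exists => // k kin.
    exact: (dist_small n (r n) w p L' kp J1 nlo nhi bp b1p L'1 L'16 kJ wm k (range_K k kin)).
  apply: ler_wpM2r; first by rewrite divr_ge0 ?exprn_ge0.
  by rewrite ler_nat -[leqRHS]card_ord max_card.
have mS := model_wS (r n) (complex.Re z * Num.sqrt n%:R) (complex.Im z * Num.sqrt n%:R) beta0 bp b1p k0E n0 m2.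
have mB := model_wB (r n) (complex.Re z * Num.sqrt n%:R) (complex.Im z * Num.sqrt n%:R) beta0 bp b1p.
(* The slices use [kp = 1] and all [J] levels to offset [L]; Bernoulli rows have [L = 1] and a
   single level. *)
have fS := fail _ L 1%N (t ^ 12)%N L1 L16 (or_intror (conj erefl erefl)) mS.
have fB := fail _ 1 0%N 1%N (lexx _) (exprn_ege1 _ tR1) (or_introl (conj erefl erefl)) mB.
have [S0 S1 _ _] := mS; have [B0 B1 _ _] := mB.
pose good X := [forall (k | inrange k), ~~ far k X].
apply: le_trans (prob_ge (E1 := good) (E2 := good) S0 S1 B0 B1 _).
  have : (4 * c%:R + 4) / n%:R ^+ 100 >= 4 / n%:R ^+ 100 :> R.
    by apply: ler_wpM2r; rewrite ?invr_ge0 ?exprn_ge0 // lerDr mulr_ge0.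
  by move: fS fB eta_small; rewrite /good; lra.
move=> X X' /good_S2 [h1 h2] /good_S2 [h3 h4] /=.
rewrite h1 h3 /= mulrA ler_pM2r ?invr_gt0 //.
apply: le_trans (lerD h2 h4) _; rewrite -mulrDl; apply: ler_wpM2r.
  by rewrite exprn_ge0 // (le_trans ler01).
by clear; lra.
Qed.
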